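(* Let $p\ge 2$ and $n\ge 1$ be integers, let $\Sigma$ be a real $p\times p$ symmetric positive definite matrix, and let $x_1,\dots,x_n$ be i.i.d. $N(0,\Sigma)$ random vectors in $\mathbb{R}^p$. Let $\widehat S=\frac1n\sum_{i=1}^n x_ix_i^T$, $\widehat F=\frac{\mathrm{Tr}(\widehat S)}{p}I_p$, $$\hat\rho_{LW}=\frac{\sum_{i=1}^n\|x_ix_i^T-\widehat S\|_F^2}{n^2\left[\mathrm{Tr}(\widehat S^2)-\mathrm{Tr}^2(\widehat S)/p\right]},\qquad \widehat\Sigma_{LW}=(1-\hat\rho_{LW})\widehat S+\hat\rho_{LW}\widehat F .$$ Then, almost surely, $$E\left[\widehat\Sigma_{LW}\mid \widehat S\right]=(1-\hat\rho_{RBLW})\widehat S+\hat\rho_{RBLW}\widehat F,\qquad \hat\rho_{RBLW}=\frac{\frac{n-2}{n}\mathrm{Tr}(\widehat S^2)+\mathrm{Tr}^2(\widehat S)}{(n+2)\left[\mathrm{Tr}(\widehat S^2)-\mathrm{Tr}^2(\widehat S)/p\right]}.$$ Moreover, writing $\widehat\Sigma_{RBLW}=(1-\hat\rho_{RBLW})\widehat S+\hat\rho_{RBLW}\widehat F$, for every such $\Sigma$, $$E\{\|\widehat\Sigma_{RBLW}-\Sigma\|_F^2\}\le E\{\|\widehat\Sigma_{LW}-\Sigma\|_F^2\}.$$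
   Context: $\|\cdot\|_F$ is the Frobenius norm, $\mathrm{Tr}$ the trace, and $\mathrm{Tr}^2(A)=(\mathrm{Tr}(A))^2$. The denominator $\mathrm{Tr}(\widehat S^2)-\mathrm{Tr}^2(\widehat S)/p$ is almost surely positive under these assumptions. $\widehat\Sigma_{LW}$ is the (unclipped) Ledoit–Wolf estimator. *)

(* Defs.v *)
From HB Require Import structures.
From mathcomp Require Import all_boot all_order all_algebra.
From mathcomp Require Import all_classical all_reals all_analysis.
Set Implicit Arguments. Unset Strict Implicit. Unset Printing Implicit Defensive.
Import Order.TTheory GRing.Theory Num.Theory.
Local Open Scope classical_set_scope.
Local Open Scope ring_scope.

Section LW.
Context {R : realType} {p n : nat}.

Definition frob2 (A : 'M[R]_p) : R := \sum_(j < p) \sum_(k < p) A j k ^+ 2.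

Definition Shat (x : 'I_n -> 'cV[R]_p) : 'M[R]_p :=
  n%:R^-1 *: \sum_(i < n) (x i *m (x i)^T).

Definition Fhat (x : 'I_n -> 'cV[R]_p) : 'M[R]_p :=
  (\tr (Shat x) / p%:R) *: 1%:M.

Definition denomLW (x : 'I_n -> 'cV[R]_p) : R :=
  \tr (Shat x *m Shat x) - (\tr (Shat x)) ^+ 2 / p%:R.

Definition rho_LW (x : 'I_n -> 'cV[R]_p) : R :=
  (\sum_(i < n) frob2 (x i *m (x i)^T - Shat x)) /
  (n%:R ^+ 2 * denomLW x).

Definition Sigma_LW (x : 'I_n -> 'cV[R]_p) : 'M[R]_p :=
  (1 - rho_LW x) *: Shat x + rho_LW x *: Fhat x.

Definition rho_RBLW (x : 'I_n -> 'cV[R]_p) : R :=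
  ((n%:R - 2) / n%:R * \tr (Shat x *m Shat x) + (\tr (Shat x)) ^+ 2) /
  ((n%:R + 2) * denomLW x).

Definition Sigma_RBLW (x : 'I_n -> 'cV[R]_p) : 'M[R]_p :=
  (1 - rho_RBLW x) *: Shat x + rho_RBLW x *: Fhat x.

End LW.

Section Prob.
Context {d : measure_display} {T : measurableType d} {R : realType}.

Definition sigma_gen {A : Type} (f : A -> T -> R) : set (set T) :=
  <<s [set E | exists a (B : set R), measurable B /\ E = f a @^-1` B] >>.

Definition sigma_vec {p : nat} (X : T -> 'cV[R]_p) : set (set T) :=
  sigma_gen (fun j : 'I_p => fun w => X w j ord0).
Definition sigma_mx {p : nat} (M : T -> 'M[R]_p) : set (set T) :=
  sigma_gen (fun jk : 'I_p * 'I_p => fun w => M w jk.1 jk.2).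

(* X is a N(0,Sigma) random vector: every nonzero linear combination u^T X
   has law N(0, u^T Sigma u) (normal_prob takes mean and standard deviation) *)
Definition is_gaussian_vec (P : probability T R) {p : nat}
    (Sigma : 'M[R]_p) (X : T -> 'cV[R]_p) : Prop :=
  (forall j, measurable_fun setT (fun w => X w j ord0)) /\
  forall u : 'cV[R]_p, u != 0 -> forall B : set R, measurable B ->
    P ((fun w => (u^T *m X w) ord0 ord0) @^-1` B) =
    normal_prob 0 (Num.sqrt ((u^T *m Sigma *m u) ord0 ord0)) B.

Definition mutually_independent (P : probability T R) {n p : nat}
    (X : 'I_n -> T -> 'cV[R]_p) : Prop :=
  forall E : 'I_n -> set T, (forall i, sigma_vec (X i) (E i)) ->
    P (\big[setI/setT]_(i < n) E i) = (\prod_(i < n) P (E i))%E.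

Definition is_cond_exp (P : probability T R) (G : set (set T))
    (Y Z : T -> R) : Prop :=
  P.-integrable setT (EFin \o Y) /\
  P.-integrable setT (EFin \o Z) /\
  (forall B : set R, measurable B -> G (Z @^-1` B)) /\
  forall A, G A -> (\int[P]_(w in A) (Y w)%:E = \int[P]_(w in A) (Z w)%:E)%E.

End Prob.

Definition sym_posdef {R : realType} {p : nat} (Sigma : 'M[R]_p) : Prop :=
  Sigma^T = Sigma /\ forall u : 'cV[R]_p, u != 0 -> 0 < (u^T *m Sigma *m u) ord0 ord0.

(* Main.v *)
(* With g_il = <x_i, x_l>, each entry of Sigma_LW - Sigma_RBLW is a constant times
   the sum over i <> l of [(g_ii - g_ll)^2 / 2 - 2 g_il^2] times a function of Shat.
   Replacing (x_i, x_l) by ((x_i + x_l) / sqrt 2, (x_i - x_l) / sqrt 2) preserves the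
   law of the Gaussian sample, preserves Shat, and changes the sign of the bracket;
   hence every term integrates to 0 over every event of sigma(Shat).

   The terms are integrable because they are O(|x|^4 / sqrt denomLW), with all
   moments of |x| finite and E denomLW^(-3/4) finite when n >= 2. Indeed, up to a constant,
   denomLW is at least |sum_m zeta_m^2|^2 with zeta_m = x_(m,j0) + i x_(m,j1).
   Conditionally on the other rows, the sum is zeta_i^2 - r^2 = (zeta_i - r)(zeta_i + r),
   and normal variables have bounded densities: integrating out one row leaves a
   singularity |r|^(-3/2), with r^2 a sum over the remaining rows, and integrating
   out a second row leaves a finite quantity.

   The mean square inequality is the conditional Jensen inequality for each entry. *)
Require Import Defs.
From HB Require Import structures.
From mathcomp Require Import all_boot all_order all_algebra.
From mathcomp Require Import all_classical all_reals all_analysis.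
From mathcomp Require Import measurable_realfun ring lra.
Set Implicit Arguments. Unset Strict Implicit. Unset Printing Implicit Defensive.
Import Order.TTheory GRing.Theory Num.Theory.
Import numFieldNormedType.Exports.
Local Open Scope classical_set_scope.
Local Open Scope ring_scope.

(** * Laws of finite families of real random variables *)

(** The Gaussian hypothesis gives only the laws of single linear forms of each row, and independence
    gives only product formulas for events: no joint density is at hand. Both uses of normality, the
    invariance under a rotation of two rows and the integration of one entry with others frozen, are
    therefore equalities of laws on a space of coordinates, checked on integrals of cosines of
    linear forms. Of the normal characteristic function it matters only that it is real, depends on
    the variance alone, and is multiplicative in it. Tonelli and the transfer of laws are applied to
    nonnegative functions, hence the recurring [1 + cos].

    The exponent 3/4 balances two needs. Young's inequality splits [|x|^4 denomLW^(-1/2)] into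
    [|x|^12 + denomLW^(-3/4)], up to constants, whence the moments of order 12; and the second term
    is only as singular as [|zeta - r|^(-3/2)], which is integrable in the plane. For [n = 1] there
    is no pair of rows and the two estimators coincide. Square integrability is never established:
    the mean square inequality is proved in [[0, +oo]]. *)

Definition lower_boxes (R : realType) (K : finType) : set (set (K -> R)) :=
  [set E | exists s : seq (K * R),
     E = [set x | all (fun kc => x kc.1 < kc.2) s]].

Arguments lower_boxes : clear implicits.
Notation coords R K := (g_sigma_algebraType (lower_boxes R K)).

Section coordinates.
Context {R : realType} {K : finType}.
Implicit Types s : seq (K * R).

Lemma measurable_box s :
  measurable ([set x | all (fun kc => x kc.1 < kc.2) s] : set (coords R K)).
Proof. by apply: sub_sigma_algebra; exists s. Qed.

(** Concatenating the lists of constraints intersects the boxes. Lists thus give a pi-system, as the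
    uniqueness theorem for measures demands, and boxes can be handled by induction. *)
Lemma boxes_setI : setI_closed (lower_boxes R K).
Proof.
move=> _ _ [s ->] [t ->]; exists (s ++ t).
by apply/seteqP; split => x /=; rewrite all_cat => /andP.
Qed.

Lemma measurable_coord (k : K) :
  measurable_fun setT (fun x : coords R K => x k).
Proof.
apply: (measurability _ (RGenInftyO.measurableE R)) => _ [_ [c ->] <-].
rewrite setTI; apply: sub_sigma_algebra; exists [:: (k, c)].
by apply/seteqP; split => x /=; rewrite in_itv/= ?andbT.
Qed.

Lemma measurable_coords d (T : measurableType d) (F : T -> coords R K) :
  (forall k, measurable_fun setT (fun w => F w k)) -> measurable_fun setT F.
Proof.
move=> mF; apply: measurability => // _ [_ [s ->] <-]; rewrite setTI.
elim: s => [|[k c] s IH] /=.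
  by rewrite (_ : _ @^-1` _ = setT)//; apply/seteqP; split.
rewrite (_ : _ @^-1` _ = (fun w => F w k) @^-1` `]-oo, c[ `&`
    F @^-1` [set x | all (fun kc => x kc.1 < kc.2) s]).
  by apply: measurableI => //; rewrite -[X in measurable X]setTI; apply: mF.
by apply/seteqP; split => w /=; rewrite in_itv/= => /andP.
Qed.

End coordinates.

Section law_uniqueness.
Context {R : realType} {K : finType} d1 d2 (T1 : measurableType d1)
  (T2 : measurableType d2).
Variables (P1 : probability T1 R) (P2 : probability T2 R).
Variables (F1 : T1 -> coords R K) (F2 : T2 -> coords R K).
Hypotheses (mF1 : measurable_fun setT F1) (mF2 : measurable_fun setT F2).

Lemma law_eq_boxes :
  (forall s : seq (K * R),
     P1 [set w | all (fun kc => F1 w kc.1 < kc.2) s] =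
     P2 [set w | all (fun kc => F2 w kc.1 < kc.2) s]) ->
  forall A, measurable A -> P1 (F1 @^-1` A) = P2 (F2 @^-1` A).
Proof.
move=> H A mA.
pose X1 : {RV P1 >-> coords R K} := HB.pack F1 (isMeasurableFun.Build _ _ _ _ F1 mF1).
pose X2 : {RV P2 >-> coords R K} := HB.pack F2 (isMeasurableFun.Build _ _ _ _ F2 mF2).
change (distribution P1 X1 A = distribution P2 X2 A).
apply: (@measure_unique _ R (coords R K) (lower_boxes R K) (fun=> setT)) => //.
- exact: boxes_setI.
- by move=> _; exists [::]; apply/seteqP; split.
- by rewrite bigcup_const.
- by move=> _ [s ->]; exact: H.
- by move=> k; change (P1 setT < +oo)%E; rewrite probability_setT ltry.
Qed.

Lemma law_eq_ge0_integral (g : coords R K -> \bar R) :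
  (forall A, measurable A -> P1 (F1 @^-1` A) = P2 (F2 @^-1` A)) ->
  measurable_fun setT g -> (forall x, 0 <= g x)%E ->
  (\int[P1]_w g (F1 w) = \int[P2]_w g (F2 w))%E.
Proof.
move=> H mg g0.
pose X1 : {RV P1 >-> coords R K} := HB.pack F1 (isMeasurableFun.Build _ _ _ _ F1 mF1).
pose X2 : {RV P2 >-> coords R K} := HB.pack F2 (isMeasurableFun.Build _ _ _ _ F2 mF2).
have := @ge0_integral_distribution _ _ _ _ _ P1 X1 g mg g0.
have := @ge0_integral_distribution _ _ _ _ _ P2 X2 g mg g0.
move=> <- <-; apply: eq_measure_integral => A mA _; exact: H.
Qed.

End law_uniqueness.

(** * Uniqueness of a law with given characteristic function *)

Definition bounded_mfun d (T : measurableType d) (R : realType) (f : T -> R) :=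
  measurable_fun setT f /\ exists M, forall x, `|f x| <= M.

Section bounded_mfun.
Context d (T : measurableType d) {R : realType}.
Variable P : probability T R.
Implicit Types f g : T -> R.

Lemma bounded_mfun_integrable f : bounded_mfun f ->
  P.-integrable setT (EFin \o f).
Proof.
move=> [mf [M fM]]; apply: measurable_bounded_integrable => //.
  by rewrite (le_lt_trans (probability_le1 P measurableT)) ?ltry.
exists M; split; first exact: num_real.
by move=> y My x _ /=; rewrite (le_trans (fM x))// ltW.
Qed.

Lemma bounded_mfunD f g : bounded_mfun f -> bounded_mfun g ->
  bounded_mfun (fun x => f x + g x).
Proof.
move=> [mf [M fM]] [mg [N gN]]; split; first exact: measurable_funD.
by exists (M + N) => x; rewrite (le_trans (ler_normD _ _))// lerD.
Qed.

Lemma bounded_mfunM f g : bounded_mfun f -> bounded_mfun g ->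
  bounded_mfun (fun x => f x * g x).
Proof.
move=> [mf [M fM]] [mg [N gN]]; split; first exact: measurable_funM.
by exists (M * N) => x; rewrite normrM ler_pM.
Qed.

Lemma bounded_mfun_cst c : bounded_mfun (fun _ : T => c : R).
Proof. by split => //; exists `|c|. Qed.

Lemma bounded_mfun_cvg (f_ : nat -> T -> R) f (M : R) :
  (forall n, measurable_fun setT (f_ n)) -> (forall n x, `|f_ n x| <= M) ->
  (forall x, f_ ^~ x @ \oo --> f x) -> bounded_mfun f.
Proof.
move=> mf_ f_M f_f; split.
  by apply: (measurable_fun_cvg mf_) => x _; exact: f_f.
exists M => x; rewrite -(cvg_lim _ (cvg_norm (f_f x)))//.
apply: limr_le; first by apply: cvgP; exact: (cvg_norm (f_f x)).
exact: nearW.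
Qed.

Lemma bounded_convergence (f_ : nat -> T -> R) f (M : R) :
  (forall n, measurable_fun setT (f_ n)) -> (forall n x, `|f_ n x| <= M) ->
  (forall x, f_ ^~ x @ \oo --> f x) ->
  (\int[P]_x f_ n x) @[n --> \oo] --> \int[P]_x f x.
Proof.
move=> mf_ f_M f_f.
have bf := bounded_mfun_cvg mf_ f_M f_f; have mf := bf.1.
have [] := @dominated_convergence _ T R P setT measurableT
  (fun n => EFin \o f_ n) (EFin \o f) (cst M%:E).
- by move=> n; exact/measurable_EFinP.
- exact/measurable_EFinP.
- by apply: aeW => x _; apply: cvg_EFin; [exact: nearW|exact: f_f].
- by apply: bounded_mfun_integrable; exact: bounded_mfun_cst.
- by apply: aeW => x n _ /=; rewrite lee_fin.
move=> _ _ cv; rewrite /Rintegral; apply: fine_cvg; rewrite fineK//.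
by apply: integrable_fin_num => //; exact: bounded_mfun_integrable.
Qed.

End bounded_mfun.

Lemma bernoulli_le (R : realType) (a : R) N : 0 <= a <= 1 -> 1 - N%:R * a <= (1 - a) ^+ N.
Proof.
move=> /andP[a0 a1]; elim: N => [|N IH]; first by rewrite mul0r subr0 expr0.
rewrite exprS; apply: (@le_trans _ _ ((1 - a) * (1 - N%:R * a))); last first.
  by rewrite ler_wpM2l// subr_ge0.
rewrite -natr1.
have : 0 <= N%:R * a * a by rewrite !mulr_ge0.
by lra.
Qed.

(** Write [z ^+ n = w ^+ n * w ^+ n] with [w = Num.sqrt z]: one factor absorbs [n], because
    [(1 - w) (1 + ... + w^(n-1))] is at least [(1 - w) n w^n], and the other tends to 0. *)
Lemma cvg_natmul_expr (R : realType) (z : R) : 0 <= z < 1 ->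
  (n%:R * z ^+ n) @[n --> \oo] --> (0 : R).
Proof.
move=> /andP[z0 z1]; pose w := Num.sqrt z.
have w0 : 0 <= w by exact: sqrtr_ge0.
have w1 : w < 1 by rewrite -sqrtr1 ltr_sqrt.
have zE : z = w * w by rewrite -expr2 sqr_sqrtr.
have nw n : n%:R * w ^+ n * (1 - w) <= 1 - w ^+ n.
  elim: n => [|n IH]; first by rewrite mul0r mul0r expr0 subrr.
  have u0 : 0 <= w ^+ n by rewrite exprn_ge0.
  have u1 : w * w ^+ n <= 1 by rewrite -exprS exprn_ile1// ltW.
  rewrite exprS -natr1.
  have : w * (n%:R * w ^+ n * (1 - w)) <= w * (1 - w ^+ n) by rewrite ler_wpM2l.
  have : w * w ^+ n * (1 - w) <= 1 * (1 - w) by rewrite ler_wpM2r// subr_ge0 ltW.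
  by move: (w ^+ n) (n%:R : R) => *; lra.
have nz n : n%:R * z ^+ n <= (1 - w)^-1 * w ^+ n.
  rewrite zE exprMn mulrA ler_wpM2r ?exprn_ge0//.
  rewrite -[leRHS]mul1r ler_pdivlMr ?subr_gt0// (le_trans (nw n))//.
  by rewrite lerBlDr lerDl exprn_ge0.
apply: (@squeeze_cvgr _ _ _ _ (cst 0) (fun n => (1 - w)^-1 * w ^+ n)).
- by near=> n; rewrite nz mulr_ge0// exprn_ge0.
- exact: cvg_cst.
- rewrite -[X in _ --> X](mulr0 (1 - w)^-1); apply: cvgM; first exact: cvg_cst.
  by apply: cvg_expr; rewrite ger0_norm.
Unshelve. all: end_near. Qed.

(** The exponent times [y ^+ m] is [m (2 y)^m], which tends to 0 or to infinity according to the
    side of 1/2; Bernoulli's inequality and [1 - u <= expR (- u)] conclude. The extra factor [m]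
    settles the boundary [y = 1/2], where the limit is 0. *)
Lemma cvg_threshold (R : realType) (y : R) : 0 <= y <= 1 ->
  (1 - y ^+ m) ^+ (m * 2 ^ m) @[m --> \oo] --> ((y < 1 / 2)%R%:R : R).
Proof.
move=> /andP[y0 y1].
have ym m : 0 <= y ^+ m <= 1 by rewrite exprn_ge0//= exprn_ile1.
case: ltP => y2.
  apply: (@squeeze_cvgr _ _ _ _ (fun m => 1 - m%:R * (2 * y) ^+ m) (cst 1)).
  - near=> m; apply/andP; split; last first.
      by rewrite exprn_ile1// ?subr_ge0 ?lerBlDr ?lerDl; case/andP: (ym m).
    rewrite exprMn mulrA -natrX -natrM; exact: bernoulli_le.
  - rewrite -[X in _ --> X]subr0; apply: cvgB; first exact: cvg_cst.
    by apply: cvg_natmul_expr; apply/andP; split; lra.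
  - exact: cvg_cst.
apply: (@squeeze_cvgr _ _ _ _ (cst 0) (fun m => expR (- m%:R))).
- near=> m; apply/andP; split.
    by rewrite exprn_ge0// subr_ge0; case/andP: (ym m).
  apply: (@le_trans _ _ (expR (- y ^+ m) ^+ (m * 2 ^ m))).
    by rewrite lerXn2r// ?nnegrE ?expR_ge0 ?subr_ge0 ?expR_ge1Dx//; case/andP: (ym m).
  rewrite -expRM_natl ler_expR mulrN lerN2 natrM natrX -mulrA -exprMn.
  by rewrite ler_peMr// exprn_ege1//; lra.
- exact: cvg_cst.
- exact: cvgn_expR.
Unshelve. all: end_near. Qed.

(** Real trigonometric polynomials. The phase [c] yields the sines and the constants, so that no
    complex exponential is needed, and product-to-sum formulas make the class an algebra. *)
Inductive trigf (R : realType) (K : finType) : ((K -> R) -> R) -> Prop :=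
| trig_cos u c : trigf (fun x => cos (\sum_k u k * x k + c))
| trig_add f g : trigf f -> trigf g -> trigf (fun x => f x + g x)
| trig_scale a f : trigf f -> trigf (fun x => a * f x).

Section trigf.
Context {R : realType} {K : finType}.
Implicit Types f g : coords R K -> R.

Lemma trig_cst (c : R) : trigf (fun _ : K -> R => c).
Proof.
have -> : (fun _ : K -> R => c) = (fun x => c * cos (\sum_(k : K) 0 * x k + 0)).
  by apply/funext => x; rewrite big1 ?addr0 ?cos0 ?mulr1// => k _; rewrite mul0r.
exact/trig_scale/trig_cos.
Qed.

Lemma trig_mul (f g : (K -> R) -> R) : trigf f -> trigf g ->
  trigf (fun x => f x * g x).
Proof.
elim=> [u c|f1 f2 _ IH1 _ IH2|a f1 _ IH1] tg.
- elim: tg => [v e|g1 g2 _ IH1 _ IH2|a g1 _ IH1].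
  + rewrite (_ : (fun x => _) = (fun x => 2^-1 *
        (cos (\sum_k (u k + v k) * x k + (c + e)) +
         cos (\sum_k (u k - v k) * x k + (c - e))))).
      by apply/trig_scale/trig_add; exact: trig_cos.
    apply/funext => x.
    have -> : \sum_k (u k + v k) * x k + (c + e) =
        (\sum_k u k * x k + c) + (\sum_k v k * x k + e).
      by under eq_bigr do rewrite mulrDl; rewrite big_split/= addrACA.
    have -> : \sum_k (u k - v k) * x k + (c - e) =
        (\sum_k u k * x k + c) - (\sum_k v k * x k + e).
      under eq_bigr do rewrite mulrBl.
      by rewrite sumrB opprD addrACA.
    move: (\sum_k u k * x k + c) (\sum_k v k * x k + e) => A B.
    by rewrite cosD cosB; field.
  + rewrite (_ : (fun x => _) = (fun x => cos (\sum_k u k * x k + c) * g1 x +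
      cos (\sum_k u k * x k + c) * g2 x)); first exact: trig_add.
    by apply/funext => x; rewrite mulrDr.
  + rewrite (_ : (fun x => _) = (fun x => a * (cos (\sum_k u k * x k + c) * g1 x))).
      exact: trig_scale.
    by apply/funext => x; rewrite mulrCA.
- rewrite (_ : (fun x => _) = (fun x => f1 x * g x + f2 x * g x)).
    by apply: trig_add; [exact: IH1|exact: IH2].
  by apply/funext => x; rewrite mulrDl.
- rewrite (_ : (fun x => _) = (fun x => a * (f1 x * g x))).
    by apply: trig_scale; exact: IH1.
  by apply/funext => x; rewrite mulrA.
Qed.

Lemma trig_exp (f : (K -> R) -> R) n : trigf f -> trigf (fun x => f x ^+ n).
Proof.
move=> tf; elim: n => [|n IH]; first exact: (trig_cst 1).
under eq_fun do rewrite exprS.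
exact: trig_mul.
Qed.

Lemma trig_bounded (f : coords R K -> R) : trigf f -> bounded_mfun f.
Proof.
elim=> [u c|f1 f2 _ IH1 _ IH2|a f1 _ IH1].
- split; last by exists 1 => x; exact: cos_max.
  apply: (measurableT_comp (f := @cos R)).
    by apply: continuous_measurable_fun; exact: continuous_cos.
  apply: measurable_funD => //; apply: measurable_sum => k.
  by apply: measurable_funM => //; exact: measurable_coord.
- exact: bounded_mfunD.
- exact/bounded_mfunM/IH1/bounded_mfun_cst.
Qed.

(* The trigonometric polynomial [1 - ((1 + sin ((x_k - c) / N)) / 2)^m]^(m 2^m)
   tends to the indicator of [sin ((x_k - c) / N) < 0] as m goes to infinity,
   which in turn tends to the indicator of [x_k < c] as N goes to infinity. *)
Definition trig_step (k : K) (c : R) (N m : nat) (x : coords R K) : R :=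
  (1 - ((1 + sin ((x k - c) / N.+1%:R)) / 2) ^+ m) ^+ (m * 2 ^ m).

Lemma trig_stepP k c N m : trigf (trig_step k c N m).
Proof.
have ts : trigf (fun x : K -> R => sin ((x k - c) / N.+1%:R)).
  rewrite (_ : (fun x => _) = (fun x => cos (\sum_(l : K)
    (if l == k then N.+1%:R^-1 else 0) * x l + (- (c / N.+1%:R) - pi / 2)))).
    exact: trig_cos.
  apply/funext => x; rewrite addrA cosBpihalf; congr sin.
  rewrite (bigD1 k)//= eqxx big1 ?addr0; last by move=> l /negPf ->; rewrite mul0r.
  by rewrite mulrBl mulrC.
rewrite /trig_step; apply: trig_exp.
rewrite (_ : (fun x => _) = (fun x : K -> R =>
   1 + -1 * ((2^-1 * (1 + sin ((x k - c) / N.+1%:R))) ^+ m))).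
  apply: trig_add; first exact: trig_cst.
  apply/trig_scale/trig_exp/trig_scale/trig_add => //; exact: trig_cst.
by apply/funext => x; rewrite mulN1r mulrC.
Qed.

Let half_sin (y : R) : 0 <= (1 + sin y) / 2 <= 1.
Proof. by have := sin_geN1 y; have := sin_le1 y; lra. Qed.

Lemma trig_step_norm k c N m x : `|trig_step k c N m x| <= 1.
Proof.
have /andP[h0 h1] := half_sin ((x k - c) / N.+1%:R).
have u0 : 0 <= 1 - ((1 + sin ((x k - c) / N.+1%:R)) / 2) ^+ m.
  by rewrite subr_ge0 exprn_ile1.
by rewrite ger0_norm ?exprn_ge0// exprn_ile1// lerBlDr lerDl exprn_ge0.
Qed.

Lemma trig_step_cvg k c N x : trig_step k c N m x @[m --> \oo] -->
  ((sin ((x k - c) / N.+1%:R) < 0)%R%:R : R).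
Proof.
rewrite (_ : (sin _ < 0) = ((1 + sin ((x k - c) / N.+1%:R)) / 2 < 1 / 2)).
  exact: cvg_threshold.
by apply/idP/idP; lra.
Qed.

(** As soon as [N] exceeds [|x k - c|], the argument lies in []-1, 1[], where the sine has the sign
    of its argument: the sequence is eventually constant. *)
Lemma sin_neg_cvg k c (x : coords R K) :
  ((sin ((x k - c) / N.+1%:R) < 0)%R%:R : R) @[N --> \oo] --> ((x k < c)%R%:R : R).
Proof.
pose y := x k - c.
have [M yM] : exists M : nat, `|y| < M%:R.
  by exists (Num.truncn `|y|).+1; rewrite truncnS_gt.
apply: cvg_near_cst; near=> N.
have N0 : 0 < N.+1%:R :> R by [].
have yN : `|y / N.+1%:R| < 1.
  rewrite normrM normfV (ger0_norm (ltW N0)) ltr_pdivrMr// mul1r.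
  rewrite (lt_le_trans yM)// ler_nat; apply: leqW; near: N; exact: nbhs_infty_ge.
have pi2 : 2 <= pi :> R by exact: pi_ge2.
have -> : (x k < c) = (y < 0) by rewrite subr_lt0.
congr (_%:R); rewrite -/y; set z := y / _ in yN *.
have [y0|y0|y0] := ltgtP y 0; last 1 first.
- by rewrite /z y0 mul0r sin0 ltxx.
- rewrite -oppr_gt0 -sinN; have yd : z < 0 by rewrite pmulr_llt0 ?invr_gt0.
  rewrite ltr0_norm// in yN.
  by rewrite sin2_gt0//; apply/andP; split; lra.
- have yd : 0 < z by rewrite divr_gt0.
  rewrite gtr0_norm// in yN; rewrite ltNge (ltW (sin2_gt0 _))//.
  by apply/andP; split; lra.
Unshelve. all: end_near. Qed.

End trigf.

(** * Laws determined by their linear forms *)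

Section cramer_wold.
Context {R : realType} {K : finType} d1 d2 (T1 : measurableType d1)
  (T2 : measurableType d2).
Variables (P1 : probability T1 R) (P2 : probability T2 R).
Variables (F1 : T1 -> coords R K) (F2 : T2 -> coords R K).
Hypotheses (mF1 : measurable_fun setT F1) (mF2 : measurable_fun setT F2).
Hypothesis cf_eq : forall (u : K -> R) c,
  \int[P1]_w cos (\sum_k u k * F1 w k + c) =
  \int[P2]_w cos (\sum_k u k * F2 w k + c).

Let bounded_comp d (T : measurableType d) (F : T -> coords R K)
    (f : coords R K -> R) :
  measurable_fun setT F -> bounded_mfun f -> bounded_mfun (f \o F).
Proof. by move=> mF [mf [M fM]]; split; [exact: (measurableT_comp mf mF)|exists M => w; exact: fM]. Qed.

Let trig_eq f : trigf f -> \int[P1]_w f (F1 w) = \int[P2]_w f (F2 w).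
Proof.
elim=> [u c|f1 f2 t1 IH1 t2 IH2|a f1 t1 IH1]; first exact: cf_eq.
- have [b1 b2] := (trig_bounded t1, trig_bounded t2).
  rewrite !RintegralD// ?IH1 ?IH2//; apply: bounded_mfun_integrable;
    exact: (bounded_comp _ (f := f1)) || exact: (bounded_comp _ (f := f2)).
- have b1 := trig_bounded t1.
  by rewrite !RintegralZl// ?IH1//; apply: bounded_mfun_integrable;
    exact: (bounded_comp _ (f := f1)).
Qed.

(** Testing against every trigonometric factor [f], not only [f = 1], makes the class stable under
    multiplication by [trig_step], hence, after two bounded limits, by the indicator of a half
    line. *)
Let good (h : coords R K -> R) := bounded_mfun h /\ forall f, trigf f ->
  \int[P1]_w (h (F1 w) * f (F1 w)) = \int[P2]_w (h (F2 w) * f (F2 w)).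

Let good_trig h f : good h -> trigf f -> good (fun x => h x * f x).
Proof.
move=> [bh H] tf; split; first exact/bounded_mfunM/trig_bounded.
move=> g tg; have := H _ (trig_mul tf tg).
by under eq_Rintegral do rewrite mulrA; under [in RHS]eq_Rintegral do rewrite mulrA.
Qed.

Let good_cvg (h_ : nat -> coords R K -> R) h M : (forall n, good (h_ n)) ->
  (forall n x, `|h_ n x| <= M) -> (forall x, h_ ^~ x @ \oo --> h x) -> good h.
Proof.
move=> gh hM hh.
have mh n : measurable_fun setT (h_ n) by have [[]] := gh n.
split=> [|f tf]; first exact: (bounded_mfun_cvg mh hM hh).
have [mf [N fN]] := trig_bounded tf.
have cv d (T : measurableType d) (P : probability T R) (F : T -> coords R K) :
    measurable_fun setT F ->
    \int[P]_w (h_ n (F w) * f (F w)) @[n --> \oo] --> \int[P]_w (h (F w) * f (F w)).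
  move=> mF; apply: (@bounded_convergence _ _ _ _ (fun n w => h_ n (F w) * f (F w))
    _ (M * N)).
  - by move=> n; apply: measurable_funM; exact: measurableT_comp.
  - by move=> n w; rewrite normrM ler_pM.
  - by move=> w; apply: cvgM; [exact: hh|exact: cvg_cst].
have c1 := cv _ _ P1 F1 mF1; have c2 := cv _ _ P2 F2 mF2.
rewrite -(cvg_lim _ c1)// -(cvg_lim _ c2)//; congr (lim _).
suff -> : (fun n => \int[P1]_w (h_ n (F1 w) * f (F1 w))) =
   (fun n => \int[P2]_w (h_ n (F2 w) * f (F2 w))) by [].
by apply/funext => n; have [_] := gh n; exact.
Qed.

Let good_half_line h k c : good h -> good (fun x => h x * (x k < c)%R%:R).
Proof.
move=> gh; have [_ [M hM]] := gh.1.
apply: (@good_cvg (fun N x => h x * (sin ((x k - c) / N.+1%:R) < 0)%R%:R) _ M).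
- move=> N; apply: (@good_cvg (fun m x => h x * trig_step k c N m x) _ M).
  + by move=> m; apply: good_trig => //; exact: trig_stepP.
  + move=> m x; rewrite normrM -[leRHS]mulr1 ler_pM//; exact: trig_step_norm.
  + by move=> x; apply: cvgM; [exact: cvg_cst|exact: trig_step_cvg].
- move=> N x; rewrite normrM -[leRHS]mulr1 ler_pM//.
  by case: (_ < _) => /=; rewrite ?normr1 ?normr0.
- by move=> x; apply: cvgM; [exact: cvg_cst|exact: sin_neg_cvg].
Qed.

(** Starting from the constant 1 and multiplying by one half line at a time, every box indicator is
    [good]; the test function 1 then gives equal probabilities of boxes. *)
Theorem cramer_wold : forall A, measurable A -> P1 (F1 @^-1` A) = P2 (F2 @^-1` A).
Proof.
apply: law_eq_boxes => // s.
have gs : good (fun x => (all (fun kc => x kc.1 < kc.2) s)%:R).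
  elim: s => [|[k c] s IH] /=.
    split; first exact: bounded_mfun_cst.
    move=> f tf; under eq_Rintegral do rewrite mul1r.
    by under [RHS]eq_Rintegral do rewrite mul1r; exact: trig_eq.
  rewrite (_ : (fun x => _) = (fun x : coords R K =>
    (all (fun kc => x kc.1 < kc.2) s)%:R * (x k < c)%R%:R)); first exact: good_half_line.
  by apply/funext => x; rewrite -natrM mulnb andbC.
have [_ /(_ _ (trig_cst 1))] := gs.
have mbox d (T : measurableType d) (F : T -> coords R K) :
    measurable_fun setT F -> measurable [set w | all (fun kc => F w kc.1 < kc.2) s].
  move=> mF; rewrite -[X in measurable X]setTI.
  exact: (mF measurableT _ (measurable_box s)).
have box d (T : measurableType d) (P : probability T R) (F : T -> coords R K) :
    measurable_fun setT F -> \int[P]_w ((all (fun kc => F w kc.1 < kc.2) s)%:R * 1) =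
    fine (P [set w | all (fun kc => F w kc.1 < kc.2) s]).
  move=> mF; rewrite -[in RHS](setIT [set w | _]) -integral_indic ?/Rintegral//; last exact: mbox.
  by congr fine; apply: eq_integral => w _; rewrite mulr1 indicE mem_setE.
by rewrite !box// => e; rewrite -[LHS]fineK ?e ?fineK//; apply: fin_num_measure; exact: mbox.
Qed.

End cramer_wold.

(** * Characteristic functions of centered normal laws *)

Section bounded_expectation.
Context d (T : measurableType d) {R : realType} (P : probability T R).

Lemma Rintegral_bounded (f : T -> R) : bounded_mfun f ->
  (\int[P]_x (f x)%:E = (\int[P]_x f x)%:E)%E.
Proof.
move=> bf; rewrite fineK//; apply: integrable_fin_num => //.
exact: bounded_mfun_integrable.
Qed.

Lemma bounded_mfun_cos (f : T -> R) : measurable_fun setT f ->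
  bounded_mfun (fun w => cos (f w)).
Proof.
move=> mf; split; last by exists 1 => x; exact: cos_max.
apply: (measurableT_comp (f := @cos R)) => //.
by apply: continuous_measurable_fun; exact: continuous_cos.
Qed.

Lemma bounded_mfun_sin (f : T -> R) : measurable_fun setT f ->
  bounded_mfun (fun w => sin (f w)).
Proof.
move=> mf; split; last by exists 1 => x; exact: sin_max.
apply: (measurableT_comp (f := @sin R)) => //.
by apply: continuous_measurable_fun; exact: continuous_sin.
Qed.

Lemma Rintegral_cosD (f : T -> R) c : measurable_fun setT f ->
  \int[P]_w cos (f w + c) =
  cos c * \int[P]_w cos (f w) - sin c * \int[P]_w sin (f w).
Proof.
move=> mf; have bc := bounded_mfun_cos mf; have bs := bounded_mfun_sin mf.
under eq_Rintegral do rewrite cosD mulrC [X in _ - X]mulrC.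
rewrite RintegralB ?RintegralZl//; apply: bounded_mfun_integrable => //;
  by apply: bounded_mfunM => //; exact: bounded_mfun_cst.
Qed.

Lemma Rintegral_cst1 c : \int[P]_w (c : R) = c.
Proof. transitivity (c * fine (P setT)); first exact: Rintegral_cst.
by rewrite probability_setT mulr1. Qed.

(** Undoes the shift by 1 that makes a cosine nonnegative, so that Tonelli and the change of law
    apply to it. *)
Lemma ge0_integral_1D (f : T -> R) : bounded_mfun f ->
  (\int[P]_x (1 + f x)%:E = (1 + \int[P]_x f x)%:E)%E.
Proof.
move=> bf; have b1 := @bounded_mfun_cst _ T R 1.
rewrite Rintegral_bounded; last exact: bounded_mfunD.
by rewrite RintegralD ?Rintegral_cst1//; exact: bounded_mfun_integrable.
Qed.

End bounded_expectation.

(** * Convolution of normal densities *)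

Section normal_convolution.
Context {R : realType}.
Local Notation mu := (@lebesgue_measure R).

Lemma ge0_integral_normal_prob (m s : R) (f : R -> \bar R) :
  measurable_fun setT f -> (forall x, 0 <= f x)%E ->
  (\int[normal_prob m s]_x f x = \int[mu]_x (f x * (normal_pdf m s x)%:E))%E.
Proof.
move=> mf f0.
have dom := @normal_prob_dominates R m s.
pose g := Radon_Nikodym_SigmaFinite.f (normal_prob m s) mu.
have ig : mu.-integrable setT g by exact: Radon_Nikodym_SigmaFinite.f_integrable.
rewrite -(Radon_Nikodym_SigmaFinite.change_of_variables dom)//.
have mp : measurable_fun setT (EFin \o normal_pdf m s).
  by apply/measurable_EFinP; exact: measurable_normal_pdf.
apply: ae_eq_integral => //.
- by apply: emeasurable_funM => //; exact: measurable_int ig.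
- exact: emeasurable_funM.
(* The Radon-Nikodym derivative and [normal_pdf] have the same integral over every measurable set,
   so they agree almost everywhere. *)
- have : ae_eq mu setT g (EFin \o normal_pdf m s).
    apply: integral_ae_eq => // E _ mE.
    by rewrite -Radon_Nikodym_SigmaFinite.f_integral.
  by apply: filterS => x /= h _; rewrite -/g h.
Qed.

Lemma integral_shift (G : R -> R) (a : R) : continuous G -> (forall x, 0 <= G x) ->
  (\int[mu]_x (G x)%:E = \int[mu]_x (G (x + a))%:E)%E.
Proof.
move=> cG G0.
have D (x : R) : is_derive x (1 : R) (fun x : R => x + a) (1 : R).
  by rewrite -[X in is_derive _ _ _ X]addr0; apply: is_deriveD.
have dE : derive1 (fun x : R => x + a) = cst 1.
  by apply/funext => x; rewrite derive1E; exact: derive_val.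
rewrite (increasing_ge0_integration_by_substitutionT (F := fun x => x + a))//.
- by apply: eq_integral => x _; rewrite dE !fctE mulr1.
- by move=> x y xy; rewrite ltrD2r.
- by rewrite dE => x; exact: cvg_cst.
- by rewrite dE; exact: is_cvg_cst.
- by rewrite dE; exact: is_cvg_cst.
- apply/cvgrNyPle => A; exists (A - a); split; first exact: num_real.
  by move=> x xA; lra.
- apply/cvgryPge => A; exists (A - a); split; first exact: num_real.
  by move=> x xA; lra.
Qed.

(** Completing the square in [y]. For independent centered normal variables with deviations [s] and
    [t], the right side is the density at [z] of the sum times the conditional density of the second
    variable given the sum. *)
Lemma normal_pdf_conv (s t z y : R) : 0 < s -> 0 < t ->
  let r := Num.sqrt (s ^+ 2 + t ^+ 2) in
  normal_pdf 0 s (z - y) * normal_pdf 0 t y =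
  normal_pdf 0 r z * normal_pdf (z * t ^+ 2 / r ^+ 2) (s * t / r) y.
Proof.
move=> s0 t0 r.
have r2 : r ^+ 2 = s ^+ 2 + t ^+ 2 by rewrite sqr_sqrtr// addr_ge0// sqr_ge0.
have r0 : 0 < r by rewrite sqrtr_gt0 addr_gt0// exprn_gt0.
have st0 : 0 < s * t / r by rewrite divr_gt0// mulr_gt0.
rewrite !normal_pdfE ?gt_eqF//.
have -> : normal_peak s * normal_fun 0 s (z - y) * (normal_peak t * normal_fun 0 t y) =
  (normal_peak s * normal_peak t) * (normal_fun 0 s (z - y) * normal_fun 0 t y) by ring.
rewrite [RHS]mulrACA; congr (_ * _).
  rewrite /normal_peak -!invfM -!sqrtrM ?mulrn_wge0 ?mulr_ge0 ?sqr_ge0 ?pi_ge0 ?(ltW r0) ?(ltW s0)//.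
  by congr (Num.sqrt _)^-1; rewrite expr_div_n exprMn r2; field; rewrite -r2 expf_neq0 ?gt_eqF.
rewrite /normal_fun -!expRD; congr expR.
rewrite expr_div_n exprMn r2; field.
by rewrite -r2 expf_neq0 ?gt_eqF.
Qed.

Lemma normal_pdf_sign (m s e y : R) : s != 0 -> e = 1 \/ e = -1 ->
  normal_pdf m s (e * y) = normal_pdf (e * m) s y.
Proof.
move=> s0 e1; rewrite !normal_pdfE// /normal_fun.
suff -> : (e * y - m) ^+ 2 = (y - e * m) ^+ 2 by [].
by case: e1 => ->; ring.
Qed.

(** A predicate on measures rather than [normal_prob] itself, so that it also covers the
    distribution of a random variable with that law. *)
Definition normal_density (s : R) (N : probability (measurableTypeR R) R) :=
  forall f : measurableTypeR R -> \bar R, measurable_fun setT f -> (forall x, 0 <= f x)%E ->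
  (\int[N]_x f x = \int[mu]_x (f x * (normal_pdf 0 s x)%:E))%E.

(** Substituting [z = x + e * y] and exchanging the integrals, [normal_pdf_conv] pulls the density
    of [z] out and leaves a normal density in [y], of integral 1. *)
Lemma normal_conv_cos (s t e : R) (Ns Nt : probability (measurableTypeR R) R) :
  0 < s -> 0 < t -> e = 1 \/ e = -1 ->
  normal_density s Ns -> normal_density t Nt ->
  (\int[Nt]_y \int[Ns]_x (1 + cos (x + e * y))%:E =
   \int[mu]_z ((1 + cos z) * normal_pdf 0 (Num.sqrt (s ^+ 2 + t ^+ 2)) z)%:E)%E.
Proof.
move=> s0 t0 e1 Hs Ht; set r := Num.sqrt _.
have c0 (x : R) : (0 <= (1 + cos x)%:E)%E.
  by rewrite lee_fin; have := cos_geN1 x; lra.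
have mc (a : R) : measurable_fun setT (fun x : R => (1 + cos (x + a))%:E).
  apply/measurable_EFinP/measurable_funD => //.
  case: (bounded_mfun_cos (T := measurableTypeR R) (f := fun x => x + a)) => //.
  exact: measurable_funD.
have mp (m u : R) : measurable_fun setT (normal_pdf m u).
  exact: measurable_normal_pdf.
have r2 : r ^+ 2 = s ^+ 2 + t ^+ 2 by rewrite sqr_sqrtr// addr_ge0// sqr_ge0.
have r0 : 0 < r by rewrite sqrtr_gt0 addr_gt0// exprn_gt0.
have ee : e ^+ 2 = 1 by case: e1 => ->; rewrite ?sqrrN expr1n.
have cc z : 0 <= 1 + cos z :> R by have := c0 z; rewrite lee_fin.
pose g (z y : R) := (1 + cos z) * normal_pdf 0 s (z - e * y).
have g0 z y : 0 <= g z y by rewrite mulr_ge0 ?normal_pdf_ge0.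
have mg : measurable_fun setT (fun zy : R * R => g zy.1 zy.2).
  apply: measurable_funM; last first.
    apply: (measurableT_comp (f := normal_pdf 0 s)) => //.
    by apply: measurable_funB => //; exact: measurable_funM.
  apply: (measurableT_comp (f := fun z => 1 + cos z)) => //.
  by have /measurable_EFinP := mc 0; under eq_fun do rewrite addr0.
have cg y : continuous (g ^~ y).
  move=> z; apply: cvgM; first by apply: cvgD; [exact: cvg_cst|exact: continuous_cos].
  apply: (@continuous_comp _ _ _ (fun x => x - e * y) (normal_pdf 0 s)); last first.
    by apply: continuous_normal_pdf; rewrite gt_eqF.
  by apply: cvgB; [exact: cvg_id|exact: cvg_cst].
have inner y : (\int[Ns]_x (1 + cos (x + e * y))%:E =
    \int[mu]_z (g z y)%:E)%E.
  rewrite (Hs _ (mc (e * y)) (fun x => c0 (x + e * y))).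
  rewrite (integral_shift (e * y) (cg y) (fun z => g0 z y)).
  by apply: eq_integral => x _; rewrite -EFinM /g addrK.
under eq_integral do rewrite inner.
rewrite (Ht (fun y => \int[mu]_z (g z y)%:E)%E); last 2 first.
- apply: (@measurable_fun_fubini_tonelli_G _ _ _ _ _ mu (fun zy => (g zy.1 zy.2)%:E)).
    exact/measurable_EFinP.
  by move=> zy; rewrite lee_fin.
- by move=> y; apply: integral_ge0 => z _; rewrite lee_fin.
pose q (z y : R) : \bar R := (g z y * normal_pdf 0 t y)%:E.
have q0 z y : (0 <= q z y)%E by rewrite lee_fin mulr_ge0// normal_pdf_ge0.
have mq : measurable_fun setT (fun zy : R * R => q zy.1 zy.2).
  apply/measurable_EFinP; apply: measurable_funM => //.
  by apply: (measurableT_comp (f := normal_pdf 0 t)).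
transitivity (\int[mu]_y \int[mu]_z q z y)%E.
  apply: eq_integral => y _.
  rewrite -(@ge0_integralZr _ _ _ mu setT measurableT (fun z => (g z y)%:E))//.
  - by apply/measurable_EFinP; apply: continuous_measurable_fun; exact: cg.
  - by move=> z _; rewrite lee_fin.
  - by rewrite lee_fin normal_pdf_ge0.
rewrite -(@fubini_tonelli _ _ _ _ R mu mu (fun zy => q zy.1 zy.2) mq (fun zy => q0 zy.1 zy.2))/=.
apply: eq_integral => z _.
transitivity (\int[mu]_y (((1 + cos z) * normal_pdf 0 r z)%:E *
   (normal_pdf (z * t ^+ 2 / r ^+ 2) (s * t / r) (e * y))%:E))%E.
  apply: eq_integral => y _; rewrite -EFinM /q /g -mulrA.
  have -> : normal_pdf 0 t y = normal_pdf 0 t (e * y).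
    rewrite /normal_pdf gt_eqF// /normal_fun !subr0 exprMn.
    by rewrite ee mul1r.
  by rewrite normal_pdf_conv// mulrA.
under eq_integral => y _ do rewrite normal_pdf_sign// ?gt_eqF ?divr_gt0 ?mulr_gt0//.
rewrite ge0_integralZl//; last 3 first.
- by apply/measurable_EFinP; exact: measurable_normal_pdf.
- by move=> y _; rewrite lee_fin normal_pdf_ge0.
- by rewrite lee_fin mulr_ge0 ?normal_pdf_ge0.
by rewrite integral_normal_pdf mule1 EFinM.
Qed.

(* The characteristic function of N(0, s^2); only the functional equation
   [gauss_cfM] matters, not the closed form. *)
Definition gauss_cf (s : R) : R :=
  if s == 0 then 1 else
  fine (\int[mu]_x ((1 + cos x) * normal_pdf 0 s x)%:E)%E - 1.

Lemma gauss_cfE s (N : probability (measurableTypeR R) R) : 0 < s -> normal_density s N ->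
  \int[N]_x cos x = gauss_cf s.
Proof.
move=> s0 HN; rewrite /gauss_cf gt_eqF//.
have bc : bounded_mfun (fun x : measurableTypeR R => cos x) by exact: bounded_mfun_cos.
have := ge0_integral_1D N bc.
rewrite HN; last 2 first.
- apply/measurable_EFinP; apply: measurable_funD => //; exact: bc.1.
- by move=> x; rewrite lee_fin; have := cos_geN1 x; lra.
under eq_integral do rewrite -EFinM.
by move=> -> /=; rewrite addrAC subrr add0r.
Qed.

Lemma gauss_cfM s t : 0 <= s -> 0 <= t ->
  gauss_cf s * gauss_cf t = gauss_cf (Num.sqrt (s ^+ 2 + t ^+ 2)).
Proof.
rewrite !le_eqVlt => /orP[/eqP <- t0|s0 /orP[/eqP <-|t0]].
- rewrite {1}/gauss_cf eqxx mul1r expr0n/= add0r sqrtr_sqr ger0_norm//.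
  by rewrite le_eqVlt.
- by rewrite {2}/gauss_cf eqxx mulr1 expr0n/= addr0 sqrtr_sqr ger0_norm// ltW.
have r0 : 0 < Num.sqrt (s ^+ 2 + t ^+ 2) by rewrite sqrtr_gt0 addr_gt0// exprn_gt0.
have ex u : exists N : probability (measurableTypeR R) R, normal_density u N.
  by exists (normal_prob 0 u) => f mf f0; exact: ge0_integral_normal_prob.
have [Ns Hs] := ex s; have [Nt Ht] := ex t.
have me (e : R) : measurable_fun setT (fun y : measurableTypeR R => e * y).
  exact: measurable_funM.
pose A := \int[Ns]_w cos w; pose B := \int[Ns]_w sin w.
have E (e : R) : e = 1 \/ e = -1 ->
    \int[Nt]_y cos (e * y) * A - \int[Nt]_y sin (e * y) * B =
    gauss_cf (Num.sqrt (s ^+ 2 + t ^+ 2)).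
  move=> e1; rewrite /gauss_cf gt_eqF// -(normal_conv_cos s0 t0 e1 Hs Ht).
  have mid (u : R) : bounded_mfun (fun x : measurableTypeR R => cos (x + u)).
    by apply: bounded_mfun_cos; exact: measurable_funD.
  under eq_integral => y _.
    rewrite (ge0_integral_1D Ns (mid (e * y))) (Rintegral_cosD Ns (e * y) (@measurable_id _ _ _)).
    over.
  rewrite -/A -/B.
  have b1 : bounded_mfun (fun y : measurableTypeR R => cos (e * y) * A).
    by apply: bounded_mfunM; [exact: bounded_mfun_cos|exact: bounded_mfun_cst].
  have b2 : bounded_mfun (fun y : measurableTypeR R => sin (e * y) * B).
    by apply: bounded_mfunM; [exact: bounded_mfun_sin|exact: bounded_mfun_cst].
  rewrite ge0_integral_1D/=; last first.
    apply: bounded_mfunD => //; under eq_fun do rewrite -mulN1r.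
    by apply: bounded_mfunM => //; exact: bounded_mfun_cst.
  rewrite addrAC subrr add0r.
  rewrite RintegralB ?RintegralZr//; apply: bounded_mfun_integrable => //.
  - exact: bounded_mfun_sin.
  - exact: bounded_mfun_cos.
(* The two signs of [e] give the same right side while the sine term changes sign; adding the
   equations eliminates it. *)
have E1 := E 1 (or_introl erefl); have E2 := E (-1) (or_intror erefl).
rewrite -(gauss_cfE s0 Hs) -(gauss_cfE t0 Ht) -/A.
have bs : bounded_mfun (fun y : measurableTypeR R => sin y) by exact: bounded_mfun_sin.
have c1 : \int[Nt]_y cos (-1 * y) = \int[Nt]_y cos y.
  by apply: eq_Rintegral => y _; rewrite mulN1r cosN.
have c2 : \int[Nt]_y cos (1 * y) = \int[Nt]_y cos y.
  by apply: eq_Rintegral => y _; rewrite mul1r.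
have s1 : \int[Nt]_y sin (-1 * y) = - \int[Nt]_y sin (1 * y).
  transitivity (\int[Nt]_y (-1 * sin (1 * y))).
    by apply: eq_Rintegral => y _; rewrite mul1r mulN1r sinN mulN1r.
  rewrite RintegralZl ?mulN1r//.
  by apply: bounded_mfun_integrable; exact: bounded_mfun_sin.
rewrite c1 s1 in E2; rewrite c2 in E1.
by move: E1 E2; move: (\int[Nt]_y cos y) (\int[Nt]_y sin (1 * y)) => *; lra.
Qed.

End normal_convolution.

Section normal_law.
Context d (T : measurableType d) {R : realType} (P : probability T R).

(** Equality of the laws of [Y] and [- Y] makes the expectation of [sin (Y w)] its own opposite. The
    Gaussian hypothesis supplies both laws, through the vectors [u] and [- u]. *)
Lemma normal_law_cos (Y : T -> R) (s c : R) : 0 < s -> measurable_fun setT Y ->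
  (forall B, measurable B -> P (Y @^-1` B) = normal_prob 0 s B) ->
  (forall B, measurable B -> P ((fun w => - Y w) @^-1` B) = normal_prob 0 s B) ->
  \int[P]_w cos (Y w + c) = gauss_cf s * cos c.
Proof.
move=> s0 mY Y1 Y2; rewrite Rintegral_cosD//.
have mY1 : measurable_fun setT (Y : T -> measurableTypeR R) := mY.
pose X : {RV P >-> measurableTypeR R} :=
  HB.pack Y (isMeasurableFun.Build _ _ _ (measurableTypeR R) _ mY1).
have mY2 : measurable_fun setT (fun w => - Y w : measurableTypeR R).
  exact: measurable_funN.
pose X2 : {RV P >-> measurableTypeR R} :=
  HB.pack (fun w => - Y w) (isMeasurableFun.Build _ _ _ (measurableTypeR R) _ mY2).
have bs := bounded_mfun_sin (@measurable_id _ (measurableTypeR R) setT).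
have bc := bounded_mfun_cos (@measurable_id _ (measurableTypeR R) setT).
have tr (Z : {RV P >-> measurableTypeR R}) (f : measurableTypeR R -> R) :
    bounded_mfun f -> \int[P]_w f (Z w) = \int[distribution P Z]_x f x.
  move=> bf; rewrite /Rintegral; congr fine; apply/esym.
  rewrite (integral_distribution (f := EFin \o f))//.
    by apply/measurable_EFinP; exact: bf.1.
  apply: (bounded_mfun_integrable P (f := f \o Z)); case: bf => mf [M fM]; split.
    exact: measurableT_comp.
  by exists M => x; exact: fM.
have -> : \int[P]_w sin (Y w) = 0.
  have e1 : \int[P]_w sin (Y w) = \int[P]_w sin (- Y w).
    rewrite (tr X _ bs) (tr X2 _ bs) /Rintegral; congr fine.
    apply: eq_measure_integral => A mA _.
    by transitivity (normal_prob 0 s A); [exact: Y1|exact/esym/Y2].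
  have e2 : \int[P]_w sin (- Y w) = - \int[P]_w sin (Y w).
    transitivity (\int[P]_w (-1 * sin (Y w))).
      by apply: eq_Rintegral => w _; rewrite sinN mulN1r.
    rewrite RintegralZl ?mulN1r//.
    by apply: bounded_mfun_integrable; exact: bounded_mfun_sin.
  by move: e1; rewrite e2; move: (\int[P]_w sin (Y w)) => *; lra.
rewrite mulr0 subr0 mulrC (tr X _ bc); congr (_ * _); apply: gauss_cfE => //.
move=> f mf f0; rewrite -ge0_integral_normal_prob//.
by apply: eq_measure_integral => A mA _; exact: Y1.
Qed.

End normal_law.

Lemma in_bigsetI (I : finType) (T : Type) (F : I -> set T) w :
  (\big[setI/setT]_i F i) w <-> forall i, F i w.
Proof.
rewrite -bigcap_seq; split=> [h i|h i _]; last exact: h.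
by apply: h => /=; exact: mem_index_enum.
Qed.

(** * Characteristic function of a sum of independent variables *)

Section independent_sum.
Context {R : realType} (I : finType) d (T : measurableType d) (P : probability T R).
Variable Y : I -> T -> R.
Hypothesis mY : forall i, measurable_fun setT (Y i).
Hypothesis indep : forall B : I -> set R, (forall i, measurable (B i)) ->
  P (\big[setI/setT]_i (Y i @^-1` B i)) = (\prod_i P (Y i @^-1` B i))%E.

Let Yv : T -> coords R I := fun w i => Y i w.

(** Variable [j] is read on a second, independent copy of the space. Independence keeps the joint
    law, and Tonelli can then integrate this variable alone. *)
Let decoupled (j : I) : (T * T) -> coords R I :=
  fun ww i => Y i (if i == j then ww.2 else ww.1).

Let mYv : measurable_fun setT Yv.
Proof. exact: measurable_coords. Qed.

Let mdecoupled j : measurable_fun setT (decoupled j).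
Proof.
apply: measurable_coords => i; rewrite /decoupled.
by case: eqP => _; apply: measurableT_comp.
Qed.

Let decoupled_law j A : measurable A ->
  P (Yv @^-1` A) = (P \x P)%E (decoupled j @^-1` A).
Proof.
move=> mA; apply: (@law_eq_boxes _ _ _ _ _ _ P (P \x P)%E Yv (decoupled j)) => // s.
pose B i : set R := [set x | all (fun kc => (kc.1 == i) ==> (x < kc.2)) s].
have mB i : measurable (B i).
  rewrite {}/B; elim: s => [|[k c] s IH] /=.
    by rewrite (_ : [set x | true] = setT)//; apply/seteqP; split.
  case: (k == i) => /=; last exact: IH.
  rewrite (_ : [set x | _] = `]-oo, c[ `&`
    [set x | all (fun kc => (kc.1 == i) ==> (x < kc.2)) s]); first exact: measurableI.
  by apply/seteqP; split => x /=; rewrite in_itv/= => /andP.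
have boxE (F : I -> R) : all (fun kc => F kc.1 < kc.2) s <-> forall i, B i (F i).
  split=> [/allP h i|h].
    by apply/allP => kc kcs; apply/implyP => /eqP <-; exact: h.
  by apply/allP => kc kcs; have /allP/(_ _ kcs)/implyP := h kc.1; apply.
have mYB i : measurable (Y i @^-1` B i).
  by rewrite -[X in measurable X]setTI; exact: mY.
have -> : [set w | all (fun kc => Yv w kc.1 < kc.2) s] =
    \big[setI/setT]_i (Y i @^-1` B i).
  by apply/seteqP; split => w /=; rewrite in_bigsetI (boxE (Y ^~ w)).
pose B' i := if i == j then setT else B i.
have mB' i : measurable (B' i) by rewrite /B'; case: ifP.
have -> : [set ww | all (fun kc => decoupled j ww kc.1 < kc.2) s] =
    (\big[setI/setT]_i (Y i @^-1` B' i)) `*` (Y j @^-1` B j).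
  apply/seteqP; split => -[w w'] /=; rewrite in_bigsetI (boxE (decoupled j (w, w'))).
    move=> h; split=> [i|]; last by have := h j; rewrite /decoupled eqxx.
    by rewrite /B'; case: eqP (h i) => // /eqP /negPf ij; rewrite /decoupled ij.
  move=> [h hj] i; rewrite /decoupled; case: eqP => [->//|/eqP /negPf ij].
  by have := h i; rewrite /B' ij.
have mI : measurable (\big[setI/setT]_i (Y i @^-1` B' i)).
  by apply: bigsetI_measurable => i _; rewrite -[X in measurable X]setTI; exact: mY.
transitivity (P (\big[setI/setT]_i (Y i @^-1` B' i)) * P (Y j @^-1` B j))%E; last first.
  exact/esym/product_measure1E.
rewrite !indep//.
rewrite (bigD1 j)//= [in RHS](bigD1 j)//= /B' eqxx preimage_setT probability_setT mul1e muleC.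
by congr (_ * _)%E; apply: eq_bigr => i /negPf ->.
Qed.

(** The hypothesis for all phases says that [Y i] has the real characteristic value [g i]. Arbitrary
    phases let the sum of the other variables be absorbed into [c] while [Y j] is integrated. *)
Lemma indep_cos (g : I -> R) :
  (forall i c, \int[P]_w cos (Y i w + c) = g i * cos c) ->
  forall c, \int[P]_w cos (\sum_i Y i w + c) = (\prod_i g i) * cos c.
Proof.
move=> hg c; elim: (index_enum I) (index_enum_uniq I) c => [|j r IH] /=.
  by move=> _ c; under eq_Rintegral do rewrite big_nil add0r; rewrite big_nil mul1r Rintegral_cst1.
move=> /andP[jr ur] c; rewrite big_cons.
have msum (l : seq I) : measurable_fun setT (fun x : coords R I => \sum_(i <- l) x i).
  by apply: measurable_sum => i; exact: measurable_coord.
have bsum (l : seq I) e : bounded_mfun (fun x : coords R I => cos (\sum_(i <- l) x i + e)).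
  by apply: bounded_mfun_cos; exact: measurable_funD.
have bY (l : seq I) e : bounded_mfun (fun w => cos (\sum_(i <- l) Y i w + e)).
  apply: bounded_mfun_cos; apply: measurable_funD => //.
  by apply: measurable_sum => i; exact: mY.
pose f (x : coords R I) : \bar R := (1 + cos (\sum_(i <- j :: r) x i + c))%:E.
have mf : measurable_fun setT f.
  by apply/measurable_EFinP; apply: measurable_funD => //; exact: (bsum _ _).1.
have f0 x : (0 <= f x)%E.
  by rewrite lee_fin; have := cos_geN1 (\sum_(i <- j :: r) x i + c); lra.
apply: (@addrI _ 1); apply: EFin_inj.
rewrite -(ge0_integral_1D P (bY (j :: r) c)).
rewrite (law_eq_ge0_integral mYv (mdecoupled j) (decoupled_law j) mf f0).
have mfd : measurable_fun setT (fun ww : T * T => f (decoupled j ww)).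
  exact: measurableT_comp.
rewrite (@fubini_tonelli1 _ _ _ _ R P P (fun ww => f (decoupled j ww)) mfd (fun ww => f0 _)).
have inner w : (\int[P]_w' f (decoupled j (w, w')) =
    (1 + g j * cos (\sum_(i <- r) Y i w + c))%:E)%E.
  have fE w' : f (decoupled j (w, w')) =
      (1 + cos (Y j w' + (\sum_(i <- r) Y i w + c)))%:E.
    rewrite /f big_cons /decoupled eqxx addrA; congr (1 + cos (_ + _ + _))%:E.
    apply: eq_big_seq => i ir; case: eqP => // ij; by rewrite -ij ir in jr.
  under eq_integral do rewrite fE.
  rewrite ge0_integral_1D ?hg//.
  by apply: bounded_mfun_cos; exact: measurable_funD.
transitivity (\int[P]_w (1 + g j * cos (\sum_(i <- r) Y i w + c))%:E)%E.
  by apply: eq_integral => w _; exact: inner.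
rewrite ge0_integral_1D; last by apply: bounded_mfunM => //; exact: bounded_mfun_cst.
rewrite RintegralZl ?IH ?mulrA//.
by apply: bounded_mfun_integrable.
Qed.

End independent_sum.

Lemma gauss_cf_sqrtM (R : realType) (x y : R) : 0 <= x -> 0 <= y ->
  gauss_cf (Num.sqrt x) * gauss_cf (Num.sqrt y) = gauss_cf (Num.sqrt (x + y)).
Proof.
move=> x0 y0; rewrite (gauss_cfM (sqrtr_ge0 _) (sqrtr_ge0 _)).
congr (gauss_cf (Num.sqrt (_ + _))); exact: sqr_sqrtr.
Qed.

Lemma prod_gauss_cf (R : realType) (I : Type) (r : seq I) (q : I -> R) :
  (forall i, 0 <= q i) ->
  \prod_(i <- r) gauss_cf (Num.sqrt (q i)) = gauss_cf (Num.sqrt (\sum_(i <- r) q i)).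
Proof.
move=> q0; elim: r => [|i r IH].
  by rewrite !big_nil sqrtr0 /gauss_cf eqxx.
rewrite !big_cons IH; apply: gauss_cf_sqrtM; first exact: q0.
exact: sumr_ge0.
Qed.

(** * Rotation invariance and decoupling of a Gaussian sample *)

Section gaussian_family.
Context {R : realType} {p n : nat} {d} {T : measurableType d} {P : probability T R}.
Variables (Sigma : 'M[R]_p) (X : 'I_n -> T -> 'cV[R]_p).
Hypothesis posdef : sym_posdef Sigma.
Hypothesis gauss : forall i, is_gaussian_vec P Sigma (X i).
Hypothesis indep : mutually_independent P X.

Definition family_of (w : T) : coords R ('I_n * 'I_p)%type := fun k => X k.1 w k.2 ord0.

Lemma measurable_family : measurable_fun setT family_of.
Proof.
by apply: measurable_coords => k; have [+ _] := gauss k.1; apply.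
Qed.

Definition lin (a : 'I_n * 'I_p -> R) (x : coords R ('I_n * 'I_p)%type) : R :=
  \sum_k a k * x k.

Definition form_col (a : 'I_n * 'I_p -> R) (i : 'I_n) : 'cV[R]_p := \col_j a (i, j).

Definition cov (a b : 'I_n * 'I_p -> R) : R :=
  \sum_i ((form_col a i)^T *m Sigma *m form_col b i) ord0 ord0.

Let quad_ge0 (u : 'cV[R]_p) : 0 <= (u^T *m Sigma *m u) ord0 ord0.
Proof.
have [->|u0] := eqVneq u 0; first by rewrite mulmx0 mxE.
by rewrite ltW//; apply posdef.2.
Qed.

Lemma lin_split a w : lin a (family_of w) =
  \sum_i ((form_col a i)^T *m X i w) ord0 ord0.
Proof.
transitivity (\sum_i \sum_j a (i, j) * X i w j ord0).
  by rewrite pair_bigA; apply: eq_bigr => -[i j] _.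
by apply: eq_bigr => i _; rewrite mxE; apply: eq_bigr => j _; rewrite !mxE.
Qed.

Let measurable_proj (u : 'cV[R]_p) i :
  measurable_fun setT (fun w => (u^T *m X i w) ord0 ord0).
Proof.
under eq_fun do rewrite mxE.
apply: measurable_sum => j; apply: measurable_funM => //.
by have [+ _] := gauss i; apply.
Qed.

Let sigma_vec_proj (u : 'cV[R]_p) i B : measurable B ->
  sigma_vec (X i) ((fun w => (u^T *m X i w) ord0 ord0) @^-1` B).
Proof.
move=> mB.
(* Giving [T] the sigma-algebra generated by the row turns membership in [sigma_vec] into
   measurability of a linear form. *)
pose G : set (set T) := [set E | exists j (B : set R), measurable B /\
  E = (fun w => X i w j ord0) @^-1` B].
have mX j : measurable_fun setT (fun w : g_sigma_algebraType G => X i w j ord0).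
  by move=> _ C mC; rewrite setTI; apply: sub_sigma_algebra; exists j, C.
have mp : measurable_fun setT
    (fun w : g_sigma_algebraType G => (u^T *m X i w) ord0 ord0).
  under eq_fun do rewrite mxE.
  by apply: measurable_sum => j; apply: measurable_funM.
by have := mp measurableT B mB; rewrite setTI.
Qed.

(** The form is a sum of independent row forms, and [gauss_cf] is multiplicative in the variance. A
    zero row form is treated apart, the Gaussian hypothesis being about nonzero vectors. *)
Lemma gaussian_cos (a : 'I_n * 'I_p -> R) c :
  \int[P]_w cos (lin a (family_of w) + c) = gauss_cf (Num.sqrt (cov a a)) * cos c.
Proof.
under eq_Rintegral do rewrite lin_split.
rewrite (@indep_cos _ _ _ _ _ (fun i w => ((form_col a i)^T *m X i w) ord0 ord0)
  _ _ (fun i => gauss_cf (Num.sqrt (((form_col a i)^T *m Sigma *m form_col a i) ord0 ord0)))).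
- by rewrite prod_gauss_cf.
- by move=> i; exact: measurable_proj.
- by move=> B mB; apply: indep => i; exact: sigma_vec_proj.
- move=> i e; have [u0|u0] := eqVneq (form_col a i) 0.
    rewrite u0 mulmx0 mxE sqrtr0 /gauss_cf eqxx mul1r.
    under eq_Rintegral do rewrite trmx0 mul0mx mxE add0r.
    by rewrite Rintegral_cst1.
  apply: normal_law_cos.
  + by rewrite sqrtr_gt0; apply posdef.2.
  + exact: measurable_proj.
  + by move=> B mB; have [_ /(_ _ u0 _ mB)] := gauss i.
  + move=> B mB; have [_] := gauss i => /(_ (- form_col a i)).
    rewrite oppr_eq0 => /(_ u0 _ mB).
    rewrite linearN/= mulNmx mulmxN mulNmx opprK => <-; congr (P _).
    by congr (_ @^-1` B); apply/funext => w; rewrite mulNmx [RHS]mxE.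
Qed.

(** * Invariance under a rotation of two rows *)

Section rotation.
Variables (i l : 'I_n).
Hypothesis il : i != l.

Definition rot_rows (x : coords R ('I_n * 'I_p)%type) : coords R ('I_n * 'I_p)%type :=
  fun k => if k.1 == i then (x (i, k.2) + x (l, k.2)) / Num.sqrt 2
           else if k.1 == l then (x (i, k.2) - x (l, k.2)) / Num.sqrt 2 else x k.

Let li : (l == i) = false. Proof. by rewrite eq_sym; apply/negbTE. Qed.

Lemma measurable_rot : measurable_fun setT rot_rows.
Proof.
apply: measurable_coords => k; rewrite /rot_rows; case: (k.1 == i); [|case: (k.1 == l)].
- by apply: measurable_funM => //; apply: measurable_funD; exact: measurable_coord.
- by apply: measurable_funM => //; apply: measurable_funB; exact: measurable_coord.
- exact: measurable_coord.
Qed.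

(** The matrix of [rot_rows] is symmetric, so the map is its own adjoint and can be moved onto the
    coefficients. *)
Lemma lin_rot a x : lin a (rot_rows x) = lin (rot_rows a) x.
Proof.
have E (f : 'I_n * 'I_p -> R) : \sum_k f k =
    \sum_j (f (i, j) + f (l, j)) + \sum_(m | (m != i) && (m != l)) \sum_j f (m, j).
  transitivity (\sum_m \sum_j f (m, j)).
    by rewrite pair_bigA; apply: eq_bigr => -[m j] _.
  by rewrite (bigD1 i)//= (bigD1 l)/= ?li// big_split/= addrA.
rewrite /lin !E; congr (_ + _).
  apply: eq_bigr => j _; rewrite /rot_rows /= !eqxx li.
  by rewrite !mulrA -!mulrDl mulrAC; ring.
apply: eq_bigr => m /andP[mi ml]; apply: eq_bigr => j _.
by rewrite /rot_rows /= (negbTE mi) (negbTE ml).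
Qed.

Lemma cov_rot a : cov (rot_rows a) (rot_rows a) = cov a a.
Proof.
rewrite /cov (bigD1 i)//= (bigD1 l)/= ?li// [RHS](bigD1 i)//= [in RHS](bigD1 l)/= ?li//.
rewrite !addrA; congr (_ + _); last first.
  apply: eq_bigr => m /andP[mi ml].
  suff -> : form_col (rot_rows a) m = form_col a m by [].
  by apply/colP => j; rewrite !mxE /rot_rows /= (negbTE mi) (negbTE ml).
set u := form_col a i; set v := form_col a l; set s := (Num.sqrt 2)^-1 : R.
have -> : form_col (rot_rows a) i = s *: (u + v).
  by apply/colP => j; rewrite !mxE /rot_rows /= eqxx mulrC.
have -> : form_col (rot_rows a) l = s *: (u - v).
  by apply/colP => j; rewrite !mxE /rot_rows /= li eqxx mulrC.
have s2 : s * s = 2^-1 by rewrite -expr2 exprVn sqr_sqrtr.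
have qZ (y : 'cV[R]_p) : (((s *: y)^T *m Sigma *m (s *: y)) ord0 ord0) =
    2^-1 * (y^T *m Sigma *m y) ord0 ord0.
  have -> : (s *: y)^T = s *: y^T by apply/rowP => j; rewrite !mxE.
  by rewrite -!scalemxAl -scalemxAr scalerA s2 mxE.
have qD (y z : 'cV[R]_p) : (((y + z)^T *m Sigma *m (y + z)) ord0 ord0) =
    (y^T *m Sigma *m y) ord0 ord0 + (z^T *m Sigma *m z) ord0 ord0 +
    ((y^T *m Sigma *m z) ord0 ord0 + (z^T *m Sigma *m y) ord0 ord0).
  have -> : (y + z)^T = y^T + z^T by apply/rowP => j; rewrite !mxE.
  rewrite !mulmxDl !mulmxDr.
  have mD (A B : 'M[R]_1) : (A + B) ord0 ord0 = A ord0 ord0 + B ord0 ord0 by rewrite mxE.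
  by rewrite !mD; ring.
have qN (y z : 'cV[R]_p) : ((y^T *m Sigma *m - z) ord0 ord0) = - (y^T *m Sigma *m z) ord0 ord0.
  by rewrite mulmxN mxE.
have qN' (y z : 'cV[R]_p) : (((- y)^T *m Sigma *m z) ord0 ord0) = - (y^T *m Sigma *m z) ord0 ord0.
  have -> : (- y)^T = - y^T by apply/rowP => j; rewrite !mxE.
  by rewrite !mulNmx mxE.
by rewrite !qZ !qD !qN !qN'; field.
Qed.

(** A rotated form has the same variance by [cov_rot], hence the same cosine integrals, and these
    determine the joint law. *)
Lemma rot_law A : measurable A ->
  P (family_of @^-1` A) = P ((rot_rows \o family_of) @^-1` A).
Proof.
have mr : measurable_fun setT (rot_rows \o family_of).
  exact: (measurableT_comp measurable_rot measurable_family).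
apply: (cramer_wold measurable_family mr) => u c.
transitivity (gauss_cf (Num.sqrt (cov u u)) * cos c); first exact: gaussian_cos.
rewrite -(cov_rot u) -gaussian_cos; apply: eq_Rintegral => w _.
by congr (cos (_ + _)); exact/esym/lin_rot.
Qed.

End rotation.

Lemma cov_sym a b : cov a b = cov b a.
Proof.
apply: eq_bigr => i _; have [SigmaT _] := posdef.
have -> : (form_col b i)^T *m Sigma *m form_col a i =
    ((form_col a i)^T *m Sigma *m form_col b i)^T.
  by rewrite !trmx_mul SigmaT trmxK mulmxA.
by rewrite [RHS]mxE.
Qed.

Lemma cov_comb (a b e : 'I_n * 'I_p -> R) t :
  cov (fun k => t * a k + b k) e = t * cov a e + cov b e.
Proof.
rewrite /cov mulr_sumr -big_split; apply: eq_bigr => i _ /=.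
have -> : (form_col (fun k => t * a k + b k) i)^T =
    t *: (form_col a i)^T + (form_col b i)^T by apply/rowP => j; rewrite !mxE.
by rewrite !mulmxDl -!scalemxAl mxE [X in X + _]mxE.
Qed.

Lemma covZ (a e : 'I_n * 'I_p -> R) t : cov (fun k => t * a k) e = t * cov a e.
Proof.
rewrite /cov mulr_sumr; apply: eq_bigr => i _ /=.
have -> : (form_col (fun k => t * a k) i)^T = t *: (form_col a i)^T.
  by apply/rowP => j; rewrite !mxE.
by rewrite -!scalemxAl mxE.
Qed.

(** * Independence of uncorrelated linear forms *)

Section decoupling.
Context {L : finType}.
Variables (a : L -> 'I_n * 'I_p -> R) (b : 'I_n * 'I_p -> R).
Hypothesis ab : forall l, cov (a l) b = 0.

Definition forms_of (w : T) : coords R L := fun l => lin (a l) (family_of w).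

Definition glue_coords (x : coords R L) (y : R) : coords R (option L) :=
  fun o => if o is Some l then x l else y.

Let joint (w : T) := glue_coords (forms_of w) (lin b (family_of w)).
Let split (ww : T * T) := glue_coords (forms_of ww.1) (lin b (family_of ww.2)).

Lemma measurable_lin e : measurable_fun setT (fun w => lin e (family_of w)).
Proof.
apply: (measurableT_comp (f := lin e)); last exact: measurable_family.
by apply: measurable_sum => k; apply: measurable_funM => //; exact: measurable_coord.
Qed.

Lemma measurable_forms_of : measurable_fun setT forms_of.
Proof. by apply: measurable_coords => l; exact: measurable_lin. Qed.

Let measurable_joint : measurable_fun setT joint.
Proof. by apply: measurable_coords => -[l|]; exact: measurable_lin. Qed.

Let measurable_split : measurable_fun setT split.
Proof.
apply: measurable_coords => -[l|].
  exact: (measurableT_comp (measurable_lin (a l))).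
exact: (measurableT_comp (measurable_lin b)).
Qed.

Let cov_comb_sq (v : L -> R) t :
  let al k := \sum_l v l * a l k in
  cov (fun k => t * b k + al k) (fun k => t * b k + al k) = t ^+ 2 * cov b b + cov al al.
Proof.
move=> al.
have alb : cov al b = 0.
  have E (r : seq L) : cov (fun k => \sum_(l <- r) v l * a l k) b = 0.
    elim: r => [|l r IH].
      have -> : (fun k => \sum_(l <- [::]) v l * a l k) = fun k => 0 * b k.
        by apply/funext => k; rewrite big_nil mul0r.
      by rewrite covZ mul0r.
    have -> : (fun k => \sum_(l <- l :: r) v l * a l k) =
        fun k => v l * a l k + \sum_(l <- r) v l * a l k.
      by apply/funext => k; rewrite big_cons.
    by rewrite cov_comb ab IH mulr0 addr0.
  exact: E.
set be := fun k => t * b k + al k.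
have h e : cov be e = t * cov b e + cov al e by exact: cov_comb.
by rewrite h (cov_sym b be) (cov_sym al be) !h (cov_sym b al) alb; ring.
Qed.

Let Rintegral_prod_cos (U V : T -> R) (gU gV c : R) :
  measurable_fun setT U -> measurable_fun setT V ->
  (forall c, \int[P]_w cos (U w + c) = gU * cos c) ->
  (forall c, \int[P]_w cos (V w + c) = gV * cos c) ->
  \int[(P \x P)%E]_ww cos (U ww.1 + V ww.2 + c) = gU * gV * cos c.
Proof.
move=> mU mV hU hV.
have bUV : bounded_mfun (fun ww : T * T => cos (U ww.1 + V ww.2 + c)).
  apply: bounded_mfun_cos; apply: measurable_funD => //; apply: measurable_funD.
    exact: (measurableT_comp mU).
  exact: (measurableT_comp mV).
have mf : measurable_fun setT (fun ww : T * T => (1 + cos (U ww.1 + V ww.2 + c))%:E).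
  by apply/measurable_EFinP; apply: measurable_funD => //; exact: bUV.1.
apply: (@addrI _ 1); apply: EFin_inj.
rewrite -(ge0_integral_1D (P \x P)%E bUV).
rewrite (@fubini_tonelli1 _ _ _ _ R P P _ mf); last first.
  by move=> ww; rewrite lee_fin; have := cos_geN1 (U ww.1 + V ww.2 + c); lra.
have bU : bounded_mfun (fun w => cos (U w + c)).
  by apply: bounded_mfun_cos; exact: measurable_funD.
transitivity (\int[P]_w (1 + gV * cos (U w + c))%:E)%E.
  apply: eq_integral => w _; rewrite /fubini_F /=.
  have fE w' : (1 + cos (U w + V w' + c))%:E = (1 + cos (V w' + (U w + c)))%:E.
    by congr (1 + cos _)%:E; ring.
  under eq_integral do rewrite fE.
  rewrite ge0_integral_1D ?hV//.
  by apply: bounded_mfun_cos; exact: measurable_funD.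
rewrite ge0_integral_1D; last by apply: bounded_mfunM => //; exact: bounded_mfun_cst.
rewrite RintegralZl//; last exact: bounded_mfun_integrable.
by rewrite hU mulrA (mulrC gV).
Qed.

Lemma big_option (f : option L -> R) : \sum_o f o = f None + \sum_l f (Some l).
Proof.
rewrite (bigD1 None)//=; congr (_ + _).
rewrite (reindex_omap Some id)//=; last by case.
by apply: eq_bigl => l; rewrite eqxx.
Qed.

(** Vanishing covariances remove the cross terms from the variance of any combination of the forms
    [a l] with [b], so its characteristic function factors as for two independent copies. This
    replaces conditioning on the forms [a]. *)
Lemma decoupled_integral (G : coords R (option L) -> \bar R) :
  measurable_fun setT G -> (forall x, 0 <= G x)%E ->
  (\int[P]_w G (glue_coords (forms_of w) (lin b (family_of w))) =
   \int[P]_w \int[P]_w' G (glue_coords (forms_of w) (lin b (family_of w'))))%E.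
Proof.
move=> mG G0.
have law A : measurable A -> P (joint @^-1` A) = (P \x P)%E (split @^-1` A).
  apply: (cramer_wold measurable_joint measurable_split) => u c.
  pose al k := \sum_l u (Some l) * a l k; pose t := u None.
  have linal w : lin al (family_of w) = \sum_l u (Some l) * forms_of w l.
    rewrite /lin /forms_of /lin; under [RHS]eq_bigr do rewrite mulr_sumr.
    rewrite exchange_big; apply: eq_bigr => k _; rewrite mulr_suml.
    by apply: eq_bigr => l _; rewrite mulrA.
  have lintb w : lin (fun k => t * b k) (family_of w) = t * lin b (family_of w).
    by rewrite /lin mulr_sumr; apply: eq_bigr => k _; rewrite mulrA.
  transitivity (gauss_cf (Num.sqrt (cov al al)) *
      gauss_cf (Num.sqrt (cov (fun k => t * b k) (fun k => t * b k))) * cos c).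
    transitivity (\int[P]_w cos (lin (fun k => t * b k + al k) (family_of w) + c)).
      apply: eq_Rintegral => w _; rewrite big_option; congr (cos (_ + _)).
      rewrite /joint /= -linal -lintb /lin -big_split; apply: eq_bigr => k _.
      by rewrite mulrDl.
    have cov_ge0 e : 0 <= cov e e by apply: sumr_ge0 => i _; exact: quad_ge0.
    rewrite gaussian_cos cov_comb_sq; congr (_ * _).
    rewrite covZ (cov_sym b) covZ mulrA -expr2 -/al (addrC _ (cov al al)).
    apply: esym; apply: gauss_cf_sqrtM; first exact: cov_ge0.
    by apply: mulr_ge0; [exact: sqr_ge0|exact: cov_ge0].
  rewrite -(@Rintegral_prod_cos (fun w => lin al (family_of w))
    (fun w => lin (fun k => t * b k) (family_of w))); first last.
  - by move=> e; exact: gaussian_cos.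
  - by move=> e; exact: gaussian_cos.
  - exact: measurable_lin.
  - exact: measurable_lin.
  apply: eq_Rintegral => ww _; congr (cos (_ + _)).
  by rewrite big_option linal lintb addrC.
have := law_eq_ge0_integral measurable_joint measurable_split law mG G0.
move=> ->.
have mGs : measurable_fun setT (fun ww : T * T => G (split ww)) by exact: measurableT_comp.
by rewrite (@fubini_tonelli1 _ _ _ _ R P P _ mGs (fun ww => G0 _)).
Qed.

End decoupling.

End gaussian_family.

(** * Anti-concentration *)

(* [kern t = |t|^(-3/4)], with the value [+oo] at [0]; the exponent is such that
   [kern] is integrable on the line near [0] while [kern (t ^ 2)] is the power
   [-3/2 < -1] of [t]. *)
Section measurable_inverse.
Context {R : realType}.

(** The approximants are continuous and converge everywhere, including at 0, where they vanish and
    the inverse is 0 by convention. *)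
Lemma measurable_inv : measurable_fun setT (@GRing.inv R).
Proof.
apply: (@measurable_fun_cvg _ _ _ _ (fun n (x : R) => x * (x ^+ 2 + n.+1%:R^-1)^-1)).
  move=> n; apply: measurable_funM => //.
  apply: continuous_measurable_fun => x.
  apply: cvgV; first by rewrite gt_eqF// ltr_wpDl ?sqr_ge0// invr_gt0.
  by apply: cvgD; [exact: exprn_continuous|exact: cvg_cst].
move=> x _; have [->|x0] := eqVneq x 0.
  by under eq_fun do rewrite mul0r; rewrite invr0; exact: cvg_cst.
have -> : x^-1 = x * (x ^+ 2 + 0)^-1 by rewrite addr0; field.
apply: cvgM; first exact: cvg_cst.
apply: cvgV; first by rewrite addr0 expf_neq0.
by apply: cvgD; [exact: cvg_cst|exact: cvg_harmonic].
Qed.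

Lemma measurable_funV d (T : measurableType d) (f : T -> R) :
  measurable_fun setT f -> measurable_fun setT (fun x => (f x)^-1).
Proof. by move=> mf; exact: (measurableT_comp measurable_inv). Qed.

End measurable_inverse.

Section kern.
Context {R : realType}.
Implicit Types t u : R.

Definition root4 t : R := Num.sqrt (Num.sqrt `|t|).

Definition kern t : \bar R := if t == 0 then +oo%E else ((root4 t) ^- 3)%:E.

Lemma root4_gt0 t : t != 0 -> 0 < root4 t.
Proof. by move=> t0; rewrite !sqrtr_gt0 normr_gt0. Qed.

Lemma kern_ge0 t : (0 <= kern t)%E.
Proof.
rewrite /kern; case: eqP => // _.
by rewrite lee_fin invr_ge0 exprn_ge0// sqrtr_ge0.
Qed.

Lemma kern_gt0 t : (0 < kern t)%E.
Proof.
rewrite /kern; case: eqVneq => // t0.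
by rewrite lte_fin invr_gt0 exprn_gt0// root4_gt0.
Qed.

Lemma root4M t u : root4 (t * u) = root4 t * root4 u.
Proof. by rewrite /root4 normrM !sqrtrM ?sqrtr_ge0. Qed.

Lemma kernM t u : kern (t * u) = (kern t * kern u)%E.
Proof.
rewrite {1}/kern mulf_eq0; have [->|t0] /= := eqVneq t 0.
  by rewrite {1}/kern eqxx gt0_mulye// kern_gt0.
have [->|u0] := eqVneq u 0.
  by rewrite {2}/kern eqxx gt0_muley// kern_gt0.
by rewrite /kern (negbTE t0) (negbTE u0) -EFinM root4M exprMn invfM.
Qed.

Lemma kern_le t u : `|t| <= `|u| -> (kern u <= kern t)%E.
Proof.
move=> tu; rewrite /kern; have [t0|t0] := eqVneq t 0; first by rewrite leey.
have u0 : u != 0 by rewrite -normr_gt0 (lt_le_trans _ tu)// normr_gt0.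
rewrite (negbTE u0) lee_fin lef_pV2 ?posrE ?exprn_gt0 ?root4_gt0//.
by rewrite lerXn2r ?nnegrE ?sqrtr_ge0// /root4 !ler_wsqrtr.
Qed.

Lemma measurable_kern : measurable_fun setT kern.
Proof.
apply: measurable_fun_ifT => //; first exact: measurable_fun_eqr.
apply/measurable_EFinP; apply: measurable_funV; apply: measurable_funX.
have ms : measurable_fun setT (@Num.sqrt R).
  by apply: continuous_measurable_fun; exact: sqrt_continuous.
by apply: (measurableT_comp ms); apply: (measurableT_comp ms); exact: normr_measurable.
Qed.

(** On the shell [16^-(k+1) < |t| <= 16^-k] the kernel is at most [8^(k+1)], since [16^(3/4) = 8];
    powers of 16 have exact fourth roots. The term 1 covers [|t| >= 1], and at 0 the series
    diverges. *)
Lemma kern_le_layers t :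
  (kern t <= 1 + \sum_(0 <= k <oo) (if `|t| <= 16 ^- k then 8 ^+ k.+1 else 0)%:E)%E.
Proof.
have le0 k : true -> (0 <= (if `|t| <= 16 ^- k then 8 ^+ k.+1 else 0)%:E :> \bar R)%E.
  by move=> _; rewrite lee_fin; case: ifP => // _; rewrite exprn_ge0.
have [t0|t0] := eqVneq t 0.
  rewrite t0 normr0 (_ : \sum_(0 <= k <oo) _ = +oo)%E ?addey ?leey//.
  apply/eqyP => A A0; apply: (@le_trans _ _ (\sum_(0 <= k < (Num.truncn A).+1) 1%:E)%E).
    by rewrite sumEFin lee_fin sumr_const_nat subn0 ltW// truncnS_gt.
  apply: (@le_trans _ _ (\sum_(0 <= k < (Num.truncn A).+1)
     (if (0 : R) <= 16 ^- k then 8 ^+ k.+1 else 0)%:E)%E).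
    apply: lee_sum => k _; rewrite lee_fin invr_ge0 exprn_ge0//.
    by rewrite exprn_ege1// ler1n.
  apply: nneseries_lim_ge => k _ _; rewrite lee_fin.
  by case: ifP => // _; rewrite ?exprn_ge0.
have [t1|t1] := leP 1 `|t|.
  apply: (@le_trans _ _ 1%E); last first.
    by rewrite -[leLHS]adde0 leeD2l// nneseries_ge0// => k _; exact: le0.
  rewrite -[leRHS](_ : kern 1 = 1%E); first by apply: kern_le; rewrite normr1.
  by rewrite /kern oner_eq0 /root4 normr1 !sqrtr1 expr1n invr1.
have ex : exists k : nat, 16 ^- k.+1 < `|t|.
  exists (Num.truncn `|t|^-1); rewrite invf_plt ?posrE ?exprn_gt0 ?normr_gt0//.
  rewrite (lt_trans (truncnS_gt _))// -natrX ltr_nat; exact: ltn_expl.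
have [k kt kmin] := ex_minnP ex.
have tk : `|t| <= 16 ^- k.
  case: k kt kmin => [|k] kt kmin; first by rewrite expr0 invr1 ltW.
  by rewrite leNgt; apply/negP => /kmin; rewrite ltnn.
have root4X m : root4 (16 ^- m) = 2 ^- m :> R.
  have p2 : 0 <= 2 ^- m :> R by rewrite invr_ge0 exprn_ge0.
  have -> : 16 ^- m = (2 ^- m ^+ 2) ^+ 2 :> R.
    by rewrite -!exprVn -!exprM mulnC exprM; congr (_ ^+ m); field.
  move: (2 ^- m) p2 => z z0; rewrite /root4 ger0_norm ?sqr_ge0// sqrtr_sqr.
  by rewrite ger0_norm ?sqr_ge0// sqrtr_sqr ger0_norm.
apply: (@le_trans _ _ (8 ^+ k.+1)%:E).
  apply: (@le_trans _ _ (kern (16 ^- k.+1))).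
    by apply: kern_le; rewrite ger0_norm ?invr_ge0 ?exprn_ge0// ltW.
  rewrite /kern invr_eq0 expf_eq0/= pnatr_eq0/= root4X lee_fin.
  rewrite -[leLHS]exprVn invrK -exprM mulnC exprM.
  by have -> : 2 ^+ 3 = 8 :> R by ring.
rewrite -[leLHS]add0e; apply: leeD => //.
rewrite (@nneseriesD1 _ _ k predT) ?tk; [|exact: le0|by []].
by rewrite -[leLHS]adde0 leeD2l// nneseries_ge0// => m _ _; exact: le0.
Qed.

End kern.

(** * Expected kernels of normal variables *)

Section anticoncentration.
Context d (T : measurableType d) {R : realType} (P : probability T R).

Lemma normal_interval_le (s c e : R) : 0 < s -> 0 <= e ->
  (normal_prob 0%R s `[(c - e)%R, (c + e)%R]%classic <= (normal_peak s * (2 * e))%:E)%E.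
Proof.
move=> s0 e0; rewrite /normal_prob.
apply: (@le_trans _ _ (\int[lebesgue_measure]_(x in `[(c - e)%R, (c + e)%R]) (normal_peak s)%:E)%E).
  apply: ge0_le_integral => //.
  - by move=> x _; rewrite lee_fin normal_pdf_ge0.
  - apply/measurable_EFinP; apply: measurable_funTS; exact: measurable_normal_pdf.
  - by move=> x _; rewrite lee_fin normal_pdf_ub ?gt_eqF.
rewrite integral_cst//= lebesgue_measure_itv/= lte_fin.
case: ifPn => _; last by rewrite mule0 lee_fin mulr_ge0 ?mulr_ge0// normal_peak_ge0.
by rewrite -EFinB -EFinM lee_fin; apply: ler_wpM2l; rewrite ?normal_peak_ge0//; lra.
Qed.

(** Layer [k] has probability at most [2 * 16^-k] times the peak of the density, so it contributes
    at most [16 * 2^-k] peaks, and the sum over [k] is 32 peaks. The bound is uniform in [c],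
    because [c] will be a function of frozen variables. *)
Lemma normal_kern (s : R) (Y : T -> R) : 0 < s -> measurable_fun setT Y ->
  (forall B, measurable B -> P (Y @^-1` B) = normal_prob 0 s B) ->
  forall c, (\int[P]_w kern (Y w - c) <= (1 + 32 * normal_peak s)%:E)%E.
Proof.
move=> s0 mY lawY c.
pose L (k : nat) (w : T) : \bar R := (if `|Y w - c| <= 16 ^- k then 8 ^+ k.+1 else 0)%:E.
have L0 k w : (0 <= L k w)%E by rewrite /L lee_fin; case: ifP => _ //; rewrite exprn_ge0.
have LE k : L k = (fun w => (8 ^+ k.+1)%:E *
    (\1_(Y @^-1` `[(c - 16 ^- k)%R, (c + 16 ^- k)%R]) w)%:E)%E.
  apply/funext => w; rewrite /L indicE -EFinM.
  have -> : (w \in Y @^-1` `[(c - 16 ^- k)%R, (c + 16 ^- k)%R]) = (`|Y w - c| <= 16 ^- k).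
    by apply/idP/idP; rewrite inE /= in_itv/= ler_distl.
  by case: ifP => _; rewrite ?mulr1 ?mulr0.
have mI k : measurable (Y @^-1` `[c - 16 ^- k, c + 16 ^- k]).
  by rewrite -[X in measurable X]setTI; exact: mY.
have mL k : measurable_fun setT (L k).
  rewrite LE; apply: emeasurable_funM => //.
  by apply/measurable_EFinP; exact: measurable_indic.
have m1 : measurable_fun setT (fun w => kern (Y w - c)).
  by apply: (measurableT_comp measurable_kern); exact: measurable_funB.
have mS : measurable_fun setT (fun w => \sum_(0 <= k <oo) L k w)%E.
  exact: ge0_emeasurable_sum.
apply: (@le_trans _ _ (\int[P]_w (1 + \sum_(0 <= k <oo) L k w))%E).
  apply: ge0_le_integral => //.
  - by move=> w _; exact: kern_ge0.
  - exact: emeasurable_funD.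
  - by move=> w _; exact: kern_le_layers.
rewrite ge0_integralD//; last by move=> w _; exact: nneseries_ge0.
rewrite integral_cst// mul1e [X in (X + _)%E]probability_setT EFinD leeD2l//.
rewrite integral_nneseries//.
apply: (@le_trans _ _ (\sum_(0 <= k <oo) ((32 * normal_peak s) / (2 ^ (k + 1))%:R)%:E)%E).
  apply: lee_nneseries => [k _ _|k _]; first exact: integral_ge0.
  rewrite LE ge0_integralZl//; last first.
    by apply/measurable_EFinP; exact: measurable_indic.
  have -> : (\int[P]_x (\1_(Y @^-1` `[(c - 16 ^- k)%R, (c + 16 ^- k)%R]) x)%:E =
      normal_prob 0%R s `[(c - 16 ^- k)%R, (c + 16 ^- k)%R]%classic)%E.
    by rewrite integral_indic// setIT; exact: lawY.
  apply: (@le_trans _ _ ((8 ^+ k.+1)%:E * (normal_peak s * (2 * 16 ^- k))%:E)%E).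
    apply: lee_wpmul2l; first by rewrite lee_fin exprn_ge0.
    by apply: normal_interval_le => //; rewrite invr_ge0 exprn_ge0.
  rewrite -EFinM lee_fin natrX addn1.
  have -> : 16 ^- k = (8 ^+ k * 2 ^+ k)^-1 :> R by rewrite -exprMn; congr (_ ^- k); ring.
  rewrite [leLHS](_ : _ = 32 * normal_peak s / 2 ^+ k.+1)// !exprS; field.
  by rewrite !expf_neq0.
have := @cvg_geometric_eseries_half R (32 * normal_peak s) 0.
by move=> /cvg_lim -> //; rewrite expr0 divr1.
Qed.

End anticoncentration.

(** * Factorization through a complex square root *)

Section complex_square_root.
Context {R : realType}.
Implicit Types a b y z : R.

Definition csqrt_norm a b : R := Num.sqrt (a ^+ 2 + b ^+ 2).
(** [csqrt_re a b] and [csqrt_im a b] are the real and imaginary parts of a square root [r] of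
    [-(a + ib)], with [|r|^2 = csqrt_norm a b]. The sign in [csqrt_im] makes twice their product
    equal to [- b]. *)
Definition csqrt_re a b : R := Num.sqrt ((csqrt_norm a b - a) / 2).
Definition csqrt_im a b : R :=
  (if 0 < b then -1 else 1) * Num.sqrt ((csqrt_norm a b + a) / 2).

Let norm_ge a b : `|a| <= csqrt_norm a b.
Proof. by rewrite -sqrtr_sqr ler_wsqrtr// lerDl sqr_ge0. Qed.

Let normB_ge0 a b : 0 <= (csqrt_norm a b - a) / 2.
Proof. by have := norm_ge a b; rewrite ler_norml; lra. Qed.

Let normD_ge0 a b : 0 <= (csqrt_norm a b + a) / 2.
Proof. by have := norm_ge a b; rewrite ler_norml; lra. Qed.

Lemma csqrt_norm_sq a b : csqrt_norm a b ^+ 2 = a ^+ 2 + b ^+ 2.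
Proof. by rewrite sqr_sqrtr// addr_ge0 ?sqr_ge0. Qed.

Let sgn2 b : (if 0 < b then -1 else 1) ^+ 2 = 1 :> R.
Proof. by case: ifP => _; rewrite ?sqrrN expr1n. Qed.

Lemma csqrt_reE a b : csqrt_re a b ^+ 2 - csqrt_im a b ^+ 2 = - a.
Proof. by rewrite exprMn sgn2 !sqr_sqrtr//; field. Qed.

Lemma csqrt_normE a b : csqrt_re a b ^+ 2 + csqrt_im a b ^+ 2 = csqrt_norm a b.
Proof. by rewrite exprMn sgn2 !sqr_sqrtr//; field. Qed.

Lemma csqrt_imE a b : 2 * csqrt_re a b * csqrt_im a b = - b.
Proof.
have e : Num.sqrt ((csqrt_norm a b - a) / 2) * Num.sqrt ((csqrt_norm a b + a) / 2) = `|b| / 2.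
  rewrite -sqrtrM//.
  have -> : (csqrt_norm a b - a) / 2 * ((csqrt_norm a b + a) / 2) = (`|b| / 2) ^+ 2.
    rewrite expr_div_n real_normK ?num_real//.
    transitivity ((csqrt_norm a b ^+ 2 - a ^+ 2) / 2 ^+ 2); first by field.
    by rewrite csqrt_norm_sq; field.
  by rewrite sqrtr_sqr ger0_norm// divr_ge0.
transitivity (2 * (if 0 < b then -1 else 1) * (Num.sqrt ((csqrt_norm a b - a) / 2) *
   Num.sqrt ((csqrt_norm a b + a) / 2))); first by rewrite /csqrt_re /csqrt_im; ring.
rewrite e; case: ltP => [b0|b0]; first by rewrite gtr0_norm//; field.
by rewrite ler0_norm//; field.
Qed.

Lemma csqrt_factor a b y z :
  (y ^+ 2 - z ^+ 2 + a) ^+ 2 + (2 * y * z + b) ^+ 2 =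
  ((y - csqrt_re a b) ^+ 2 + (z - csqrt_im a b) ^+ 2) *
  ((y + csqrt_re a b) ^+ 2 + (z + csqrt_im a b) ^+ 2).
Proof.
have h1 := csqrt_reE a b; have h2 := csqrt_imE a b.
move: (csqrt_re a b) (csqrt_im a b) h1 h2 => u v h1 h2.
have -> : a = v ^+ 2 - u ^+ 2 by lra.
have -> : b = - (2 * u * v) by lra.
by ring.
Qed.

(** From [|y z| <= y^2 + z^2]. The planar singularity [|zeta|^(-3/2)] splits into two linear ones of
    exponent -3/4, each integrable against a bounded density. *)
Lemma kern_sumsq y z : (kern (y ^+ 2 + z ^+ 2) <= kern y * kern z)%E.
Proof.
rewrite -kernM; apply: kern_le; rewrite normrM.
rewrite [leRHS]ger0_norm ?addr_ge0 ?sqr_ge0//.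
rewrite -(real_normK (num_real y)) -(real_normK (num_real z)).
by have := sqr_ge0 (`|y| - `|z|); have := sqr_ge0 (`|y| + `|z|); nra.
Qed.

(** One term for each of the roots [r] and [-r], as either may be the nearer one to [y + iz]. The
    double negation keeps both terms in the form of a kernel centered at a function of [a] and
    [b]. *)
Definition kern_pair a b y z : \bar R :=
  (kern (y - csqrt_re a b) * kern (z - csqrt_im a b) +
   kern (y - - csqrt_re a b) * kern (z - - csqrt_im a b))%E.

Let kernMM_ge0 y z : (0 <= kern y * kern z)%E.
Proof. by rewrite mule_ge0 ?kern_ge0. Qed.

(* With [zeta = y + iz] and [r] a square root of [-(a + ib)], the left side is
   [kern] of [|zeta^2 - r^2|^2 = |zeta - r|^2 |zeta + r|^2], and one of the two
   factors is at least [|r|^2 = csqrt_norm a b]. *)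
Lemma kern_quadratic a b y z :
  (kern ((y ^+ 2 - z ^+ 2 + a) ^+ 2 + (2 * y * z + b) ^+ 2) <=
   kern_pair a b y z * kern (csqrt_norm a b))%E.
Proof.
rewrite csqrt_factor kernM /kern_pair !opprK.
have rE := csqrt_normE a b.
move: (csqrt_re a b) (csqrt_im a b) (csqrt_norm a b) rE => u v r rE.
have r0 : 0 <= r by rewrite -rE addr_ge0 ?sqr_ge0.
set A := (y - u) ^+ 2 + (z - v) ^+ 2; set B := (y + u) ^+ 2 + (z + v) ^+ 2.
have A0 : 0 <= A by rewrite addr_ge0 ?sqr_ge0.
have B0 : 0 <= B by rewrite addr_ge0 ?sqr_ge0.
have AB : 2 * r <= A + B.
  have -> : A + B = 2 * (y ^+ 2 + z ^+ 2) + 2 * r by rewrite -rE /A /B; ring.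
  by have := sqr_ge0 y; have := sqr_ge0 z; lra.
have [rB|Br] := leP r B.
  apply: lee_pmul; rewrite ?kern_ge0//; last by apply: kern_le; rewrite !ger0_norm.
  by apply: (le_trans (kern_sumsq _ _)); exact: leeDl.
rewrite muleC; apply: lee_pmul; rewrite ?kern_ge0//.
  by apply: (le_trans (kern_sumsq _ _)); exact: leeDr.
by apply: kern_le; rewrite !ger0_norm//; lra.
Qed.

(** Here the modulus [|zeta - r| |zeta + r|] is not squared: it is at least the square of the
    smaller distance, so [kern_pair] bounds it alone and no singularity in [a] and [b] remains. *)
Lemma kern_csqrt_norm a b y z :
  (kern (csqrt_norm (y ^+ 2 - z ^+ 2 + a) (2 * y * z + b)) <= kern_pair a b y z)%E.
Proof.
have := csqrt_norm_sq (y ^+ 2 - z ^+ 2 + a) (2 * y * z + b).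
rewrite csqrt_factor /kern_pair !opprK.
have : 0 <= csqrt_norm (y ^+ 2 - z ^+ 2 + a) (2 * y * z + b) by exact: sqrtr_ge0.
move: (csqrt_norm _ _) => r r0.
set u := csqrt_re a b; set v := csqrt_im a b.
set A := (y - u) ^+ 2 + (z - v) ^+ 2; set B := (y + u) ^+ 2 + (z + v) ^+ 2 => rE.
have A0 : 0 <= A by rewrite addr_ge0 ?sqr_ge0.
have B0 : 0 <= B by rewrite addr_ge0 ?sqr_ge0.
have [AB|BA] := leP A B.
  have Ar : A <= r by rewrite -(@ler_pXn2r _ 2)// ?nnegrE// rE expr2 ler_wpM2l.
  apply: (@le_trans _ _ (kern A)); first by apply: kern_le; rewrite !ger0_norm.
  by apply: (le_trans (kern_sumsq _ _)); exact: leeDl.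
have Br : B <= r by rewrite -(@ler_pXn2r _ 2)// ?nnegrE// rE expr2 ler_wpM2r// ltW.
apply: (@le_trans _ _ (kern B)); first by apply: kern_le; rewrite !ger0_norm.
by apply: (le_trans (kern_sumsq _ _)); exact: leeDr.
Qed.

Section measurability.
Context d (T : measurableType d).
Variables (f g : T -> R).
Hypotheses (mf : measurable_fun setT f) (mg : measurable_fun setT g).

Let measurable_sqrt (h : T -> R) : measurable_fun setT h ->
  measurable_fun setT (fun x => Num.sqrt (h x)).
Proof.
have ms : measurable_fun setT (@Num.sqrt R).
  by apply: continuous_measurable_fun; exact: sqrt_continuous.
by move=> mh; exact: (measurableT_comp ms).
Qed.

Lemma measurable_csqrt_norm : measurable_fun setT (fun x => csqrt_norm (f x) (g x)).
Proof.
by apply: measurable_sqrt; apply: measurable_funD; exact: measurable_funX.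
Qed.

Lemma measurable_csqrt_re : measurable_fun setT (fun x => csqrt_re (f x) (g x)).
Proof.
apply: measurable_sqrt; apply: measurable_funM => //.
by apply: measurable_funB => //; exact: measurable_csqrt_norm.
Qed.

Lemma measurable_csqrt_im : measurable_fun setT (fun x => csqrt_im (f x) (g x)).
Proof.
apply: measurable_funM; last first.
  apply: measurable_sqrt; apply: measurable_funM => //.
  by apply: measurable_funD => //; exact: measurable_csqrt_norm.
by apply: measurable_fun_ifT => //; exact: measurable_fun_ltr.
Qed.

End measurability.

End complex_square_root.

(** * The negative moment of the denominator *)

Section negative_moment.
Context {R : realType} {p n : nat} {d} {T : measurableType d} {P : probability T R}.
Variables (Sigma : 'M[R]_p) (X : 'I_n -> T -> 'cV[R]_p).
Hypothesis posdef : sym_posdef Sigma.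
Hypothesis gauss : forall i, is_gaussian_vec P Sigma (X i).
Hypothesis indep : mutually_independent P X.

Local Notation K := ('I_n * 'I_p)%type.
Local Notation fam := (family_of X).

Let mfam : measurable_fun setT fam := measurable_family gauss.

Lemma row_form_law (b : K -> R) i : (forall k, k.1 != i -> b k = 0) ->
  form_col b i != 0 -> exists2 s : R, 0 < s &
  forall B, measurable B -> P ((fun w => lin b (fam w)) @^-1` B) = normal_prob 0 s B.
Proof.
move=> bi b0; have [_ pd] := posdef; have [_ gi] := gauss i.
exists (Num.sqrt (((form_col b i)^T *m Sigma *m form_col b i) ord0 ord0)).
  by rewrite sqrtr_gt0 pd.
move=> B mB; rewrite -gi//; congr (P (_ @^-1` B)); apply/funext => w.
rewrite lin_split (bigD1 i)//= big1 ?addr0// => m mi.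
have -> : form_col b m = 0 by apply/colP => j; rewrite !mxE bi.
by rewrite trmx0 mul0mx mxE.
Qed.

(** After decoupling, [r] and [h] are constants in the inner integral over [lin b], where the bound
    of [normal_kern], uniform in the center, applies. *)
Lemma decoupled_kern {L : finType} (a : L -> K -> R) (b : K -> R) (s : R) :
  (forall l, cov Sigma (a l) b = 0) -> 0 < s ->
  (forall B, measurable B -> P ((fun w => lin b (fam w)) @^-1` B) = normal_prob 0 s B) ->
  forall (r : coords R L -> R) (h : coords R L -> \bar R),
  measurable_fun setT r -> measurable_fun setT h -> (forall x, 0 <= h x)%E ->
  (\int[P]_w (kern (lin b (fam w) - r (forms_of X a w)) * h (forms_of X a w)) <=
   (1 + 32 * normal_peak s)%:E * \int[P]_w h (forms_of X a w))%E.
Proof.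
move=> ab s0 lawb r h mr mh h0.
pose back (y : coords R (option L)) : coords R L := fun l => y (Some l).
have mback : measurable_fun setT back.
  by apply: measurable_coords => l; exact: measurable_coord.
pose G (y : coords R (option L)) := (kern (y None - r (back y)) * h (back y))%E.
have mG : measurable_fun setT G.
  apply: emeasurable_funM; last exact: (measurableT_comp mh).
  apply: (measurableT_comp measurable_kern); apply: measurable_funB.
    exact: measurable_coord.
  exact: (measurableT_comp mr).
have G0 y : (0 <= G y)%E by rewrite mule_ge0 ?kern_ge0.
have mk c : measurable_fun setT (fun w => kern (lin b (fam w) - c)).
  apply: (measurableT_comp measurable_kern); apply: measurable_funB => //.
  exact: (measurable_lin gauss).
have mhf : measurable_fun setT (fun w => h (forms_of X a w)).
  by apply: (measurableT_comp mh); exact: (measurable_forms_of gauss).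
have C0 : (0 <= (1 + 32 * normal_peak s)%:E :> \bar R)%E.
  by rewrite lee_fin addr_ge0// mulr_ge0// normal_peak_ge0.
rewrite (decoupled_integral posdef gauss indep ab mG G0).
rewrite -ge0_integralZl//.
apply: ge0_le_integral => //.
- by move=> w _; apply: integral_ge0.
- apply: (@measurable_fun_fubini_tonelli_F _ _ _ _ _ P
    (fun ww => G (glue_coords (forms_of X a ww.1) (lin b (fam ww.2))))).
    apply: (measurableT_comp mG); apply: measurable_coords => -[l|] /=.
      exact: (measurableT_comp (measurable_lin gauss (a l))).
    exact: (measurableT_comp (measurable_lin gauss b)).
  by move=> ww; exact: G0.
- exact: emeasurable_funM.
move=> w _.
have E w' : G (glue_coords (forms_of X a w) (lin b (fam w'))) =
  (kern (lin b (fam w') - r (forms_of X a w)) * h (forms_of X a w))%E by [].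
under eq_integral do rewrite E.
rewrite ge0_integralZr//; last by move=> w' _; exact: kern_ge0.
apply: lee_wpmul2r => //; apply: normal_kern => //.
exact: (measurable_lin gauss).
Qed.

Definition unit_form (k0 : K) : K -> R := fun k => (k == k0)%:R.

Lemma lin_unit_form k0 (x : coords R K) : lin (unit_form k0) x = x k0.
Proof.
rewrite /lin (bigD1 k0)//= /unit_form eqxx mul1r big1 ?addr0// => k /negPf ->.
by rewrite mul0r.
Qed.

Let form_col_unit i j m : form_col (unit_form (i, j)) m =
  if m == i then delta_mx j ord0 else 0.
Proof.
apply/colP => k; rewrite mxE /unit_form xpair_eqE; case: ifP => _ /=.
  by rewrite mxE eqxx andbT.
by rewrite mxE.
Qed.

Lemma cov_unit_form k k' :
  cov Sigma (unit_form k) (unit_form k') = if k.1 == k'.1 then Sigma k.2 k'.2 else 0.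
Proof.
case: k k' => [i j] [i' j'] /=; rewrite /cov (bigD1 i)//= big1; last first.
  by move=> m /negPf mi; rewrite form_col_unit mi trmx0 !mul0mx mxE.
rewrite addr0 !form_col_unit eqxx; case: eqP => _; last by rewrite mulmx0 mxE.
by rewrite trmx_delta -rowE -colE !mxE.
Qed.

Section pair.
Variables (i : 'I_n) (j0 j1 : 'I_p).
Hypothesis j01 : j0 != j1.

Definition row_free (U : Type) (F : coords R K -> U) :=
  forall x x' : coords R K, (forall k, k.1 != i -> x k = x' k) -> F x = F x'.

(** The entries frozen at each stage: the other rows for [a2], and also entry [(i, j0)] for [a1].
    Zero forms elsewhere keep the index type [K], so that [forms_of] is again a sample at which
    functions of the sample can be evaluated. *)
Let a2 (l : K) : K -> R := if l.1 != i then unit_form l else (fun k => 0 * unit_form l k).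
Let a1 (l : K) : K -> R :=
  if (l.1 != i) || (l == (i, j0)) then unit_form l else (fun k => 0 * unit_form l k).
(** The regression coefficient of entry [j1] on entry [j0]; it makes the residual [b1] uncorrelated
    with entry [(i, j0)]. *)
Let al := Sigma j0 j1 / Sigma j0 j0.
Let b1 : K -> R := fun k => - al * unit_form (i, j0) k + unit_form (i, j1) k.

Let diag_gt0 : 0 < Sigma j0 j0.
Proof.
have [_ /(_ (delta_mx j0 ord0))] := posdef.
rewrite trmx_delta -rowE -colE !mxE; apply.
by apply/eqP => /colP /(_ j0); rewrite !mxE !eqxx => /eqP; rewrite oner_eq0.
Qed.

Let fam_a2 w k : k.1 != i -> fam w k = forms_of X a2 w k.
Proof. by move=> ki; rewrite /forms_of /a2 ki lin_unit_form. Qed.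

Let fam_a1 w k : k.1 != i -> fam w k = forms_of X a1 w k.
Proof. by move=> ki; rewrite /forms_of /a1 ki lin_unit_form. Qed.

Let cov_a2 l : cov Sigma (a2 l) (unit_form (i, j0)) = 0.
Proof.
rewrite /a2; case: ifPn => li; last by rewrite covZ mul0r.
by rewrite cov_unit_form /= (negbTE li).
Qed.

Let cov_a1 l : cov Sigma (a1 l) b1 = 0.
Proof.
rewrite (cov_sym posdef) /b1 cov_comb /a1; case: ifPn => [|_]; last first.
  by rewrite 2!(cov_sym posdef _ (fun k => 0 * _)) !covZ !mul0r mulr0 addr0.
rewrite !cov_unit_form /= => /orP[li|/eqP ->] /=.
  by rewrite eq_sym (negbTE li) mulr0 addr0.
have [SigmaT _] := posdef.
have -> : Sigma j1 j0 = Sigma j0 j1 by rewrite -[in LHS]SigmaT mxE.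
by rewrite eqxx /al; field; rewrite gt_eqF.
Qed.

(** Two uses of [decoupled_kern]: the residual [b1] is integrated given [a1], then entry [(i, j0)]
    given [a2]. The constant is independent of the centers and of [h]. *)
Lemma kern_pair_moment : exists2 C : R, 0 <= C &
  forall (r1 r2 : coords R K -> R) (h : coords R K -> \bar R),
  measurable_fun setT r1 -> measurable_fun setT r2 -> measurable_fun setT h ->
  (forall x, 0 <= h x)%E -> row_free r1 -> row_free r2 -> row_free h ->
  (\int[P]_w (kern (fam w (i, j0) - r1 (fam w)) * kern (fam w (i, j1) - r2 (fam w)) *
     h (fam w)) <= C%:E * \int[P]_w h (fam w))%E.
Proof.
have [s1 s10 law1] : exists2 s : R, 0 < s &
    forall B, measurable B -> P ((fun w => lin b1 (fam w)) @^-1` B) = normal_prob 0 s B.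
  apply: (@row_form_law _ i).
    move=> k ki; rewrite /b1 /unit_form; case: k ki => m j /= /negPf mi.
    by rewrite !xpair_eqE mi mulr0 addr0.
  apply/eqP => /colP /(_ j1); rewrite !mxE /b1 /unit_form !eqxx.
  rewrite xpair_eqE eqxx eq_sym (negbTE j01) mulr0 add0r => /eqP.
  by rewrite oner_eq0.
have [s2 s20 law2] : exists2 s : R, 0 < s &
    forall B, measurable B -> P ((fun w => lin (unit_form (i, j0)) (fam w)) @^-1` B) = normal_prob 0 s B.
  apply: (@row_form_law _ i).
    by move=> [m j] /= /negPf mi; rewrite /unit_form xpair_eqE mi.
  rewrite form_col_unit eqxx; apply/eqP => /colP /(_ j0); rewrite !mxE !eqxx => /eqP.
  by rewrite oner_eq0.
have C0 s : 0 <= 1 + 32 * normal_peak s :> R.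
  by rewrite addr_ge0// mulr_ge0// normal_peak_ge0.
exists ((1 + 32 * normal_peak s1) * (1 + 32 * normal_peak s2)); first exact: mulr_ge0.
move=> r1 r2 h mr1 mr2 mh h0 f1 f2 fh.
(* The regression term moves into the center, which may depend on [(i, j0)] since [a1] freezes that
   entry. *)
pose rr (x : coords R K) := r2 x - al * x (i, j0).
pose hh (x : coords R K) := (kern (x (i, j0) - r1 x) * h x)%E.
have mrr : measurable_fun setT rr.
  apply: measurable_funB => //; apply: measurable_funM => //; exact: measurable_coord.
have mhh : measurable_fun setT hh.
  apply: emeasurable_funM => //; apply: (measurableT_comp measurable_kern).
  by apply: measurable_funB => //; exact: measurable_coord.
have hh0 x : (0 <= hh x)%E by rewrite mule_ge0 ?kern_ge0.
have D1 := decoupled_kern cov_a1 s10 law1 mrr mhh hh0.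
have D2 := decoupled_kern cov_a2 s20 law2 mr1 mh h0.
have y1 w : forms_of X a1 w (i, j0) = fam w (i, j0).
  by rewrite /forms_of /a1 eqxx orbT lin_unit_form.
have E1 w : hh (forms_of X a1 w) = (kern (fam w (i, j0) - r1 (fam w)) * h (fam w))%E.
  by rewrite /hh y1 (f1 _ (fam w)) ?(fh _ (fam w))// => k /fam_a1 ->.
have E2 w : (kern (lin b1 (fam w) - rr (forms_of X a1 w)) * hh (forms_of X a1 w) =
    kern (fam w (i, j0) - r1 (fam w)) * kern (fam w (i, j1) - r2 (fam w)) * h (fam w))%E.
  rewrite E1 /rr y1 (f2 _ (fam w)); last by move=> k /fam_a1 ->.
  have -> : lin b1 (fam w) = - al * fam w (i, j0) + fam w (i, j1).
    rewrite -(lin_unit_form (i, j0)) -(lin_unit_form (i, j1)) /lin mulr_sumr -big_split.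
    by apply: eq_bigr => k _; rewrite mulrDl mulrA.
  rewrite muleA [X in (X * _)%E]muleC; congr (_ * kern _ * _)%E; ring.
under eq_integral do rewrite -E2.
apply: (le_trans D1); rewrite EFinM -muleA; apply: lee_wpmul2l; first by rewrite lee_fin.
under eq_integral do rewrite E1.
have E3 w : h (forms_of X a2 w) = h (fam w) by apply: fh => k /fam_a2 ->.
have E4 w : r1 (forms_of X a2 w) = r1 (fam w) by apply: f1 => k /fam_a2 ->.
under eq_integral => w _ do rewrite -E3 -E4 -(lin_unit_form (i, j0)).
under [X in (_ <= _ * X)%E]eq_integral => w _ do rewrite -E3.
exact: D2.
Qed.

End pair.

(* With [zeta_m = x_(m,j0) + i x_(m,j1)], these are the real and imaginary parts
   of the sum of the [zeta_m ^ 2] over the rows [m] satisfying [Q]. *)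
Definition sq_re (Q : pred 'I_n) (j0 j1 : 'I_p) (x : coords R K) : R :=
  \sum_(m | Q m) (x (m, j0) ^+ 2 - x (m, j1) ^+ 2).
Definition sq_im (Q : pred 'I_n) (j0 j1 : 'I_p) (x : coords R K) : R :=
  \sum_(m | Q m) (2 * x (m, j0) * x (m, j1)).

Let measurable_sum_cond (Q : pred 'I_n) (F : 'I_n -> coords R K -> R) :
  (forall m, measurable_fun setT (F m)) ->
  measurable_fun setT (fun x => \sum_(m | Q m) F m x).
Proof.
move=> mF; rewrite (_ : (fun x => _) =
    (fun x => \sum_(m <- [seq m <- index_enum 'I_n | Q m]) F m x)).
  exact: measurable_sum.
by apply/funext => x; rewrite big_filter.
Qed.

Lemma measurable_sq_re Q j0 j1 : measurable_fun setT (sq_re Q j0 j1).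
Proof.
apply: measurable_sum_cond => m.
by apply: measurable_funB; apply: measurable_funX; exact: measurable_coord.
Qed.

Lemma measurable_sq_im Q j0 j1 : measurable_fun setT (sq_im Q j0 j1).
Proof.
apply: measurable_sum_cond => m; apply: measurable_funM; last exact: measurable_coord.
by apply: measurable_funM => //; exact: measurable_coord.
Qed.

Let row_free_sum i Q j0 j1 : ~~ Q i ->
  row_free i (sq_re Q j0 j1) /\ row_free i (sq_im Q j0 j1).
Proof.
move=> Qi; split=> x x' xx'; apply: eq_bigr => m Qm.
  by rewrite !xx'//=; apply: contraNneq Qi => <-.
by rewrite !xx'//=; apply: contraNneq Qi => <-.
Qed.

Let kern_pair_sum i Q j0 j1 : j0 != j1 -> ~~ Q i -> exists2 C : R, 0 <= C &
  forall h : coords R K -> \bar R, measurable_fun setT h -> (forall x, 0 <= h x)%E ->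
  row_free i h ->
  (\int[P]_w (kern_pair (sq_re Q j0 j1 (fam w)) (sq_im Q j0 j1 (fam w))
     (fam w (i, j0)) (fam w (i, j1)) * h (fam w)) <= C%:E * \int[P]_w h (fam w))%E.
Proof.
move=> j01 Qi; have [C C0 HC] := kern_pair_moment i j01.
exists (C + C); first by rewrite addr_ge0.
move=> h mh h0 fh; have [fr fi] := row_free_sum j0 j1 Qi.
have mr := measurable_sq_re Q j0 j1; have mi := measurable_sq_im Q j0 j1.
pose r1 (x : coords R K) := csqrt_re (sq_re Q j0 j1 x) (sq_im Q j0 j1 x).
pose r2 (x : coords R K) := csqrt_im (sq_re Q j0 j1 x) (sq_im Q j0 j1 x).
have mr1 : measurable_fun setT r1 by exact: measurable_csqrt_re.
have mr2 : measurable_fun setT r2 by exact: measurable_csqrt_im.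
have f1 : row_free i r1 by move=> x x' xx'; rewrite /r1 (fr _ _ xx') (fi _ _ xx').
have f2 : row_free i r2 by move=> x x' xx'; rewrite /r2 (fr _ _ xx') (fi _ _ xx').
have mrN (r : coords R K -> R) : measurable_fun setT r -> measurable_fun setT (fun x => - r x).
  by move=> ?; exact: measurable_funN.
have fN (r : coords R K -> R) : row_free i r -> row_free i (fun x => - r x).
  by move=> fr' x x' xx'; rewrite (fr' _ _ xx').
have mk (r : coords R K -> R) k : measurable_fun setT r ->
    measurable_fun setT (fun w => kern (fam w k - r (fam w))).
  move=> mr'; apply: (measurableT_comp measurable_kern); apply: measurable_funB.
    exact: (measurableT_comp (measurable_coord k)).
  exact: (measurableT_comp mr').
have mhf : measurable_fun setT (fun w => h (fam w)) by exact: measurableT_comp.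
have mp (u v : coords R K -> R) : measurable_fun setT u -> measurable_fun setT v ->
    measurable_fun setT (fun w => kern (fam w (i, j0) - u (fam w)) *
      kern (fam w (i, j1) - v (fam w)) * h (fam w))%E.
  by move=> mu mv; apply: emeasurable_funM => //; apply: emeasurable_funM; exact: mk.
have k0 (u v : coords R K -> R) w : (0 <= kern (fam w (i, j0) - u (fam w)) *
      kern (fam w (i, j1) - v (fam w)))%E.
  by rewrite mule_ge0 ?kern_ge0.
under eq_integral do rewrite /kern_pair -/(r1 _) -/(r2 _) ge0_muleDl ?mule_ge0 ?kern_ge0//.
rewrite (@ge0_integralD _ _ _ P setT measurableT
  (fun w => kern (fam w (i, j0) - r1 (fam w)) *
    kern (fam w (i, j1) - r2 (fam w)) * h (fam w))%E
  (fun w => kern (fam w (i, j0) - - r1 (fam w)) *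
    kern (fam w (i, j1) - - r2 (fam w)) * h (fam w))%E); first last.
- exact: (mp _ _ (mrN _ mr1) (mrN _ mr2)).
- by move=> w _; apply: mule_ge0 => //; exact: (k0 (fun x => - r1 x) (fun x => - r2 x)).
- exact: mp.
- by move=> w _; apply: mule_ge0 => //; exact: k0.
rewrite EFinD ge0_muleDl ?lee_fin//; apply: leeD; first exact: HC.
exact: (HC (fun x => - r1 x) (fun x => - r2 x) h (mrN _ mr1) (mrN _ mr2) mh h0
  (fN _ f1) (fN _ f2) fh).
Qed.

Lemma negative_moment (i0 i1 : 'I_n) (j0 j1 : 'I_p) : i0 != i1 -> j0 != j1 ->
  (\int[P]_w kern (sq_re predT j0 j1 (fam w) ^+ 2 + sq_im predT j0 j1 (fam w) ^+ 2)
    < +oo)%E.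
Proof.
move=> i01 j01.
pose Q1 : pred 'I_n := fun m => m != i0.
pose Q2 : pred 'I_n := fun m => (m != i0) && (m != i1).
have [C1 C10 H1] := @kern_pair_sum i0 Q1 j0 j1 j01 (negbT (negbF (eqxx i0))).
have [C2 C20 H2] : exists2 C : R, 0 <= C & forall h : coords R K -> \bar R,
  measurable_fun setT h -> (forall x, 0 <= h x)%E -> row_free i1 h ->
  (\int[P]_w (kern_pair (sq_re Q2 j0 j1 (fam w)) (sq_im Q2 j0 j1 (fam w))
     (fam w (i1, j0)) (fam w (i1, j1)) * h (fam w)) <= C%:E * \int[P]_w h (fam w))%E.
  by apply: kern_pair_sum => //; rewrite /Q2 eqxx andbF.
(* What row [i0] leaves behind: [csqrt_norm] being [|r|^2], this is [|r|^(-3/2)]. *)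
pose h (x : coords R K) := kern (csqrt_norm (sq_re Q1 j0 j1 x) (sq_im Q1 j0 j1 x)).
have mh : measurable_fun setT h.
  apply: (measurableT_comp measurable_kern); apply: measurable_csqrt_norm.
    exact: measurable_sq_re.
  exact: measurable_sq_im.
have h0 x : (0 <= h x)%E by exact: kern_ge0.
have fh : row_free i0 h.
  have Qi : ~~ Q1 i0 by rewrite /Q1 eqxx.
  have [fr fi] := row_free_sum j0 j1 Qi.
  by move=> x x' xx'; rewrite /h (fr _ _ xx') (fi _ _ xx').
have mkp Q i : measurable_fun setT (fun w => kern_pair (sq_re Q j0 j1 (fam w))
    (sq_im Q j0 j1 (fam w)) (fam w (i, j0)) (fam w (i, j1))).
  have mre : measurable_fun setT (fun w => sq_re Q j0 j1 (fam w)).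
    by apply: (measurableT_comp (measurable_sq_re Q j0 j1)).
  have mim : measurable_fun setT (fun w => sq_im Q j0 j1 (fam w)).
    by apply: (measurableT_comp (measurable_sq_im Q j0 j1)).
  have mc k : measurable_fun setT (fun w => fam w k).
    exact: (measurableT_comp (measurable_coord k)).
  have m1 := measurable_csqrt_re mre mim; have m2 := measurable_csqrt_im mre mim.
  by apply: emeasurable_funD; apply: emeasurable_funM;
    apply: (measurableT_comp measurable_kern); apply: measurable_funB => //; exact: measurable_funN.
have kp0 a b y z : (0 <= kern_pair a b y z :> \bar R)%E.
  by rewrite adde_ge0// mule_ge0 ?kern_ge0.
apply: (@le_lt_trans _ _ (C1%:E * (C2%:E * 1%:E))%E); last by rewrite -!EFinM ltry.
apply: (@le_trans _ _ (C1%:E * \int[P]_w h (fam w))%E).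
  apply: le_trans (H1 h mh h0 fh); apply: ge0_le_integral => //.
  - by move=> w _; exact: kern_ge0.
  - apply: (measurableT_comp measurable_kern); apply: measurable_funD;
      apply: measurable_funX.
      by apply: (measurableT_comp (measurable_sq_re predT j0 j1)).
    by apply: (measurableT_comp (measurable_sq_im predT j0 j1)).
  - by apply: emeasurable_funM => //; exact: (measurableT_comp mh).
  move=> w _; rewrite [sq_re predT _ _ _](bigD1 i0)//= [sq_im predT _ _ _](bigD1 i0)//=.
  exact: kern_quadratic.
apply: lee_wpmul2l; first by rewrite lee_fin.
(* Row [i1] is integrated against the constant 1: nothing singular is left for the remaining
   rows. *)
have := H2 (cst 1%E) (measurable_cst _) (fun _ => lee01) (fun _ _ _ => erefl).
rewrite /= integral_cst// mul1e [X in (_ <= _ * X)%E -> _]probability_setT.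
apply: le_trans; apply: ge0_le_integral => //.
- exact: (measurableT_comp mh).
- by apply: emeasurable_funM.
have Q11 : Q1 i1 by rewrite /Q1 eq_sym.
move=> w _; rewrite mule1 /h [sq_re Q1 _ _ _](bigD1 i1 Q11)/=.
rewrite [sq_im Q1 _ _ _](bigD1 i1 Q11)/=.
exact: kern_csqrt_norm.
Qed.

End negative_moment.

(** * Algebra of the two shrinkage estimators *)

Section shrinkage_algebra.
Context {R : realType} {p n : nat}.
Implicit Types x : 'I_n -> 'cV[R]_p.

Definition gram x (i l : 'I_n) : R := \sum_j x i j ord0 * x l j ord0.

Definition total_sq x : R := \sum_i gram x i i.

Lemma ShatE x j k : Shat x j k = n%:R^-1 * \sum_i x i j ord0 * x i k ord0.
Proof.
rewrite /Shat mxE summxE; congr (_ * _); apply: eq_bigr => i _.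
by rewrite mxE big_ord1 mxE.
Qed.

Lemma Shat_sym x j k : Shat x j k = Shat x k j.
Proof. by rewrite !ShatE; congr (_ * _); apply: eq_bigr => i _; rewrite mulrC. Qed.

Lemma tr_Shat x : \tr (Shat x) = n%:R^-1 * total_sq x.
Proof.
rewrite /mxtrace; under eq_bigr do rewrite ShatE.
by rewrite -mulr_sumr exchange_big.
Qed.

Lemma tr_Shat2_frob2 x : \tr (Shat x *m Shat x) = frob2 (Shat x).
Proof.
rewrite /mxtrace /frob2; apply: eq_bigr => j _; rewrite mxE.
by apply: eq_bigr => k _; rewrite (Shat_sym x k j) expr2.
Qed.

Lemma tr_Shat2 x : \tr (Shat x *m Shat x) = n%:R ^- 2 * \sum_i \sum_l gram x i l ^+ 2.
Proof.
rewrite tr_Shat2_frob2 /frob2.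
transitivity (\sum_j \sum_k n%:R ^- 2 * (\sum_i \sum_l
    (x i j ord0 * x i k ord0) * (x l j ord0 * x l k ord0))).
  apply: eq_bigr => j _; apply: eq_bigr => k _.
  by rewrite ShatE exprMn exprVn; congr (_ * _); rewrite expr2 big_distrlr.
under eq_bigr do rewrite -mulr_sumr.
rewrite -mulr_sumr; congr (_ * _).
transitivity (\sum_j \sum_i \sum_l \sum_k
    (x i j ord0 * x i k ord0) * (x l j ord0 * x l k ord0)).
  apply: eq_bigr => j _; rewrite exchange_big; apply: eq_bigr => i _.
  by rewrite exchange_big.
rewrite exchange_big; apply: eq_bigr => i _; rewrite exchange_big.
apply: eq_bigr => l _; rewrite /gram expr2 big_distrlr.
by apply: eq_bigr => j _; apply: eq_bigr => k _ /=; ring.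
Qed.

Lemma rho_LW_numerator x : (0 < n)%N ->
  \sum_i frob2 (x i *m (x i)^T - Shat x) =
  \sum_i gram x i i ^+ 2 - n%:R * \tr (Shat x *m Shat x).
Proof.
move=> n0; have nn0 : n%:R != 0 :> R by rewrite pnatr_eq0 -lt0n.
have xE i j k : (x i *m (x i)^T) j k = x i j ord0 * x i k ord0.
  by rewrite mxE big_ord1 mxE.
transitivity (\sum_i (gram x i i ^+ 2 - 2 * \sum_j \sum_k x i j ord0 * x i k ord0 * Shat x j k
    + frob2 (Shat x))).
  apply: eq_bigr => i _; rewrite /frob2 /gram expr2 big_distrlr mulr_sumr -sumrB -big_split.
  apply: eq_bigr => j _ /=; rewrite mulr_sumr -sumrB -big_split; apply: eq_bigr => k _ /=.
  by rewrite !mxE big_ord1 mxE; ring.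
rewrite big_split sumrB/= -mulr_sumr sumr_const card_ord.
have -> : \sum_i \sum_j \sum_k x i j ord0 * x i k ord0 * Shat x j k =
    n%:R * frob2 (Shat x).
  rewrite exchange_big mulr_sumr; apply: eq_bigr => j _; rewrite exchange_big mulr_sumr.
  apply: eq_bigr => k _; rewrite -mulr_suml expr2 mulrA; congr (_ * _).
  by rewrite ShatE mulVKf.
by rewrite tr_Shat2_frob2 -mulr_natl; ring.
Qed.

(** Each entry of [Fhat - Shat] is therefore at most the square root of [denomLW], so the quotient
    of the two is only as large as [denomLW^(-1/2)]. *)
Lemma denomLW_frob2 x : (0 < p)%N -> denomLW x = frob2 (Shat x - Fhat x).
Proof.
move=> p0; have pp0 : p%:R != 0 :> R by rewrite pnatr_eq0 -lt0n.
set f := \tr (Shat x) / p%:R.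
transitivity (\sum_j \sum_k (Shat x j k ^+ 2 - 2 * f * (Shat x j k *+ (j == k)) + f ^+ 2 *+ (j == k))).
  rewrite /denomLW tr_Shat2_frob2 /frob2.
  under [RHS]eq_bigr do rewrite big_split sumrB/= -mulr_sumr.
  rewrite big_split sumrB/= -mulr_sumr.
  have -> : \sum_j \sum_k Shat x j k *+ (j == k) = \tr (Shat x).
    apply: eq_bigr => j _; rewrite (bigD1 j)//= eqxx mulr1n big1 ?addr0// => k kj.
    by rewrite eq_sym (negbTE kj).
  have -> : \sum_(j < p) \sum_(k < p) f ^+ 2 *+ (j == k) = p%:R * f ^+ 2.
    rewrite (eq_bigr (fun=> f ^+ 2)) ?sumr_const ?card_ord ?mulr_natl// => j _.
    rewrite (bigD1 j)//= eqxx mulr1n big1 ?addr0// => k kj.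
    by rewrite eq_sym (negbTE kj).
  by rewrite /f; field.
rewrite /frob2; apply: eq_bigr => j _; apply: eq_bigr => k _.
rewrite !mxE -/f; case: (j == k); rewrite /= ?mulr1n ?mulr0n; ring.
Qed.

Lemma frob2_ge_entry (A : 'M[R]_p) j k : A j k ^+ 2 <= frob2 A.
Proof.
rewrite /frob2 (bigD1 j)//= (bigD1 k)//= -addrA lerDl addr_ge0 ?sumr_ge0//.
  by move=> l _; exact: sqr_ge0.
by move=> i _; apply: sumr_ge0 => l _; exact: sqr_ge0.
Qed.

Lemma frob2_ge0 (A : 'M[R]_p) : 0 <= frob2 A.
Proof. by apply: sumr_ge0 => i _; apply: sumr_ge0 => l _; exact: sqr_ge0. Qed.

Lemma frob2_ge_block (A : 'M[R]_p) j k : j != k ->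
  A j j ^+ 2 + A j k ^+ 2 + (A k j ^+ 2 + A k k ^+ 2) <= frob2 A.
Proof.
move=> jk; rewrite /frob2 (bigD1 j)//= [X in _ <= _ + X](bigD1 k) 1?eq_sym//=.
have row i : A i j ^+ 2 + A i k ^+ 2 <= \sum_l A i l ^+ 2.
  rewrite (bigD1 j)//= [X in _ <= _ + X](bigD1 k) 1?eq_sym//= addrA lerDl sumr_ge0//.
  by move=> l _; exact: sqr_ge0.
apply: lerD; first exact: row.
rewrite -[leLHS]addr0; apply: lerD; first exact: row.
by apply: sumr_ge0 => i _; apply: sumr_ge0 => l _; exact: sqr_ge0.
Qed.

Lemma deviationE x j k :
  (Shat x - Fhat x) j k = Shat x j k - (\tr (Shat x) / p%:R) *+ (j == k).
Proof. by rewrite !mxE; case: (j == k); rewrite ?mulr1 ?mulr0. Qed.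

(** Only the block of indices [j0], [j1] of [Shat - Fhat] is kept. With diagonal entries [u], [v]
    and off-diagonal entry [s], the claim is [(u - v)^2 + (2 s)^2 <= 2 (u^2 + v^2 + 2 s^2)]; the
    trace part cancels in [u - v]. *)
Lemma denomLW_ge x j0 j1 : (0 < n)%N -> (0 < p)%N -> j0 != j1 ->
  (\sum_i (x i j0 ord0 ^+ 2 - x i j1 ord0 ^+ 2)) ^+ 2 +
  (\sum_i 2 * x i j0 ord0 * x i j1 ord0) ^+ 2 <= 2 * n%:R ^+ 2 * denomLW x.
Proof.
move=> n0 p0 j01; have nn0 : n%:R != 0 :> R by rewrite pnatr_eq0 -lt0n.
rewrite denomLW_frob2//.
have re : \sum_i (x i j0 ord0 ^+ 2 - x i j1 ord0 ^+ 2) = n%:R * (Shat x j0 j0 - Shat x j1 j1).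
  by rewrite !ShatE mulrBr !mulVKf// -sumrB.
have im : \sum_i 2 * x i j0 ord0 * x i j1 ord0 = n%:R * (2 * Shat x j0 j1).
  rewrite ShatE mulrCA mulVKf// mulr_sumr; apply: eq_bigr => i _; ring.
have B := frob2_ge_block (Shat x - Fhat x) j01.
have o0 : (Shat x - Fhat x) j0 j1 = Shat x j0 j1.
  by rewrite deviationE (negbTE j01) subr0.
have o1 : (Shat x - Fhat x) j1 j0 = Shat x j0 j1.
  by rewrite deviationE eq_sym (negbTE j01) subr0 Shat_sym.
have dd : Shat x j0 j0 - Shat x j1 j1 = (Shat x - Fhat x) j0 j0 - (Shat x - Fhat x) j1 j1.
  by rewrite !deviationE !eqxx; ring.
rewrite re im dd !exprMn -mulrDr.
have -> : 2 * n%:R ^+ 2 * frob2 (Shat x - Fhat x) = n%:R ^+ 2 * (2 * frob2 (Shat x - Fhat x)).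
  by ring.
rewrite ler_wpM2l ?sqr_ge0//.
rewrite o0 o1 in B.
move: (frob2 _) ((Shat x - Fhat x) j0 j0) ((Shat x - Fhat x) j1 j1) (Shat x j0 j1) B => f u v s B.
by have := sqr_ge0 (u + v); nra.
Qed.

(* The only part of [Sigma_LW - Sigma_RBLW] that is not a function of [Shat]. *)
Definition gram_diff x (i l : 'I_n) : R :=
  (gram x i i - gram x l l) ^+ 2 / 2 - 2 * gram x i l ^+ 2.

(** A function of [Shat] alone; both estimators are [Shat] plus a scalar multiple of it. *)
Definition direction x (j k : 'I_p) : R := (Fhat x - Shat x) j k / denomLW x.

Lemma Sigma_LW_entry x j k : (0 < n)%N ->
  Sigma_LW x j k = Shat x j k +
  (\sum_i gram x i i ^+ 2 - n%:R * \tr (Shat x *m Shat x)) / n%:R ^+ 2 * direction x j k.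
Proof.
move=> n0; rewrite /direction -rho_LW_numerator//.
transitivity (Shat x j k + rho_LW x * (Fhat x - Shat x) j k).
  rewrite /Sigma_LW [LHS]mxE [X in X + _]mxE [X in _ + X]mxE [(Fhat x - Shat x) j k]mxE.
  by rewrite [(- Shat x) j k]mxE; ring.
by congr (_ + _); rewrite /rho_LW invfM; ring.
Qed.

Lemma Sigma_RBLW_entry x j k :
  Sigma_RBLW x j k = Shat x j k +
  ((n%:R - 2) / n%:R * \tr (Shat x *m Shat x) + \tr (Shat x) ^+ 2) / (n%:R + 2) *
    direction x j k.
Proof.
rewrite /direction; transitivity (Shat x j k + rho_RBLW x * (Fhat x - Shat x) j k).
  rewrite /Sigma_RBLW [LHS]mxE [X in X + _]mxE [X in _ + X]mxE [(Fhat x - Shat x) j k]mxE.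
  by rewrite [(- Shat x) j k]mxE; ring.
by congr (_ + _); rewrite /rho_RBLW invfM; ring.
Qed.

(** In the double sum [gram x i i ^+ 2] has coefficient [n] from the pairs plus 2 from the excluded
    diagonal. This is the [n + 2] in the denominator of [rho_RBLW], whose other coefficients match
    the rest of the sum. *)
Lemma Sigma_LW_sub_RBLW x j k : (0 < n)%N ->
  Sigma_LW x j k - Sigma_RBLW x j k =
  (n%:R ^+ 2 * (n%:R + 2))^-1 *
  \sum_i \sum_(l | l != i) gram_diff x i l * direction x j k.
Proof.
move=> n0; have nn0 : n%:R != 0 :> R by rewrite pnatr_eq0 -lt0n.
have n2 : n%:R + 2 != 0 :> R by rewrite gt_eqF// ltr_wpDl.
rewrite Sigma_LW_entry// Sigma_RBLW_entry opprD addrACA subrr add0r -mulrBl.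
have -> : \sum_i \sum_(l | l != i) gram_diff x i l * direction x j k =
    (\sum_i \sum_(l | l != i) gram_diff x i l) * direction x j k.
  by rewrite mulr_suml; apply: eq_bigr => i _; rewrite mulr_suml.
rewrite [RHS]mulrA; congr (_ * _).
have -> : \sum_i \sum_(l | l != i) gram_diff x i l =
    n%:R * \sum_i gram x i i ^+ 2 - total_sq x ^+ 2
    - 2 * \sum_i \sum_l gram x i l ^+ 2 + 2 * \sum_i gram x i i ^+ 2.
  (* The diagonal value of [gram_diff] is [-2 * gram x i i ^+ 2]; adding it back frees the sum over
     [l]. *)
  transitivity (\sum_i (\sum_l gram_diff x i l + 2 * gram x i i ^+ 2)).
    apply: eq_bigr => i _; rewrite [in RHS](bigD1 i)//= /gram_diff subrr expr0n/= mul0r sub0r.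
    by rewrite addrAC addNr add0r.
  rewrite big_split/= -mulr_sumr; congr (_ + _).
  transitivity (\sum_i \sum_l (gram x i i ^+ 2 / 2 + gram x l l ^+ 2 / 2
     - gram x i i * gram x l l - 2 * gram x i l ^+ 2)).
    by apply: eq_bigr => i _; apply: eq_bigr => l _; rewrite /gram_diff; field.
  have inner i : \sum_l (gram x i i ^+ 2 / 2 + gram x l l ^+ 2 / 2
     - gram x i i * gram x l l - 2 * gram x i l ^+ 2) =
     n%:R / 2 * gram x i i ^+ 2 + (\sum_l gram x l l ^+ 2) / 2 - gram x i i * total_sq x
     - 2 * \sum_l gram x i l ^+ 2.
    rewrite !sumrB big_split/= sumr_const card_ord -mulr_suml -!mulr_sumr -mulr_natl.
    by rewrite /total_sq; field.
  rewrite (eq_bigr _ (fun i _ => inner i)) !sumrB big_split/= sumr_const card_ord.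
  rewrite -!mulr_sumr -mulr_suml -mulr_natl -/(total_sq x).
  by field.
rewrite tr_Shat2 tr_Shat.
move: (\sum_i \sum_l _) (\sum_i gram x i i ^+ 2) (total_sq x) => u v t.
by field; rewrite nn0 n2.
Qed.

End shrinkage_algebra.

(** * Moments of order 12 *)

Lemma sum_exp_le (R : realType) (I : finType) (y : I -> R) m :
  (forall i, 0 <= y i) ->
  (\sum_i y i) ^+ m.+1 <= #|I|%:R ^+ m.+1 * \sum_i y i ^+ m.+1.
Proof.
move=> y0; have [i0|I0] := pickP I; last first.
  by rewrite !big1 ?expr0n ?mulr0// => i; have := I0 i.
move=> _; pose M := [arg max_(i > i0) y i]%O.
have yM i : y i <= y M by rewrite /M; case: arg_maxP => // j _; apply.
apply: (@le_trans _ _ ((#|I|%:R * y M) ^+ m.+1)).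
  rewrite lerXn2r ?nnegrE ?sumr_ge0 ?mulr_ge0//.
  rewrite (le_trans (ler_sum _ (fun i _ => yM i)))// sumr_const.
  by rewrite mulr_natl.
rewrite exprMn ler_wpM2l ?exprn_ge0// (bigD1 M)//= lerDl.
by apply: sumr_ge0 => i _; rewrite exprn_ge0.
Qed.

Section moments.
Context d (T : measurableType d) {R : realType} (P : probability T R).
Local Notation mu := (@lebesgue_measure R).

Lemma normal_law_ge0_integral (Y : T -> R) (s : R) (f : measurableTypeR R -> \bar R) :
  measurable_fun setT Y ->
  (forall B, measurable B -> P (Y @^-1` B) = normal_prob 0 s B) ->
  measurable_fun setT f -> (forall x, 0 <= f x)%E ->
  (\int[P]_w f (Y w) = \int[mu]_x (f x * (normal_pdf 0 s x)%:E))%E.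
Proof.
move=> mY lawY mf f0.
have mY1 : measurable_fun setT (Y : T -> measurableTypeR R) := mY.
pose X : {RV P >-> measurableTypeR R} :=
  HB.pack Y (isMeasurableFun.Build _ _ _ (measurableTypeR R) _ mY1).
transitivity (\int[distribution P X]_x f x)%E.
  by rewrite ge0_integral_distribution.
transitivity (\int[normal_prob 0 s]_x f x)%E; last exact: ge0_integral_normal_prob.
by apply: eq_measure_integral => A mA _; exact: lawY.
Qed.

(** With [y = x^2 / (4 s^2)] the Gaussian factor is [expR (- y) ^+ 2]: one half absorbs [x^12]
    through [y^6 <= 6! expR y], the other is a Gaussian of deviation [sqrt 2 * s]. *)
Lemma pow12_normal_pdf (s : R) : 0 < s -> exists2 C : R, 0 <= C &
  forall x, x ^+ 12 * normal_pdf 0 s x <= C * normal_pdf 0 (Num.sqrt 2 * s) x.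
Proof.
move=> s0; have t0 : 0 < Num.sqrt 2 * s by rewrite mulr_gt0.
have p1 := normal_peak_gt0 (lt0r_neq0 s0); have p2 := normal_peak_gt0 (lt0r_neq0 t0).
have [k k0 expk] : exists2 k : R, 0 < k & forall y, 0 <= y -> y ^+ 6 <= k * expR y.
  exists 6`!%:R; first by rewrite ltr0n fact_gt0.
  move=> y y0; have := expR_ge1Dxn 5 y0.
  have : 0 < 6`!%:R :> R by rewrite ltr0n fact_gt0.
  move: (6`!%:R : R) => f f0 h; rewrite mulrC -ler_pdivrMr//.
  by apply: le_trans h; rewrite lerDr.
have s40 : 0 <= (4 * s ^+ 2) ^+ 6 by apply: exprn_ge0; apply: mulr_ge0; [|exact: sqr_ge0].
exists ((4 * s ^+ 2) ^+ 6 * k * normal_peak s / normal_peak (Num.sqrt 2 * s)).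
  apply: divr_ge0; last exact: ltW.
  apply: mulr_ge0; last exact: ltW.
  by apply: mulr_ge0 => //; exact: ltW.
move=> x; rewrite (normal_pdfE _ (lt0r_neq0 s0)) (normal_pdfE _ (lt0r_neq0 t0)).
have s2 : s ^+ 2 != 0 by rewrite expf_neq0// gt_eqF.
pose y := x ^+ 2 / (4 * s ^+ 2).
have y0 : 0 <= y by rewrite divr_ge0 ?sqr_ge0// mulr_ge0// sqr_ge0.
have e1 : normal_fun 0 s x = expR (- y) * expR (- y).
  rewrite -expRD /normal_fun; congr expR; rewrite /y subr0 -mulr_natr.
  by field; rewrite gt_eqF.
have e2 : normal_fun 0 (Num.sqrt 2 * s) x = expR (- y).
  rewrite /normal_fun; congr expR; rewrite /y subr0 exprMn sqr_sqrtr// -mulr_natr.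
  by field; rewrite gt_eqF.
have x12 : x ^+ 12 = (4 * s ^+ 2) ^+ 6 * y ^+ 6.
  have xy : x ^+ 2 = 4 * s ^+ 2 * y by rewrite /y mulrC divfK// mulf_neq0.
  by rewrite (exprM x 2 6) xy exprMn.
have yE : y ^+ 6 * expR (- y) <= k.
  by rewrite expRN ler_pdivrMr ?expR_gt0// expk.
rewrite e1 e2 x12.
move: (normal_peak (Num.sqrt 2 * s)) (normal_peak s) (expR (- y)) (expR_ge0 (- y)) yE p2 p1.
move=> N2 N1 E E0 yE p2 p1.
move: ((4 * s ^+ 2) ^+ 6) s40 => c c0.
have -> : c * y ^+ 6 * (N1 * (E * E)) = c * N1 * E * (y ^+ 6 * E) by ring.
have -> : c * k * N1 / N2 * (N2 * E) = c * N1 * E * k by field; rewrite gt_eqF.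
apply: ler_wpM2l => //; apply: mulr_ge0 => //; apply: mulr_ge0 => //; exact: ltW.
Qed.

Lemma normal_moment12 (Y : T -> R) (s : R) : 0 < s -> measurable_fun setT Y ->
  (forall B, measurable B -> P (Y @^-1` B) = normal_prob 0 s B) ->
  (\int[P]_w (Y w ^+ 12)%:E < +oo)%E.
Proof.
move=> s0 mY lawY; have [C C0 HC] := pow12_normal_pdf s0.
have mp m t : measurable_fun setT (fun x => (normal_pdf m t x)%:E : \bar R).
  by apply/measurable_EFinP; exact: measurable_normal_pdf.
rewrite (@normal_law_ge0_integral Y s (fun x => (x ^+ 12)%:E))//; last 2 first.
- by apply/measurable_EFinP; exact: measurable_funX.
- by move=> x; rewrite lee_fin (exprM x 6 2) sqr_ge0.
apply: (@le_lt_trans _ _ (\int[mu]_x (C%:E * (normal_pdf 0 (Num.sqrt 2 * s) x)%:E))%E).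
  apply: ge0_le_integral => //.
  - by move=> x _; rewrite mule_ge0// lee_fin ?normal_pdf_ge0// (exprM x 6 2) sqr_ge0.
  - apply: emeasurable_funM; last exact: mp.
    by apply/measurable_EFinP; exact: measurable_funX.
  - by apply: emeasurable_funM => //; exact: mp.
  - by move=> x _; rewrite -!EFinM lee_fin.
rewrite ge0_integralZl ?integral_normal_pdf ?mule1 ?ltry//.
- exact: mp.
- by move=> x _; rewrite lee_fin normal_pdf_ge0.
Qed.

End moments.

(** * Conditional expectation and mean square *)

Section conditional_mean_square.
Context {d : measure_display} {T : measurableType d} {R : realType}.
Variables (P : probability T R) (G : set (set T)).

(* After splitting the space into the G-measurable level sets [k e <= Z - c < (k + 1) e],
   conditional Jensen for the square is, on each piece, the tangent inequality
   [y^2 >= a^2 + 2 a (y - a)] with the constant [a = k e]. *)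
Lemma cond_exp_mean_square (Y Z : T -> R) (c : R) : is_cond_exp P G Y Z ->
  (\int[P]_w ((Z w - c) ^+ 2)%:E <= \int[P]_w ((Y w - c) ^+ 2)%:E)%E.
Proof.
move=> [iY [iZ [GZ YZ]]].
have mY : measurable_fun setT Y by apply/measurable_EFinP; exact: measurable_int iY.
have mZ : measurable_fun setT Z by apply/measurable_EFinP; exact: measurable_int iZ.
have mY2 : measurable_fun setT (fun w => ((Y w - c) ^+ 2)%:E).
  by apply/measurable_EFinP; apply: measurable_funX; exact: measurable_funB.
have mZ2 : measurable_fun setT (fun w => ((Z w - c) ^+ 2)%:E).
  by apply/measurable_EFinP; apply: measurable_funX; exact: measurable_funB.
have sq0 (u : R) : (0 <= (u ^+ 2)%:E)%E by rewrite lee_fin sqr_ge0.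
apply/lee_addgt0Pr => e2 e20.
(* The error on each piece is [e ^+ 2 = e2] times its probability, so the total error is [e2]. *)
pose e := Num.sqrt e2; have e0 : 0 < e by rewrite sqrtr_gt0.
pose lev (w : T) : int := Num.floor ((Z w - c) / e).
(* Integer levels are coded by naturals to form a sequence of pieces; codes that no level uses give
   empty pieces. *)
pose A (k : nat) : set T := [set w | pickle (lev w) = k].
have levP w : (lev w)%:~R * e <= Z w - c < (lev w)%:~R * e + e.
  have := floor_itv ((Z w - c) / e); rewrite -/(lev w).
  rewrite intrD => /andP[h1 h2]; rewrite -ler_pdivlMr// h1/=.
  by move: h2; rewrite ltr_pdivrMr// mulrDl mul1r.
have AE k : A k = set0 \/ exists m : int, A k = Z @^-1` `[(m%:~R * e + c)%R, (m%:~R * e + e + c)%R[%classic /\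
    (forall w, A k w -> lev w = m).
  have [[w0 Aw0]|nA] := pselect (exists w, A k w); last first.
    by left; apply/seteqP; split => w // Aw; apply: nA; exists w.
  right; exists (lev w0); have lv w : A k w -> lev w = lev w0.
    by rewrite /A /= => h; apply: (pcan_inj pickleK); rewrite h Aw0.
  split=> //; apply/seteqP; split => w /=.
    by move=> Aw; have := levP w; rewrite (lv _ Aw) in_itv/=; lra.
  rewrite in_itv/= => /andP[h1 h2]; rewrite /A /= -Aw0; congr pickle.
  apply/eqP; rewrite eq_le; apply/andP; split.
    have : (lev w)%:~R * e < ((lev w0)%:~R + 1) * e.
      by have := levP w; lra.
    by rewrite ltr_pM2r// -intrD1 ltr_int ltzD1.
  have : (lev w0)%:~R * e < ((lev w)%:~R + 1) * e by have := levP w; lra.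
  by rewrite ltr_pM2r// -intrD1 ltr_int ltzD1.
have mA k : measurable (A k).
  by case: (AE k) => [->//|[m [-> _]]]; rewrite -[X in measurable X]setTI; exact: mZ.
have tA : trivIset setT A by move=> i j _ _ [w [<- <-]].
have cA : \bigcup_k A k = setT by apply/seteqP; split => // w _; exists (pickle (lev w)).
have piece k : (\int[P]_(w in A k) ((Z w - c) ^+ 2)%:E <=
    \int[P]_(w in A k) (((Y w - c) ^+ 2)%:E + e2%:E))%E.
  case: (AE k) => [->|[m [Am levm]]]; first by rewrite !integral_set0.
  have GA : G (A k) by rewrite Am; apply: GZ.
  pose a : R := m%:~R * e + c; pose q : R := m%:~R * e.
  have iYA : P.-integrable (A k) (EFin \o Y) by apply: (integrableS measurableT).
  have iZA : P.-integrable (A k) (EFin \o Z) by apply: (integrableS measurableT).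
  have ic (u : R) : P.-integrable (A k) (EFin \o cst u).
    by apply: finite_measure_integrable_cst.
  have ilin (W : T -> R) : P.-integrable (A k) (EFin \o W) ->
      P.-integrable (A k) (EFin \o (fun w => 2 * q * W w + (e2 - 2 * q * c - q ^+ 2))).
    move=> iW; exact: (integrableD (mA k) (integrableZl (mA k) (2 * q) iW) (ic _)).
  have lin_eq : (\int[P]_(w in A k) (2 * q * Z w + (e2 - 2 * q * c - q ^+ 2))%:E =
      \int[P]_(w in A k) (2 * q * Y w + (e2 - 2 * q * c - q ^+ 2))%:E)%E.
    under eq_integral do rewrite EFinD EFinM.
    under [RHS]eq_integral do rewrite EFinD EFinM.
    rewrite !integralD//; last 4 first.
    - exact: (integrableZl (mA k) (2 * q) iYA).
    - exact: ic.
    - exact: (integrableZl (mA k) (2 * q) iZA).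
    - exact: ic.
    by rewrite !integralZl// YZ.
  have sub (W : T -> R) : measurable_fun setT W -> measurable_fun (A k) (EFin \o W).
    by move=> mW; apply: measurable_funTS; exact/measurable_EFinP.
  (* With [V = Z - c], [V^2 = 2 q V - q^2 + (V - q)^2] and [|V - q| <= e] on the piece. By [lin_eq]
     the affine bound has the same integral for [Y], where it lies below [(Y - c)^2 + e2]. *)
  apply: (@le_trans _ _ (\int[P]_(w in A k) (2 * q * Z w + (e2 - 2 * q * c - q ^+ 2))%:E)%E).
    apply: ge0_le_integral => //.
    - exact: measurable_funTS.
    - exact: measurable_int (ilin _ iZA).
    - move=> w Aw; rewrite lee_fin.
      have := levP w; rewrite (levm _ Aw) -/q => /andP[h1 h2].
      have -> : e2 = e ^+ 2 by rewrite sqr_sqrtr// ltW.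
      have : (Z w - c - q) ^+ 2 <= e ^+ 2 by rewrite lerXn2r// ?nnegrE; lra.
      by nra.
  have mg : measurable_fun (A k) (fun w => ((Y w - c) ^+ 2)%:E + e2%:E)%E.
    by apply: measurable_funTS; exact: emeasurable_funD.
  have g0 w : (0 <= ((Y w - c) ^+ 2)%:E + e2%:E)%E.
    by rewrite adde_ge0// lee_fin ltW.
  (* An infinite right side is trivial; a finite one supplies the integrability that the comparison
     of integrals needs. *)
  have [goo|goo] := eqVneq (\int[P]_(w in A k) (((Y w - c) ^+ 2)%:E + e2%:E))%E +oo%E.
    by rewrite goo leey.
  rewrite lin_eq; apply: le_integral => //.
  - exact: ilin.
  - apply/integrableP; split => //; rewrite ltey; move: goo; congr (_ != _).
    by apply: eq_integral => w _; rewrite gee0_abs.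
  - move=> w _; rewrite -EFinD lee_fin.
    by have := sqr_ge0 (Y w - c - q); nra.
have split_int (f : T -> \bar R) : measurable_fun setT f -> (forall w, 0 <= f w)%E ->
    (\int[P]_w f w = \sum_(0 <= k <oo) \int[P]_(w in A k) f w)%E.
  move=> mf f0; rewrite -{1}cA ge0_integral_bigcup//.
  exact: measurable_funTS.
have e20' : (0 <= e2%:E)%E by rewrite lee_fin ltW.
have -> : (\int[P]_w ((Y w - c) ^+ 2)%:E + e2%:E =
    \int[P]_w (((Y w - c) ^+ 2)%:E + e2%:E))%E.
  rewrite ge0_integralD// integral_cst//; congr (_ + _)%E.
  by rewrite [X in (_ * X)%E]probability_setT mule1.
rewrite !split_int//; last 2 first.
- exact: emeasurable_funD.
- by move=> w; rewrite adde_ge0.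
by apply: lee_nneseries => k _; [move=> _; exact: integral_ge0|exact: piece].
Qed.

End conditional_mean_square.

(** * Statistics of the sample as functions of its coordinates *)

Section coordinate_form.
Context {R : realType} {p n : nat}.
Local Notation K := ('I_n * 'I_p)%type.
Implicit Types v : coords R K.

Definition rows v : 'I_n -> 'cV[R]_p := fun i => \col_j v (i, j).

Lemma rowsE v i j : rows v i j ord0 = v (i, j). Proof. by rewrite mxE. Qed.

Lemma gram_ge0 x i : 0 <= @gram R p n x i i.
Proof. by apply: sumr_ge0 => j _; rewrite -expr2 sqr_ge0. Qed.

Lemma gram_le_total x i : @gram R p n x i i <= total_sq x.
Proof.
rewrite /total_sq (bigD1 i)//= lerDl; apply: sumr_ge0 => l _; exact: gram_ge0.
Qed.

Lemma total_sq_ge0 x : 0 <= @total_sq R p n x.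
Proof. by apply: sumr_ge0 => l _; exact: gram_ge0. Qed.

Lemma norm_gram_le x i l : `|@gram R p n x i l| <= total_sq x.
Proof.
apply: (@le_trans _ _ ((gram x i i + gram x l l) / 2)); last first.
  by have := gram_le_total x i; have := gram_le_total x l; lra.
rewrite /gram -big_split/= mulr_suml; apply: le_trans (ler_norm_sum _ _ _) _.
apply: ler_sum => j _; rewrite ler_norml.
have := sqr_ge0 (x i j ord0 + x l j ord0); have := sqr_ge0 (x i j ord0 - x l j ord0).
by move=> h1 h2; apply/andP; split; nra.
Qed.

Lemma norm_Shat_le x j k : `|@Shat R p n x j k| <= total_sq x.
Proof.
have [n0|n0] := posnP n.
  rewrite ShatE big1 ?mulr0 ?normr0 ?total_sq_ge0// => i _.
  by case: i => m mn; exfalso; move: mn; rewrite n0.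
have nn : 1 <= n%:R :> R by rewrite ler1n.
rewrite ShatE normrM normfV normr_nat ler_pdivrMl ?(lt_le_trans _ nn)//.
apply: (@le_trans _ _ (total_sq x)); last by rewrite ler_peMl ?total_sq_ge0.
apply: le_trans (ler_norm_sum _ _ _) _; rewrite /total_sq; apply: ler_sum => i _.
have sq m : x i m ord0 ^+ 2 <= gram x i i.
  rewrite /gram (bigD1 m)//= -expr2 lerDl; apply: sumr_ge0 => l _.
  by rewrite -expr2 sqr_ge0.
rewrite ler_norml; have := sq j; have := sq k.
have := sqr_ge0 (x i j ord0 + x i k ord0); have := sqr_ge0 (x i j ord0 - x i k ord0).
by move=> h1 h2 h3 h4; apply/andP; split; nra.
Qed.

Lemma norm_gram_diff_le x i l : `|@gram_diff R p n x i l| <= 3 * total_sq x ^+ 2.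
Proof.
have := gram_le_total x i; have := gram_le_total x l.
have := gram_ge0 x i; have := gram_ge0 x l; have := norm_gram_le x i l.
rewrite /gram_diff; move: (gram x i i) (gram x l l) (gram x i l) (total_sq x) => a b c t.
rewrite ler_norml => /andP[c1 c2] b0 a0 bt at_.
have cc : c ^+ 2 <= t ^+ 2 by nra.
have ab : (a - b) ^+ 2 <= t ^+ 2 by nra.
have := sqr_ge0 c; have := sqr_ge0 (a - b).
by rewrite ler_norml; move=> h1 h2; apply/andP; split; lra.
Qed.

Lemma norm_RBLW_coef_le x : (1 < n)%N ->
  `|((n%:R - 2) / n%:R * \tr (@Shat R p n x *m Shat x) + \tr (Shat x) ^+ 2) / (n%:R + 2)|
  <= 2 * total_sq x ^+ 2.
Proof.
move=> n1; have nn : 2 <= n%:R :> R by rewrite ler_nat.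
have S0 : 0 <= \tr (Shat x *m Shat x) by rewrite tr_Shat2_frob2 frob2_ge0.
have nV : 0 <= (n%:R^-1 : R) <= 1.
  by rewrite invr_ge0 ler0n/= invf_le1; lra.
have S1 : \tr (Shat x *m Shat x) <= total_sq x ^+ 2.
  rewrite tr_Shat2.
  rewrite ler_pdivrMl ?exprn_gt0 ?(lt_le_trans _ nn)//.
  apply: (@le_trans _ _ (\sum_(i < n) \sum_(l < n) total_sq x ^+ 2)).
    apply: ler_sum => i _; apply: ler_sum => l _.
    have := norm_gram_le x i l; have := total_sq_ge0 x; rewrite ler_norml.
    by move=> t0 /andP[h1 h2]; nra.
  by rewrite !sumr_const !card_ord -mulrnA -[leLHS]mulr_natl natrM expr2.
have T1 : \tr (Shat x) ^+ 2 <= total_sq x ^+ 2.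
  rewrite tr_Shat; have := total_sq_ge0 x; move: (total_sq x) (n%:R^-1) nV => t m /andP[m0 m1] t0.
  by rewrite exprMn ler_piMl ?sqr_ge0// exprn_ile1.
have k01 : 0 <= ((n%:R - 2) / n%:R : R) <= 1.
  rewrite divr_ge0 ?subr_ge0// ler_pdivrMr ?(lt_le_trans _ nn)// mul1r.
  by rewrite lerBlDr lerDl/=.
have m01 : 0 <= ((n%:R + 2)^-1 : R) <= 1.
  by rewrite invr_ge0 addr_ge0//= invf_le1; lra.
have T0 := sqr_ge0 (\tr (Shat x)).
move: (\tr (Shat x *m _)) (\tr (Shat x) ^+ 2) S0 S1 T0 T1 => s t S0 S1 T0 T1.
move: ((n%:R - 2) / n%:R) k01 => a /andP[a0 a1].
move: ((n%:R + 2)^-1) m01 => b /andP[b0 b1].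
rewrite ger0_norm; last by rewrite mulr_ge0// addr_ge0// mulr_ge0.
have h : a * s + t <= 2 * total_sq x ^+ 2 by nra.
by apply: le_trans h; rewrite ler_piMr// addr_ge0// mulr_ge0.
Qed.

(* Young's inequality, applied to [q = total_sq x ^+ 2] and [r = (denomLW x) ^ (-1/4)]. *)
Lemma direction_bound v (q : R) j0 j1 j k : (0 < n)%N -> j0 != j1 -> 0 <= q ->
  ((q * `|direction (rows v) j k|)%:E <= (2 * n%:R)%:E * ((q ^+ 3)%:E +
    kern (sq_re predT j0 j1 v ^+ 2 + sq_im predT j0 j1 v ^+ 2)))%E.
Proof.
move=> n0 j01 q0; have p0 : (0 < p)%N by case: (p) j0 {j01} => // -[].
have nn : 0 < n%:R :> R by rewrite ltr0n.
have := denomLW_ge (rows v) n0 p0 j01.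
have -> : \sum_i (rows v i j0 ord0 ^+ 2 - rows v i j1 ord0 ^+ 2) = sq_re predT j0 j1 v.
  by apply: eq_bigr => i _; rewrite !rowsE.
have -> : \sum_i 2 * rows v i j0 ord0 * rows v i j1 ord0 = sq_im predT j0 j1 v.
  by apply: eq_bigr => i _; rewrite !rowsE.
set D := _ ^+ 2 + _ ^+ 2 => dD.
have D0 : 0 <= D by rewrite addr_ge0 ?sqr_ge0.
(* When [D = 0] the kernel is [+oo] and the bound holds trivially. *)
rewrite /kern; case: eqVneq => [_|Dn0].
  by rewrite addey// gt0_muley ?leey// lte_fin mulr_gt0.
have r0 := root4_gt0 Dn0; have r4 : root4 D ^+ 4 = D.
  rewrite (exprM _ 2 2) /root4 sqr_sqrtr ?sqrtr_ge0// sqr_sqrtr ?normr_ge0//.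
  by rewrite ger0_norm.
have e0 : (Fhat (rows v) - Shat (rows v)) j k ^+ 2 <= denomLW (rows v).
  rewrite denomLW_frob2//; apply: le_trans (frob2_ge_entry _ j k).
  by rewrite -opprB mxE sqrrN.
rewrite -EFinD -EFinM lee_fin.
have D1 : 0 < D by rewrite lt_neqAle eq_sym Dn0.
have d0 : 0 < denomLW (rows v).
  rewrite -(@pmulr_rgt0 _ (2 * n%:R ^+ 2)) ?(lt_le_trans _ dD)//.
  by rewrite mulr_gt0// exprn_gt0.
rewrite /direction; move: (_ j k) (denomLW _) e0 d0 dD => e c ec c0 Dc.
have r40 : 0 < root4 D ^+ 2 by rewrite exprn_gt0.
(* Squaring, [(e / c)^2 D <= 2 n^2 e^2 / c <= 2 n^2], from [D <= 2 n^2 c] and [e^2 <= c]. *)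
have key : `|e / c| * root4 D ^+ 2 <= 2 * n%:R.
  have l0 : 0 <= `|e / c| * root4 D ^+ 2 by rewrite mulr_ge0// ltW.
  have m0 : 0 <= 2 * n%:R :> R by rewrite mulr_ge0.
  rewrite -(@ler_pXn2r _ 2)// exprMn -normrX.
  rewrite -exprM r4 ger0_norm ?sqr_ge0//.
  apply: (@le_trans _ _ ((e / c) ^+ 2 * (2 * n%:R ^+ 2 * c))).
    by rewrite ler_wpM2l ?sqr_ge0.
  have -> : (e / c) ^+ 2 * (2 * n%:R ^+ 2 * c) = 2 * n%:R ^+ 2 * (e ^+ 2 / c).
    by field; rewrite gt_eqF.
  have : e ^+ 2 / c <= 1 by rewrite ler_pdivrMr// mul1r.
  have : 0 < n%:R ^+ 2 :> R by rewrite exprn_gt0.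
  by rewrite exprMn; move: (n%:R ^+ 2) (e ^+ 2 / c) => m u; nra.
have {}key : `|e / c| <= 2 * n%:R * (root4 D)^-1 ^+ 2.
  by rewrite exprVn -ler_pdivrMr ?invrK ?invr_gt0.
have s0 : 0 < (root4 D)^-1 by rewrite invr_gt0.
rewrite -exprVn; move: (root4 D)^-1 s0 key => r {}r0 key.
apply: (@le_trans _ _ (q * (2 * n%:R * r ^+ 2))); first by rewrite ler_wpM2l.
rewrite mulrCA ler_wpM2l ?mulr_ge0 ?ler0n//.
(* In either case [q r^2] is at most the cube of the larger of [q] and [r]. *)
have [qr|rq] := leP q r.
  apply: (@le_trans _ _ (r ^+ 3)); last by rewrite lerDr exprn_ge0.
  by rewrite [leRHS]exprS ler_wpM2r ?sqr_ge0.
apply: (@le_trans _ _ (q ^+ 3)); last by rewrite lerDl exprn_ge0// ltW.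
by rewrite [leRHS]exprS ler_wpM2l// lerXn2r ?nnegrE// ltW.
Qed.

Lemma measurable_rows d (T : measurableType d) (f : T -> coords R K) i j :
  measurable_fun setT f -> measurable_fun setT (fun w => rows (f w) i j ord0).
Proof.
move=> mf; rewrite (_ : (fun w => _) = (fun w => f w (i, j))).
  exact: (measurableT_comp (measurable_coord (i, j)) mf).
by apply/funext => w; rewrite rowsE.
Qed.

Section measurable_statistics.
Context d (T : measurableType d) (x : T -> 'I_n -> 'cV[R]_p).

Section from_rows.
Hypothesis mx : forall i j, measurable_fun setT (fun w => x w i j ord0).

Lemma measurable_gram i l : measurable_fun setT (fun w => gram (x w) i l).
Proof. by apply: measurable_sum => j; exact: measurable_funM. Qed.

Lemma measurable_gram_diff i l : measurable_fun setT (fun w => gram_diff (x w) i l).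
Proof.
apply: measurable_funB; apply: measurable_funM => //; apply: measurable_funX.
  by apply: measurable_funB; exact: measurable_gram.
exact: measurable_gram.
Qed.

Lemma measurable_total_sq : measurable_fun setT (fun w => total_sq (x w)).
Proof. by apply: measurable_sum => i; exact: measurable_gram. Qed.

Lemma measurable_Shat j k : measurable_fun setT (fun w => Shat (x w) j k).
Proof.
under eq_fun do rewrite ShatE.
apply: measurable_funM => //; apply: measurable_sum => i; exact: measurable_funM.
Qed.

End from_rows.

Hypothesis mS : forall j k, measurable_fun setT (fun w => Shat (x w) j k).

Let measurable_tr : measurable_fun setT (fun w => \tr (Shat (x w))).
Proof. by apply: measurable_sum => i; exact: mS. Qed.

Let measurable_tr2 : measurable_fun setT (fun w => \tr (Shat (x w) *m Shat (x w))).
Proof.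
apply: measurable_sum => i; under eq_fun do rewrite mxE.
by apply: measurable_sum => j; exact: measurable_funM.
Qed.

Let measurable_denomLW : measurable_fun setT (fun w => denomLW (x w)).
Proof.
by apply: measurable_funB => //; apply: measurable_funM => //; exact: measurable_funX.
Qed.

Lemma measurable_RBLW_coef : measurable_fun setT (fun w =>
  ((n%:R - 2) / n%:R * \tr (Shat (x w) *m Shat (x w)) + \tr (Shat (x w)) ^+ 2) / (n%:R + 2)).
Proof.
apply: measurable_funM => //; apply: measurable_funD; first exact: measurable_funM.
exact: measurable_funX.
Qed.

Lemma measurable_direction j k : measurable_fun setT (fun w => direction (x w) j k).
Proof.
apply: measurable_funM; last exact: measurable_funV.
under eq_fun do rewrite -opprB mxE deviationE -mulr_natr.
apply: measurable_funN; apply: measurable_funB => //.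
by apply: measurable_funM => //; apply: measurable_funM.
Qed.

(** Uses measurability of the entries of [Shat] only, so it also holds when [T] carries the
    sigma-algebra generated by [Shat], as a conditional expectation requires. *)
Lemma measurable_Sigma_RBLW j k : measurable_fun setT (fun w => Sigma_RBLW (x w) j k).
Proof.
under eq_fun do rewrite Sigma_RBLW_entry.
apply: measurable_funD; first exact: mS.
apply: measurable_funM; [exact: measurable_RBLW_coef|exact: measurable_direction].
Qed.

End measurable_statistics.

(** * Effect of the rotation on the statistics *)

Section rotated_rows.
Variables i l : 'I_n.
Hypothesis il : i != l.

Let li : (l == i) = false. Proof. by rewrite eq_sym; apply/negbTE. Qed.

Let sqrt2 : Num.sqrt 2 ^+ 2 = 2 :> R. Proof. by rewrite sqr_sqrtr. Qed.
Let sqrt2_neq0 : Num.sqrt 2 != 0 :> R. Proof. by rewrite gt_eqF// sqrtr_gt0. Qed.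

Let rot_pair (a b c e : R) :
  (a + b) / Num.sqrt 2 * ((c + e) / Num.sqrt 2) = (a + b) * (c + e) / 2.
Proof. by rewrite -[in RHS]sqrt2; field. Qed.

Lemma Shat_rot v j k : Shat (rows (rot_rows i l v)) j k = Shat (rows v) j k.
Proof.
rewrite !ShatE; congr (_ * _); rewrite (bigD1 i)//= (bigD1 l)/= ?li//.
rewrite [RHS](bigD1 i)//= [in RHS](bigD1 l)/= ?li// !addrA; congr (_ + _); last first.
  by apply: eq_bigr => m /andP[mi ml]; rewrite !rowsE /rot_rows/= (negbTE mi) (negbTE ml).
rewrite !rowsE /rot_rows/= !eqxx li !rot_pair.
by field.
Qed.

(** The rotation exchanges [(gram i i - gram l l) / 2] and [gram i l], and the bracket is twice the
    difference of their squares. *)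
Lemma gram_diff_rot v : gram_diff (rows (rot_rows i l v)) i l = - gram_diff (rows v) i l.
Proof.
have gii : gram (rows (rot_rows i l v)) i i =
    (gram (rows v) i i + 2 * gram (rows v) i l + gram (rows v) l l) / 2.
  rewrite /gram mulr_sumr -!big_split/= mulr_suml; apply: eq_bigr => j _.
  by rewrite !rowsE /rot_rows/= !eqxx rot_pair; field.
have gll : gram (rows (rot_rows i l v)) l l =
    (gram (rows v) i i - 2 * gram (rows v) i l + gram (rows v) l l) / 2.
  rewrite /gram mulr_sumr -sumrB -!big_split/= mulr_suml; apply: eq_bigr => j _.
  by rewrite !rowsE /rot_rows/= !eqxx li rot_pair; field.
have gil : gram (rows (rot_rows i l v)) i l = (gram (rows v) i i - gram (rows v) l l) / 2.
  rewrite /gram -sumrB mulr_suml; apply: eq_bigr => j _.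
  by rewrite !rowsE /rot_rows/= !eqxx li rot_pair; field.
by rewrite /gram_diff gii gll gil; field.
Qed.

End rotated_rows.

End coordinate_form.

(** * Conditional expectation of the Ledoit-Wolf estimator *)

Section null_functions.
Context {d : measure_display} {T : measurableType d} {R : realType}.
Variables (P : probability T R) (G : set (set T)).
Hypothesis GT : G `<=` measurable.

(** The functions with conditional expectation 0 given [G]. They form a linear space, so the
    difference of the estimators is treated one pair of rows at a time. *)
Definition null_fun (f : T -> R) := P.-integrable setT (EFin \o f) /\
  forall A, G A -> (\int[P]_(w in A) (f w)%:E = 0)%E.

Lemma null_fun0 : null_fun (fun=> 0).
Proof.
by split=> [|A GA]; [exact: integrable0|apply: integral0_eq].
Qed.

Lemma null_funD f g : null_fun f -> null_fun g -> null_fun (fun w => f w + g w).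
Proof.
move=> [f1 f2] [g1 g2]; split=> [|A GA]; first exact: (integrableD measurableT f1 g1).
have mA := GT GA; under eq_integral do rewrite EFinD.
rewrite integralD//; last 2 first.
- exact: (integrableS measurableT).
- exact: (integrableS measurableT).
by rewrite f2// g2// adde0.
Qed.

Lemma null_funZ (c : R) f : null_fun f -> null_fun (fun w => c * f w).
Proof.
move=> [f1 f2]; split=> [|A GA]; first exact: (integrableZl measurableT c f1).
have mA := GT GA; under eq_integral do rewrite EFinM.
rewrite integralZl//; last exact: (integrableS measurableT).
by rewrite f2// mule0.
Qed.

Lemma null_fun_sum (I : Type) (r : seq I) (Q : pred I) (F : I -> T -> R) :
  (forall i, Q i -> null_fun (F i)) -> null_fun (fun w => \sum_(i <- r | Q i) F i w).
Proof.
move=> nF; elim: r => [|i r IHr].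
  by under eq_fun do rewrite big_nil; exact: null_fun0.
have [Qi|nQi] := boolP (Q i).
  rewrite (_ : (fun w => _) = (fun w => F i w + \sum_(i <- r | Q i) F i w)).
    by apply: null_funD => //; exact: nF.
  by apply/funext => w; rewrite big_cons Qi.
by under eq_fun do rewrite big_cons (negbTE nQi).
Qed.

Lemma is_cond_exp_null (Y Z : T -> R) : P.-integrable setT (EFin \o Z) ->
  (forall B, measurable B -> G (Z @^-1` B)) -> null_fun (fun w => Y w - Z w) ->
  is_cond_exp P G Y Z.
Proof.
move=> iZ GZ [iYZ nYZ].
have YE : Y = (fun w => (Y w - Z w) + Z w) by apply/funext => w; rewrite subrK.
split.
  by rewrite YE; exact: (integrableD measurableT iYZ iZ).
split=> //; split=> // A GA; have mA := GT GA.
rewrite YE; under eq_integral do rewrite EFinD.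
rewrite integralD//; last 2 first.
- exact: (integrableS measurableT).
- exact: (integrableS measurableT).
by rewrite nYZ// add0e.
Qed.

End null_functions.

Lemma ord_le1 m (i l : 'I_m) : (m <= 1)%N -> i = l.
Proof. by case: m i l => [|[|//]] i l _; [case: i|rewrite !ord1]. Qed.

(** * Application to the Gaussian sample *)

Section rao_blackwell.
Context {R : realType} {p n : nat} {d} {T : measurableType d} {P : probability T R}.
Variables (Sigma : 'M[R]_p) (X : 'I_n -> T -> 'cV[R]_p).
Hypothesis p2 : (1 < p)%N.
Hypothesis n0 : (0 < n)%N.
Hypothesis posdef : sym_posdef Sigma.
Hypothesis gauss : forall i, is_gaussian_vec P Sigma (X i).
Hypothesis indep : mutually_independent P X.

Local Notation K := ('I_n * 'I_p)%type.
Local Notation fam := (family_of X).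
Local Notation S := (fun w => Shat (fun i => X i w)).

Let mfam : measurable_fun setT fam := measurable_family gauss.

Lemma rows_family w : rows (fam w) = fun i => X i w.
Proof. by apply/funext => i; apply/colP => j; rewrite mxE. Qed.

Let mX i j : measurable_fun setT (fun w => X i w j ord0).
Proof. by have [+ _] := gauss i; apply. Qed.

Lemma sigma_mx_measurable : sigma_mx S `<=` measurable.
Proof.
apply: smallest_sub; first exact: sigma_algebra_measurable.
move=> _ [jk [B [mB ->]]]; rewrite -[X in measurable X]setTI.
by apply: (measurable_Shat mX) => //; exact: measurableT.
Qed.

(** The rotation acts on coordinates and not on [T], so events must be transported. The last clause
    says that [E] is saturated for [Shat], which makes its indicator invariant; the events admitting
    such an [E] form a sigma-algebra. *)
Lemma sigma_mx_coords A : sigma_mx S A -> exists E : set (coords R K),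
  [/\ measurable E, A = fam @^-1` E &
      forall v v', Shat (rows v) = Shat (rows v') -> E v -> E v'].
Proof.
move: A; apply: smallest_sub; first split.
- by exists set0; split => //; rewrite preimage_set0.
- move=> A [E [mE -> EE]]; exists (~` E); split; first exact: measurableC.
    by rewrite setTD preimage_setC.
  by move=> v v' vv' nE Ev'; apply: nE; exact: (EE v').
- move=> F /choice[E EP]; exists (\bigcup_k E k); split.
  + by apply: bigcup_measurable => k _; have [] := EP k.
  + rewrite preimage_bigcup; apply: eq_bigcupr => k _; by have [] := EP k.
  + move=> v v' vv' [k _ Ek]; exists k => //.
    by have [_ _ h] := EP k; exact: (h v).
move=> _ [jk [B [mB ->]]].
exists ((fun v : coords R K => Shat (rows v) jk.1 jk.2) @^-1` B); split.
- rewrite -[X in measurable X]setTI.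
  apply: (@measurable_Shat _ _ _ _ _ rows) => // i j.
  exact: (measurable_rows _ _ (@measurable_id _ _ setT)).
- by apply/funext => w; rewrite /preimage/= rows_family.
- by move=> v v' vv'; rewrite /= vv'.
Qed.

Lemma total_sq_moment : (\int[P]_w (total_sq (rows (fam w)) ^+ 6)%:E < +oo)%E.
Proof.
have totE v : total_sq (rows v) = \sum_k v k ^+ 2 :> R.
  transitivity (\sum_i \sum_j v (i, j) ^+ 2).
    by apply: eq_bigr => i _; apply: eq_bigr => j _; rewrite !rowsE expr2.
  by rewrite pair_bigA; apply: eq_bigr => -[i j].
have mf k : measurable_fun setT (fun w => fam w k).
  exact: (measurableT_comp (measurable_coord k) mfam).
have m12 k : measurable_fun setT (fun w => (fam w k ^+ 12)%:E).
  by apply/measurable_EFinP; exact: measurable_funX.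
have pos k w : (0 <= (fam w k ^+ 12)%:E)%E by rewrite lee_fin (exprM _ 6 2) sqr_ge0.
pose C : R := #|[the finType of K]|%:R ^+ 6.
have C0 : 0 <= C by rewrite exprn_ge0.
apply: (@le_lt_trans _ _ (\int[P]_w (C%:E * \sum_k (fam w k ^+ 12)%:E))%E).
  apply: ge0_le_integral => //.
  - by move=> w _; rewrite lee_fin exprn_ge0// total_sq_ge0.
  - apply/measurable_EFinP; apply: measurable_funX.
    apply: (@measurable_total_sq _ _ _ _ _ (rows \o fam)) => i j.
    exact: measurable_rows.
  - by apply: emeasurable_funM => //; exact: emeasurable_sum.
  - move=> w _; rewrite sumEFin -EFinM lee_fin totE.
    have := @sum_exp_le R _ (fun k => fam w k ^+ 2) 5 (fun k => sqr_ge0 _).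
    by under [X in _ <= _ * X -> _]eq_bigr do rewrite -exprM.
rewrite ge0_integralZl//; last 2 first.
- exact: emeasurable_sum.
- by move=> w _; exact: sume_ge0.
rewrite ge0_integral_sum//; apply: lte_mul_pinfty => //.
apply: lte_sum_pinfty => -[i j] _.
have i0 k : k.1 != i -> unit_form (i, j) k = 0 :> R.
  by move=> ki; rewrite /unit_form; case: eqP => // kE; rewrite kE eqxx in ki.
have c0 : form_col (unit_form (i, j)) i != 0 :> 'cV[R]_p.
  apply/eqP => /colP/(_ j)/eqP; rewrite !mxE /unit_form eqxx.
  by rewrite oner_eq0.
have [s s0 law] := row_form_law posdef gauss i0 c0.
apply: (normal_moment12 s0 (mf _)) => B mB; rewrite -law//; congr (P _).
by apply/funext => w; rewrite /preimage/= lin_unit_form.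
Qed.

Let total_sq6_integrable : P.-integrable setT (fun w => (total_sq (rows (fam w)) ^+ 6)%:E).
Proof.
apply/integrableP; split.
  apply/measurable_EFinP; apply: measurable_funX.
  apply: (@measurable_total_sq _ _ _ _ _ (rows \o fam)) => i j.
  exact: measurable_rows.
apply: le_lt_trans total_sq_moment; rewrite le_eqVlt; apply/orP; left; apply/eqP.
by apply: eq_integral => w _; rewrite /= ger0_norm// exprn_ge0// total_sq_ge0.
Qed.

Lemma Shat_integrable j k : P.-integrable setT (fun w => (S w j k)%:E).
Proof.
have i1 := integrableD measurableT
  (finite_measure_integrable_cst P 1 measurableT) total_sq6_integrable.
apply: (le_integrable measurableT _ _ i1).
  by apply/measurable_EFinP; exact: measurable_Shat.
move=> w _; rewrite -rows_family /= lee_fin [leRHS]ger0_norm; last first.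
  by rewrite addr_ge0// exprn_ge0// total_sq_ge0.
apply: le_trans (norm_Shat_le _ j k) _.
have := total_sq_ge0 (rows (fam w)); move: (total_sq _) => t t0.
have [t1|t1] := leP t 1; first by rewrite -[leLHS]addr0 lerD// exprn_ge0.
apply: (@le_trans _ _ (t ^+ 6)); last by rewrite lerDr.
by rewrite -[leLHS]expr1 ler_weXn2l// ltW.
Qed.

(** Stated for any [phi] of degree at most 4 in the sample, to serve both [gram_diff] and the
    coefficient of [Sigma_RBLW]. Two rows are needed for [negative_moment]. *)
Lemma direction_integrable (phi : coords R K -> R) (c : R) j k : (1 < n)%N ->
  measurable_fun setT phi -> (forall v, `|phi v| <= c * total_sq (rows v) ^+ 2) ->
  P.-integrable setT (fun w => (phi (fam w) * direction (rows (fam w)) j k)%:E).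
Proof.
move=> n1 mphi phic.
pose i0 : 'I_n := Ordinal n0; pose i1 : 'I_n := Ordinal n1.
pose j0 : 'I_p := Ordinal (ltnW p2); pose j1 : 'I_p := Ordinal p2.
have i01 : i0 != i1 by []. have j01 : j0 != j1 by [].
pose D (v : coords R K) := sq_re predT j0 j1 v ^+ 2 + sq_im predT j0 j1 v ^+ 2.
have mD : measurable_fun setT (fun w => kern (D (fam w))).
  apply: (measurableT_comp measurable_kern).
  apply: (measurableT_comp _ mfam).
  by apply: measurable_funD; apply: measurable_funX;
    [exact: measurable_sq_re|exact: measurable_sq_im].
have mM : measurable_fun setT (fun w => (total_sq (rows (fam w)) ^+ 6)%:E).
  exact: measurable_int total_sq6_integrable.
have mphid : measurable_fun setT (fun w => phi (fam w) * direction (rows (fam w)) j k).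
  apply: measurable_funM; first exact: (measurableT_comp mphi mfam).
  apply: (@measurable_direction _ _ _ _ _ (rows \o fam)) => j' k'.
  by apply: measurable_Shat => i'' j''; exact: measurable_rows.
pose c' : R := `|c| * (2 * n%:R); have c'0 : 0 <= c' by rewrite !mulr_ge0.
have M0 w : (0 <= (total_sq (rows (fam w)) ^+ 6)%:E)%E.
  by rewrite lee_fin exprn_ge0// total_sq_ge0.
apply/integrableP; split; first exact/measurable_EFinP.
apply: (@le_lt_trans _ _ (\int[P]_w
    (c'%:E * ((total_sq (rows (fam w)) ^+ 6)%:E + kern (D (fam w)))))%E).
  apply: ge0_le_integral => //.
  - by apply: measurableT_comp => //; exact/measurable_EFinP.
  - by apply: emeasurable_funM => //; exact: emeasurable_funD.
  - move=> w _; rewrite abse_EFin normrM.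
    have := @direction_bound _ _ _ (fam w) _ _ _ j k n0 j01 (sqr_ge0 (total_sq (rows (fam w)))).
    rewrite -exprM -/(D (fam w)) => h.
    apply: (@le_trans _ _ (`|c|%:E * (total_sq (rows (fam w)) ^+ 2 *
        `|direction (rows (fam w)) j k|)%:E)%E).
      rewrite -EFinM lee_fin mulrA ler_wpM2r//.
      apply: le_trans (phic _) _; rewrite ler_wpM2r ?sqr_ge0//; exact: ler_norm.
    have -> : c'%:E = (`|c|%:E * (2 * n%:R)%:E)%E by [].
    by rewrite -muleA lee_wpmul2l// lee_fin.
rewrite ge0_integralZl//; last 2 first.
- exact: emeasurable_funD.
- by move=> w _; rewrite adde_ge0// kern_ge0.
rewrite ge0_integralD//; last by move=> w _; exact: kern_ge0.
apply: lte_mul_pinfty => //; apply: lte_add_pinfty; first exact: total_sq_moment.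
exact: (negative_moment posdef gauss indep i01 j01).
Qed.

(** The rotation exchanges the positive and negative parts of [h], which are nonnegative, so
    invariance of the law equates their integrals; integrability makes these finite and their
    difference 0. *)
Lemma rot_antisym_integral (i l : 'I_n) (h : coords R K -> R) : i != l ->
  measurable_fun setT h -> (forall v, h (rot_rows i l v) = - h v) ->
  P.-integrable setT (fun w => (h (fam w))%:E) -> (\int[P]_w (h (fam w))%:E = 0)%E.
Proof.
move=> il mh hrot ih.
rewrite integralE.
have mrf : measurable_fun setT (rot_rows i l \o fam).
  exact: (measurableT_comp (measurable_rot i l) mfam).
pose g v := maxe (h v)%:E 0.
have mg : measurable_fun setT g.
  by apply: measurable_maxe => //; exact/measurable_EFinP.
have g0 v : (0 <= g v)%E by rewrite /g le_max lexx orbT.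
have E := law_eq_ge0_integral mfam mrf (rot_law posdef gauss indep il) mg g0.
have -> : (\int[P]_w (fun w => (h (fam w))%:E)^\- w = \int[P]_w g (fam w))%E.
  rewrite E; apply: eq_integral => w _.
  by rewrite funenegE /g /= hrot EFinN.
have pE : (\int[P]_w (fun w => (h (fam w))%:E)^\+ w = \int[P]_w g (fam w))%E.
  by apply: eq_integral => w _; rewrite funeposE.
rewrite pE; apply: subee; rewrite -pE; exact: (integrable_pos_fin_num measurableT ih).
Qed.

Lemma gram_diff_null (i l : 'I_n) j k : i != l ->
  null_fun P (sigma_mx S) (fun w => gram_diff (fun i => X i w) i l *
    direction (fun i => X i w) j k).
Proof.
move=> il; have n1 : (1 < n)%N.
  by rewrite ltnNge; apply/negP => n1; rewrite (ord_le1 i l n1) eqxx in il.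
have mr i' j' : measurable_fun setT (fun v : coords R K => rows v i' j' ord0).
  exact: (measurable_rows _ _ (@measurable_id _ _ setT)).
have mgd : measurable_fun setT (fun v : coords R K => gram_diff (rows v) i l).
  exact: measurable_gram_diff.
have iphi := direction_integrable j k n1 mgd (fun v => norm_gram_diff_le (rows v) i l).
have iphi' : P.-integrable setT (EFin \o (fun w => gram_diff (fun i => X i w) i l *
    direction (fun i => X i w) j k)).
  by rewrite (_ : EFin \o _ = (fun w => (gram_diff (rows (fam w)) i l *
    direction (rows (fam w)) j k)%:E))//; apply/funext => w /=; rewrite rows_family.
split=> // A GA; have mA := sigma_mx_measurable GA.
have [E [mE AE EE]] := sigma_mx_coords GA.
pose h (v : coords R K) := gram_diff (rows v) i l * direction (rows v) j k * \1_E v.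
have hfam : (fun w => (h (fam w))%:E) = (EFin \o (fun w => gram_diff (fun i => X i w) i l *
    direction (fun i => X i w) j k)) \_ A.
  apply/funext => w; rewrite /h rows_family patchE AE indicE.
  have -> : (w \in fam @^-1` E) = (fam w \in E).
    by apply/idP/idP => /set_mem h'; exact/mem_set.
  by case: ifPn; rewrite ?mulr1 ?mulr0.
rewrite integral_mkcond -hfam; apply: (rot_antisym_integral il).
- apply: measurable_funM; last exact: measurable_indic.
  apply: measurable_funM => //; apply: measurable_direction => j' k'.
  exact: measurable_Shat.
(* Apart from [gram_diff], every factor is a function of [Shat], including the indicator by
   saturation of [E]. *)
- move=> v; have Sv : Shat (rows (rot_rows i l v)) = Shat (rows v).
    by apply/matrixP => j' k'; exact: Shat_rot.
  rewrite /h gram_diff_rot// /direction /Fhat /denomLW Sv !mulNr.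
  congr (- (_ * _)); rewrite !indicE; congr (_%:R); congr nat_of_bool.
  by apply/idP/idP; rewrite !inE; apply: EE.
- rewrite hfam; apply/(integrable_mkcond _ mA).
  exact: (integrableS measurableT).
Qed.

Lemma cond_exp_Sigma_LW j k : is_cond_exp P (sigma_mx S)
  (fun w => Sigma_LW (fun i => X i w) j k) (fun w => Sigma_RBLW (fun i => X i w) j k).
Proof.
have nLR : null_fun P (sigma_mx S)
    (fun w => Sigma_LW (fun i => X i w) j k - Sigma_RBLW (fun i => X i w) j k).
  rewrite (_ : (fun w => _) = (fun w => (n%:R ^+ 2 * (n%:R + 2))^-1 * \sum_i \sum_(l | l != i)
      gram_diff (fun i => X i w) i l * direction (fun i => X i w) j k)); last first.
    by apply/funext => w; exact: Sigma_LW_sub_RBLW.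
  apply: null_funZ; first exact: sigma_mx_measurable.
  apply: null_fun_sum; first exact: sigma_mx_measurable.
  move=> i _; apply: null_fun_sum; first exact: sigma_mx_measurable.
  by move=> l li; apply: gram_diff_null; rewrite eq_sym.
apply: is_cond_exp_null => //; first exact: sigma_mx_measurable.
- have [n1|n1] := ltnP 1 n.
    have mc : measurable_fun setT (fun v : coords R K =>
        ((n%:R - 2) / n%:R * \tr (Shat (rows v) *m Shat (rows v)) + \tr (Shat (rows v)) ^+ 2)
        / (n%:R + 2)).
      apply: measurable_RBLW_coef => j' k'; apply: measurable_Shat => i' j''.
      exact: (measurable_rows _ _ (@measurable_id _ _ setT)).
    have := integrableD measurableT (Shat_integrable j k)
      (direction_integrable j k n1 mc (fun v => norm_RBLW_coef_le (rows v) n1)).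
    congr (P.-integrable setT _); apply/funext => w /=.
    by rewrite rows_family Sigma_RBLW_entry.
  (* With one row the sum over pairs is empty, so the estimators agree, and the numerator of
     [rho_LW] vanishes: both equal [Shat], which is integrable without any negative moment. *)
  have n1E : n = 1%N by apply/eqP; rewrite eqn_leq n1.
  have := Shat_integrable j k; congr (P.-integrable setT _); apply/funext => w /=.
  congr EFin; set x := fun i => X i w.
  have eq1 (i l : 'I_n) : i = l by exact: ord_le1.
  have : Sigma_LW x j k - Sigma_RBLW x j k = 0.
    rewrite Sigma_LW_sub_RBLW// big1 ?mulr0// => i _; rewrite big1// => l.
    by rewrite (eq1 l i) eqxx.
  move/subr0_eq => <-; rewrite Sigma_LW_entry// tr_Shat2.
  have -> : \sum_i \sum_l gram x i l ^+ 2 = \sum_i gram x i i ^+ 2.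
    apply: eq_bigr => i _; rewrite (bigD1 i)//= big1 ?addr0// => l.
    by rewrite (eq1 l i) eqxx.
  have -> : n%:R = 1 :> R by rewrite n1E.
  by rewrite expr1n invr1 !mul1r subrr !mul0r addr0.
(* On [T] with the sigma-algebra generated by [Shat], the claim is ordinary measurability of
   [Sigma_RBLW]. *)
- pose G : set (set T) := [set E | exists (jk : 'I_p * 'I_p) (B : set R),
    measurable B /\ E = (fun w => S w jk.1 jk.2) @^-1` B].
  have mS j' k' : measurable_fun setT (fun w : g_sigma_algebraType G => S w j' k').
    by move=> _ C mC; rewrite setTI; apply: sub_sigma_algebra; exists (j', k'), C.
  move=> B mB.
  have := @measurable_Sigma_RBLW R p n _ (g_sigma_algebraType G) (fun w i => X i w) mS j k measurableT B mB.
  by rewrite setTI.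
Qed.

Lemma mean_square_entry j k :
  (\int[P]_w ((Sigma_RBLW (fun i => X i w) - Sigma) j k ^+ 2)%:E <=
   \int[P]_w ((Sigma_LW (fun i => X i w) - Sigma) j k ^+ 2)%:E)%E.
Proof.
have h (A : 'M[R]_p) : (A - Sigma) j k = A j k - Sigma j k.
  by rewrite !mxE.
under eq_integral do rewrite h.
under [leRHS]eq_integral do rewrite h.
exact: (cond_exp_mean_square (Sigma j k) (cond_exp_Sigma_LW j k)).
Qed.

Lemma integral_frob2 (Y : T -> 'M[R]_p) :
  (forall j k, measurable_fun setT (fun w => Y w j k)) ->
  (\int[P]_w (frob2 (Y w))%:E = \sum_j \sum_k \int[P]_w (Y w j k ^+ 2)%:E)%E.
Proof.
move=> mY; have m2 j k : measurable_fun setT (fun w => (Y w j k ^+ 2)%:E).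
  by apply/measurable_EFinP; exact: measurable_funX.
have p0 j k w : (0 <= (Y w j k ^+ 2)%:E)%E by rewrite lee_fin sqr_ge0.
under eq_integral do (rewrite /frob2 -sumEFin; under eq_bigr do rewrite -sumEFin).
rewrite ge0_integral_sum//; last 2 first.
- by move=> j; exact: emeasurable_sum.
- by move=> j w _; exact: sume_ge0.
by apply: eq_bigr => j _; rewrite ge0_integral_sum.
Qed.

Lemma mean_square_frob2 :
  (\int[P]_w (frob2 (Sigma_RBLW (fun i => X i w) - Sigma))%:E
     <= \int[P]_w (frob2 (Sigma_LW (fun i => X i w) - Sigma))%:E)%E.
Proof.
have mY (A : T -> 'M[R]_p) j k : P.-integrable setT (fun w => (A w j k)%:E) ->
    measurable_fun setT (fun w => (A w - Sigma) j k).
  move=> iA; under eq_fun do rewrite mxE [X in _ + X]mxE.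
  apply: measurable_funD => //.
  by apply/measurable_EFinP; exact: measurable_int iA.
rewrite !integral_frob2; last 2 first.
- by move=> j k; apply: mY; have [+ _] := cond_exp_Sigma_LW j k.
- by move=> j k; apply: mY; have [_ [+ _]] := cond_exp_Sigma_LW j k.
by apply: lee_sum => j _; apply: lee_sum => k _; exact: mean_square_entry.
Qed.

End rao_blackwell.

Theorem theorem2 (R : realType) (p n : nat) (d : measure_display)
    (T : measurableType d) (P : probability T R)
    (Sigma : 'M[R]_p) (X : 'I_n -> T -> 'cV[R]_p) :
  (2 <= p)%N -> (1 <= n)%N -> sym_posdef Sigma ->
  (forall i, is_gaussian_vec P Sigma (X i)) ->
  mutually_independent P X ->
  (forall j k : 'I_p,
     is_cond_exp P (sigma_mx (fun w => Shat (fun i => X i w)))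
       (fun w => Sigma_LW (fun i => X i w) j k)
       (fun w => Sigma_RBLW (fun i => X i w) j k)) /\
  (\int[P]_w (frob2 (Sigma_RBLW (fun i => X i w) - Sigma))%:E
     <= \int[P]_w (frob2 (Sigma_LW (fun i => X i w) - Sigma))%:E)%E.
Proof.
move=> p2 n0 posdef gauss indep; split=> [j k|].
  exact: (cond_exp_Sigma_LW p2 n0 posdef gauss indep).
exact: (mean_square_frob2 p2 n0 posdef gauss indep).
Qed.
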